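(* In the setting and notation of the context, assume that $\epsilon^{d/2}n\to\infty$ and that $\epsilon^d n$ converges to a limit in $[0,1/\lVert\rho_0\rVert_{L^1(\mathbb{T}^d)})$. Then the unidirectional collision number $C^{(n)}$, viewed as a random element of $D(0,T;C^\infty(\mathbb{T}^d\times\{1,\dots,d\}\times\{+,-\})^* )$, converges narrowly in the Skorohod–Mitoma topology to the unique deterministic path $c=(c_{l,\pm})$ satisfying, for all $l,\pm$, $$\partial_t c_{l,\pm}(x,t)=\rho^2(x,t),\qquad c_{l,\pm}(x,0)\equiv0,$$ i.e. $c_{l,\pm}(dx,t)=\big(\int_0^t\rho^2(x,s)\,ds\big)dx$.
   Context: Fix $d\in\mathbb{N}$ and $T>0$. Let $\mathbb{T}^d=\mathbb{R}^d/\mathbb{Z}^d$. For each $n\in\mathbb{N}$ let $\epsilon=\epsilon_n\in\{1/N:N\in\mathbb{N}\}$ with $\epsilon_n\to0$, and let $\mathbb{T}_\epsilon^d=(\epsilon\mathbb{Z}/\mathbb{Z})^d$; $\mathds 1_l$ is the $l$-th unit vector; $x\sim y$ means $y=x\pm\epsilon\mathds1_l$ for some $l$ and sign. Dynamics: $(\eta(t),\widetilde W(t),\widetilde C(t))$ is the continuous-time Markov process with $\eta(t)\in\{0,1\}^{\mathbb{T}_\epsilon^d}$, $\widetilde W(t),\widetilde C(t)\in\mathbb{N}_0^{\mathbb{T}_\epsilon^d\times\mathbb{T}_\epsilon^d}$ such that for each ordered pair $(x,y)$ with $x\sim y$: at rate $\epsilon^{-2}\eta(x)(1-\eta(y))$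 the particle at $x$jumps to $y$ and $\widetilde W_{xy}$ increases by $1$; at rate $\epsilon^{-2}\eta(x)\eta(y)$, $\widetilde C_{xy}$ increases by $1$ ($\eta$ unchanged). Initial condition: $\rho_0\in C(\mathbb{T}^d)$ nonnegative, not identically zero; $\eta(x,0)$, $x\in\mathbb{T}_\epsilon^d$, independent Bernoulli with parameter $n\int_{B_\epsilon(x)}\rho_0\le1$, $B_\epsilon(x)=\prod_i[x_i-\epsilon/2,x_i+\epsilon/2]$; $\widetilde W(0)=\widetilde C(0)=0$. $\rho(x,t)$ solves $\partial_t\rho=\Delta\rho$ on $\mathbb{T}^d$, $\rho(\cdot,0)=\rho_0$. Unidirectional collision number: $C^{(n)}_{l,\pm}(t)=\frac{\epsilon^2}{\epsilon^d n^2}\sum_{x\in\mathbb{T}_\epsilon^d}\widetilde C_{x,x\pm\epsilon\mathds1_l}(t)\,\delta_{x\pm\frac\epsilon2\mathds1_l}$ for $l=1,\dots,d$, $\pm\in\{+,-\}$, paired with $\phi\in C^\infty(\mathbb{T}^d\times\{1,\dots,d\}\times\{+,-\})$ via $\langle\phi,c\rangle=\sum_l\sum_\pm\int\phi_{l,\pm}\,dc_{l,\pm}$. Topology: for finite $I$, $C^\infty(\mathbb{T}^d\times I)$ has the Fréchet topology of uniform convergence of all derivatives; its dual has the strong topology (seminorms $\lVert\xi\rVert_B=\sup_{\phi\in B}|\langle\phi,\xi\rangle|$, $B$ bounded). $D(0,T;C^\infty(\mathbb{T}^d\times I)^* )$ is the space of càdlàg paths with the Skorohod–Mitoma topology generated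 by the Skorohod metrics $d_B(\xi_1,\xi_2)=\inf_\tau\{\sup_t\lVert\xi_1(t)-\xi_2(\tau(t))\rVert_B+\sup_{s\ne t}|\log\frac{\tau(t)-\tau(s)}{t-s}|\}$ over bounded $B$. Narrow convergence means weak convergence of laws. *)

(* Defs.v *)
From HB Require Import structures.
From mathcomp Require Export all_boot all_order all_algebra.
From mathcomp Require Export all_classical all_reals all_analysis.
Set Implicit Arguments. Unset Strict Implicit. Unset Printing Implicit Defensive.
Import Order.TTheory GRing.Theory Num.Theory.
Import numFieldNormedType.Exports.
Local Open Scope classical_set_scope.
Local Open Scope ring_scope.

(* Generic continuous-time Markov chain on a state space S with        *)
(* finitely many jumps out of each state, given by                     *)
(*   jumps s = list of (rate, target state).                           *)
(* Generator Q(s,s') = sum_{(r,t) in jumps s} r ([t=s'] - [s=s']).      *)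
Section CTMC.
Variables (R : realType) (S : eqType) (jumps : S -> seq (R * S)).

(* Qpow k s s' = (Q^k)(s,s') ; Q^(k+1) = Q Q^k *)
Fixpoint Qpow (k : nat) (s s' : S) : R :=
  match k with
  | 0%N => (s == s')%:R
  | k'.+1 => \sum_(j <- jumps s) j.1 * (Qpow k' j.2 s' - Qpow k' s s')
  end.

Definition ptrans (t : R) (s s' : S) : R :=
  limn (fun m => \sum_(k < m) (t ^+ k / (k`!)%:R * Qpow k s s')).

Fixpoint times_ok (t0 : R) (l : seq (R * S)) : Prop :=
  match l with
  | [::] => True
  | (t, _) :: l' => t0 <= t /\ times_ok t l'
  end.

Fixpoint fdd_prod (t0 : R) (s0 : S) (l : seq (R * S)) : R :=
  match l with
  | [::] => 1
  | (t, s) :: l' => ptrans (t - t0) s0 s * fdd_prod t s l'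
  end.

Variables (dO : measure_display) (Omega : measurableType dO).

Fixpoint fdd_event (X : R -> Omega -> S) (l : seq (R * S)) : set Omega :=
  match l with
  | [::] => setT
  | (t, s) :: l' => [set w | X t w = s] `&` fdd_event X l'
  end.

(* X is (on [0,oo)) the continuous-time Markov process with initial law mu
   and jump rates given by [jumps]: measurable, cadlag paths (discrete state
   space), and finite-dimensional distributions given by the transition
   function exp(tQ). *)
Definition is_markov (P : probability Omega R) (X : R -> Omega -> S)
    (mu : S -> R) : Prop :=
  (forall t s, 0 <= t -> measurable [set w | X t w = s]) /\
  (forall w t, 0 <= t -> exists delta, 0 < delta /\
      forall u, t <= u -> u < t + delta -> X u w = X t w) /\
  (forall w t, 0 < t -> exists delta (s : S), 0 < delta /\
      forall u, t - delta < u -> u < t -> X u w = s) /\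
  (forall s0 l, times_ok 0 l ->
      P ([set w | X 0 w = s0] `&` fdd_event X l) = (mu s0 * fdd_prod 0 s0 l)%:E).

End CTMC.

Section Space.
Variables (R : realType) (d : nat).

Definition unitv (i : 'I_d) : 'rV[R]_d := \row_j (j == i)%:R.

Definition setcoord (x : 'rV[R]_d) (i : 'I_d) (y : R) : 'rV[R]_d :=
  \row_j (if j == i then y else x 0 j).

Definition torus_periodic (f : 'rV[R]_d -> R) := forall x i, f (x + unitv i) = f x.

Fixpoint pder (s : seq 'I_d) (f : 'rV[R]_d -> R) : 'rV[R]_d -> R :=
  match s with
  | [::] => f
  | i :: s' => fun x => derive (pder s' f) x (unitv i)
  end.

Definition smooth (f : 'rV[R]_d -> R) :=
  forall s, continuous (pder s f) /\
            forall i x, derivable (pder s f) x (unitv i).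

Fixpoint iint_aux (s : seq 'I_d) (lo hi : 'I_d -> R) (f : 'rV[R]_d -> R)
    (x : 'rV[R]_d) : R :=
  match s with
  | [::] => f x
  | i :: s' => \int[lebesgue_measure]_(y in `[lo i, hi i])
                  iint_aux s' lo hi f (setcoord x i y)
  end.

Definition boxint (lo hi : 'I_d -> R) (f : 'rV[R]_d -> R) : R :=
  iint_aux (enum 'I_d) lo hi f 0.

Definition torint (f : 'rV[R]_d -> R) : R :=
  boxint (fun _ => 0) (fun _ => 1) f.

Definition heat_sol (rho0 : 'rV[R]_d -> R) (rho : 'rV[R]_d -> R -> R) : Prop :=
  (forall x, rho x 0 = rho0 x) /\
  (forall x i t, rho (x + unitv i) t = rho x t) /\
  {within [set p : 'rV[R]_d * R | 0 <= p.2], continuous (fun p => rho p.1 p.2)} /\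
  (forall x t, 0 < t ->
     derivable (rho x) t 1 /\
     (forall i, derivable (fun y => rho y t) x (unitv i) /\
        derivable (fun y => derive (fun z => rho z t) y (unitv i)) x (unitv i)) /\
     derive (rho x) t 1 =
       \sum_(i < d) derive (fun y => derive (fun z => rho z t) y (unitv i)) x (unitv i)).

(* Test functions C^infty(T^d x {1..d} x {+,-}) and the dual           *)
(* (b = true is "+", b = false is "-")                                *)
Definition testfn := 'I_d -> bool -> 'rV[R]_d -> R.

Definition is_test (phi : testfn) :=
  forall l b, torus_periodic (phi l b) /\ smooth (phi l b).

Definition seminorm (s : seq 'I_d) (phi : testfn) : R :=
  sup [set r | exists l b x, r = `|pder s (phi l b) x|].

Definition bounded_set (B : set testfn) :=
  (forall phi, B phi -> is_test phi) /\
  forall s, exists Mb, forall phi, B phi -> forall l b x, `|pder s (phi l b) x| <= Mb.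

Definition in_dual (xi : testfn -> R) :=
  (forall a phi psi, is_test phi -> is_test psi ->
     xi (fun l b x => a * phi l b x + psi l b x) = a * xi phi + xi psi) /\
  exists (k : nat) (Sd : nat -> seq 'I_d) (C : R), forall phi, is_test phi ->
     `|xi phi| <= C * \sum_(j < k) seminorm (Sd j) phi.

(* D(0,T; dual of C^infty) with the strong topology *)
Definition in_D (T : R) (xi : R -> testfn -> R) :=
  (forall t, 0 <= t <= T -> in_dual (xi t)) /\
  (forall t, 0 <= t < T -> forall B, bounded_set B -> forall e, 0 < e ->
     exists delta, 0 < delta /\ forall u, t <= u < t + delta -> u <= T ->
       forall phi, B phi -> `|xi u phi - xi t phi| <= e) /\
  (forall t, 0 < t <= T -> exists zeta, in_dual zeta /\
     forall B, bounded_set B -> forall e, 0 < e ->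
     exists delta, 0 < delta /\ forall u, t - delta < u < t -> 0 <= u ->
       forall phi, B phi -> `|xi u phi - zeta phi| <= e).

Definition timechange (T : R) (tau : R -> R) :=
  tau 0 = 0 /\ tau T = T /\
  (forall s t, 0 <= s -> s < t -> t <= T -> tau s < tau t) /\
  {within `[0, T], continuous tau}.

Definition dB (T : R) (B : set testfn) (xi1 xi2 : R -> testfn -> R) : \bar R :=
  ereal_inf [set v : \bar R | exists tau, timechange T tau /\
    v = (ereal_sup [set r : \bar R | exists (t : R) phi, (0 <= t <= T)%R /\ B phi /\
                          r = (`|xi1 t phi - xi2 (tau t) phi|)%:E]
         + ereal_sup [set r : \bar R | exists s t : R, (0 <= s <= T)%R /\ (0 <= t <= T)%R /\ s != t /\
                          r = (`|ln ((tau t - tau s) / (t - s))|)%:E])%E].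

(* continuity on D(0,T;C^infty* ) for the Skorohod--Mitoma topology,
   i.e. the topology generated by the pseudometrics d_B, B bounded *)
Definition SM_continuous (T : R) (F : (R -> testfn -> R) -> R) :=
  forall xi, in_D T xi -> forall e, 0 < e ->
    exists (k : nat) (Bs : nat -> set testfn) (delta : R), 0 < delta /\
      (forall j, (j < k)%N -> bounded_set (Bs j)) /\
      forall eta, in_D T eta ->
        (forall j, (j < k)%N -> (dB T (Bs j) xi eta < delta%:E)%E) ->
        `|F xi - F eta| < e.

Definition SM_bounded (T : R) (F : (R -> testfn -> R) -> R) :=
  exists C, forall xi, in_D T xi -> `|F xi| <= C.

(* The lattice T^d_eps, eps = 1/N, N = M.+1                           *)
Variable M : nat.

Definition eps : R := ((M.+1)%:R)^-1.

Definition site := {ffun 'I_d -> 'I_M.+1}.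

Definition pos (x : site) : 'rV[R]_d := \row_i ((x i : nat)%:R * eps).

Definition nbr (x : site) (l : 'I_d) (b : bool) : site :=
  [ffun i => if i == l then (if b then ordS (x i) else ord_pred (x i)) else x i].

Definition adj (x y : site) : bool := [exists l, exists b, y == nbr x l b].

Definition state :=
  ({ffun site -> bool} * {ffun site * site -> nat} * {ffun site * site -> nat})%type.

Definition st_eta (s : state) := s.1.1.
Definition st_W (s : state) := s.1.2.
Definition st_C (s : state) := s.2.

Definition move_st (s : state) (p : site * site) : state :=
  ([ffun z => if z == p.1 then false else if z == p.2 then true else st_eta s z],
   [ffun q => (st_W s q + (q == p))%N],
   st_C s).

Definition coll_st (s : state) (p : site * site) : state :=
  (st_eta s, st_W s, [ffun q => (st_C s q + (q == p))%N]).

Definition exclusion_jumps (s : state) : seq (R * state) :=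
  [seq (eps ^- 2, move_st s p) | p <- enum [pred p : site * site |
       adj p.1 p.2 && st_eta s p.1 && ~~ st_eta s p.2]] ++
  [seq (eps ^- 2, coll_st s p) | p <- enum [pred p : site * site |
       adj p.1 p.2 && st_eta s p.1 && st_eta s p.2]].

Definition init_param (rho0 : 'rV[R]_d -> R) (n : nat) (x : site) : R :=
  n%:R * boxint (fun i => pos x 0 i - eps / 2) (fun i => pos x 0 i + eps / 2) rho0.

Definition init_law (rho0 : 'rV[R]_d -> R) (n : nat) (s : state) : R :=
  ((st_W s == [ffun => 0%N]) && (st_C s == [ffun => 0%N]))%:R *
  \prod_(x : site) (if st_eta s x then init_param rho0 n x else 1 - init_param rho0 n x).

Definition collision_number (n : nat) (Xw : R -> state) : R -> testfn -> R :=
  fun t phi => eps ^+ 2 / (eps ^+ d * n%:R ^+ 2) *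
    \sum_(x : site) \sum_(l < d) \sum_(b : bool)
       (st_C (Xw t) (x, nbr x l b))%:R *
       phi l b (pos x + ((if b then 1 else -1) * eps / 2) *: unitv l).

End Space.

Definition collision_limit (R : realType) (d : nat) (rho : 'rV[R]_d -> R -> R)
  : R -> testfn R d -> R :=
  fun t phi => \sum_(l < d) \sum_(b : bool)
    torint (fun x => phi l b x * \int[lebesgue_measure]_(s in `[0, t]) (rho x s ^+ 2)).

(* Main.v *)
Require Import Defs.
From mathcomp Require Import measurable_realfun ring lra zify.
Set Implicit Arguments. Unset Strict Implicit. Unset Printing Implicit Defensive.
Import Order.TTheory GRing.Theory Num.Theory.
Import numFieldNormedType.Exports.
Local Open Scope classical_set_scope.
Local Open Scope ring_scope.

(** Write [A_t(phi)] for the collision number paired with [phi]. Its drift is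
    [eps^-2] times its scale times the sum of [phi eta(x) eta(y)] over directed bonds,
    and a Gronwall argument bounds [E (A_t(phi) - a_t)^2] by the mean square distance
    between that drift and [a'_t]. The latter only needs two- and four-point
    correlations. Self-duality of the symmetric exclusion process makes the
    correlation functions solve closed lattice equations, so that maximum principles
    give Liggett's upper bound (correlations are at most products of densities) and,
    with a barrier absorbing the exclusion on the diagonal, a matching lower bound on
    two-point functions. Densities follow the lattice heat equation; they are compared
    with [rho] through trigonometric polynomials, for which both heat flows are
    explicit and which approximate [rho0] uniformly.

    For [phi >= 0] the number [A_t(phi)] is nondecreasing in [t], which makes the law
    of large numbers uniform in time; a finite net in the sup norm makes it uniform
    over bounded sets of test functions. As the limit path is continuous this gives
    closeness for every pseudometric [d_B] with the identity as time change.
    Measurability follows by sampling the path on a time grid: a time change close to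
    the identity maps the sampled path to the original one. *)

(** The law of the process is given by the power series exp(tQ) and the collision counters are
    unbounded. Moments are therefore differentiated as power series, on functions of geometric
    growth; the process itself supplies only positivity and Markov's inequality. The product initial
    law keeps pair correlations close to a product of densities at every time, so one-time moments
    suffice. In the variance of the drift, four-point functions enter with a plus sign and need the
    upper bound; the cross term enters with a minus sign and calls for the lower bound on pairs. The
    lower bound is the obstacle. At adjacent sites exclusion loses [eps^-2] times the squared
    difference of the densities, which the barrier absorbs only if neighbouring densities differ by
    [O(eps)]. A merely continuous [rho0] gives no such bound near time zero; a trigonometric
    polynomial gives one uniform in time and in [eps]. Jumps of the collision number have size
    [O(eps^2 / (eps^d n^2))], and pairs of bonds sharing a site contribute [O(1 / (eps^d n^2))] to
    the variance; both vanish because [eps^(d/2) n] diverges. *)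

Section exponential_series.
Variable R : realType.
Implicit Types (a : nat -> R) (K B x : R).

(** Coefficients of at most geometric growth, divided by factorials, are dominated by the series of
    [K * expR (B * |x|)]; powers of a generator with bounded rates grow in this way. *)
Lemma pseries_expo_cvg a K B x : (forall k, `|a k| <= K * B ^+ k) ->
  cvgn (pseries (fun k => a k / k`!%:R) x).
Proof.
move=> aB; apply: normed_cvg; rewrite /normed_series_of /=.
have E : (fun k => K * exp_coeff (B * `|x|) k) = K *: exp_coeff (B * `|x|).
  by apply/funext.
apply: (@series_le_cvg _ _ (fun k => K * exp_coeff (B * `|x|) k)) => [n|n|n|].
- by rewrite normr_ge0.
- apply: (@le_trans _ _ (`|a n| * `|x| ^+ n / n`!%:R)).
    by rewrite !mulr_ge0.
  rewrite /exp_coeff /= exprMn 2!mulrA ler_pM2r ?invr_gt0 ?ltr0n ?fact_gt0//.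
  by rewrite ler_wpM2r.
- rewrite !normrM normfV normrX (ger0_norm (ler0n _ _)) mulrAC.
  rewrite /exp_coeff /= exprMn 2!mulrA ler_pM2r ?invr_gt0 ?ltr0n ?fact_gt0//.
  by rewrite ler_wpM2r.
- by rewrite E; apply/is_cvg_seriesZ/is_cvg_series_exp_coeff.
Qed.

Lemma pseries_expo_le a K B x : (forall k, `|a k| <= K * B ^+ k) ->
  `|limn (pseries (fun k => a k / k`!%:R) x)| <= K * expR (B * `|x|).
Proof.
move=> aB; have cv := @pseries_expo_cvg a K B x aB.
have E : (fun k => K * exp_coeff (B * `|x|) k) = K *: exp_coeff (B * `|x|).
  by apply/funext.
have cvE : series (K *: exp_coeff (B * `|x|)) @ \oo --> K * expR (B * `|x|).
  have -> : series (K *: exp_coeff (B * `|x|)) =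
            (fun n => K * series (exp_coeff (B * `|x|)) n).
    by apply/funext => n; rewrite /series /= mulr_sumr.
  by apply: cvgMl_tmp; exact: is_cvg_series_exp_coeff.
rewrite -(cvg_lim _ cvE)//.
rewrite -lim_norm//.
apply: ler_lim; [exact: is_cvg_norm|by apply/cvg_ex; eexists; exact: cvE|].
apply: nearW => n /=; rewrite /pseries /series /=.
apply: (le_trans (ler_norm_sum _ _ _)); apply: ler_sum => k _.
rewrite !normrM normfV normrX (ger0_norm (ler0n _ _)) mulrAC.
rewrite /exp_coeff !fctE /= exprMn /GRing.scale /= 2!mulrA.
by rewrite ler_pM2r ?invr_gt0 ?ltr0n ?fact_gt0// ler_wpM2r.
Qed.

(** The factor [k + 1] cancels in the factorial, so differentiation only shifts [a]: in the
    application this is d/dt exp(tQ) = exp(tQ) Q. *)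
Lemma pseries_expo_diff a :
  pseries_diffs (fun k => a k / k`!%:R) = (fun k => a k.+1 / k`!%:R).
Proof.
apply/funext => k; rewrite /pseries_diffs factS natrM invfM mulrCA (mulrA k.+1%:R).
by rewrite divff ?pnatr_eq0// mul1r.
Qed.

Lemma is_derive_pseries_expo a K B x : (forall k, `|a k| <= K * B ^+ k) ->
  is_derive x (1 : R) (fun x => limn (pseries (fun k => a k / k`!%:R) x))
    (limn (pseries (fun k => a k.+1 / k`!%:R) x)).
Proof.
move=> aB; rewrite -pseries_expo_diff.
have aB1 k : `|a k.+1| <= (K * B) * B ^+ k by rewrite -mulrA -exprS.
have aB2 k : `|a k.+2| <= (K * B * B) * B ^+ k by rewrite -2!mulrA -2!exprS.
(* Termwise differentiation asks for convergence of the series and of its first two formal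
   derivatives at a point beyond [|x|]. *)
apply: (@pseries_snd_diffs _ _ (`|x| + 1)).
- exact: pseries_expo_cvg aB.
- by rewrite pseries_expo_diff; apply: pseries_expo_cvg aB1.
- by rewrite !pseries_expo_diff; apply: pseries_expo_cvg aB2.
- by rewrite (ger0_norm (addr_ge0 _ _))// ltrDl.
Qed.

End exponential_series.

(** * Semigroups acting on functions of geometric growth *)

Section semigroup.
Variables (R : realType) (S : countType) (jumps : S -> seq (R * S)).
Variables (lvl : S -> nat) (lam : R).
Hypothesis rate_ge0 : forall s j, j \in jumps s -> 0 <= j.1.
Hypothesis rate_le : forall s, \sum_(j <- jumps s) j.1 <= lam.
Hypothesis lvl_jump : forall s j, j \in jumps s -> (lvl j.2 <= (lvl s).+1)%N.
Implicit Types (f g : S -> R) (s : S) (t K V : R).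

Definition gen f s := \sum_(j <- jumps s) j.1 * (f j.2 - f s).

(** Bounded functions would exclude the counters. Geometric growth in [lvl], which a jump raises by
    at most one, is stable under sums, products and the generator, and keeps exp(tQ) f an entire
    series in [t]. *)
Definition dominated f :=
  exists K V, [/\ 0 <= K, 1 <= V & forall s, `|f s| <= K * V ^+ lvl s].

(** The formal exponential exp(tQ) f. Its sign is invisible in this form and is recovered later from
    the law of the process. *)
Definition sgrp t f s := limn (pseries (fun k => iter k gen f s / k`!%:R) t).

Lemma lam_ge0 (s : S) : 0 <= lam.
Proof.
by apply: le_trans (rate_le s); rewrite big_seq; apply: sumr_ge0 => j /rate_ge0.
Qed.

(** A jump multiplies the bound [V ^+ lvl s] by at most [V], so on functions of growth [V] the
    generator has norm at most [lam * (V + 1)]. *)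
Lemma gen_le f K V : 0 <= K -> 1 <= V -> (forall s, `|f s| <= K * V ^+ lvl s) ->
  forall s, `|gen f s| <= (lam * (V + 1)) * K * V ^+ lvl s.
Proof.
move=> K0 V1 fK s; apply: (le_trans (ler_norm_sum _ _ _)).
have V0 : 0 <= V by apply: le_trans V1.
apply: (@le_trans _ _ (\sum_(j <- jumps s) j.1 * ((V + 1) * K * V ^+ lvl s))).
  rewrite big_seq [leRHS]big_seq; apply: ler_sum => j js.
  rewrite normrM (ger0_norm (rate_ge0 js)) ler_wpM2l ?(rate_ge0 js)//.
  apply: (le_trans (ler_normB _ _)).
  rewrite mulrDl mul1r mulrDl lerD//.
  apply: (le_trans (fK _)); rewrite mulrAC -exprS mulrC ler_wpM2r//.
  by rewrite ler_weXn2l// lvl_jump.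
rewrite -mulr_suml; apply: le_trans (_ : lam * ((V + 1) * K * V ^+ lvl s) <= _).
  by rewrite ler_wpM2r// !mulr_ge0// ?exprn_ge0// addr_ge0.
by rewrite !mulrA.
Qed.

Lemma iter_gen_le f K V : 0 <= K -> 1 <= V ->
  (forall s, `|f s| <= K * V ^+ lvl s) ->
  forall k s, `|iter k gen f s| <= K * V ^+ lvl s * (lam * (V + 1)) ^+ k.
Proof.
move=> K0 V1 fK k s.
have V0 : 0 <= V by apply: le_trans V1.
suff H : forall s, `|iter k gen f s| <= (lam * (V + 1)) ^+ k * K * V ^+ lvl s.
  by rewrite mulrC mulrA.
elim: k => [|k IH] {}s /=; first by rewrite expr0 mul1r.
rewrite exprS -(mulrA (lam * _)); apply: gen_le => //.
by rewrite mulr_ge0// exprn_ge0// mulr_ge0 ?lam_ge0// addr_ge0.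
Qed.

Lemma dominated_cvg f s : dominated f ->
  forall t, cvgn (pseries (fun k => iter k gen f s / k`!%:R) t).
Proof.
move=> [K [V [K0 V1 fK]]] t.
exact: (@pseries_expo_cvg _ _ (K * V ^+ lvl s) (lam * (V + 1)) _
  (fun k => iter_gen_le K0 V1 fK k s)).
Qed.

Lemma dominated_gen f : dominated f -> dominated (gen f).
Proof.
move=> [K [V [K0 V1 fK]]].
(* [lam >= 0] is only known in the presence of a state; without one every bound is vacuous. *)
have [[s _]|noS] := pselect (exists s : S, True).
  exists (lam * (V + 1) * K), V; split => //; last exact: gen_le.
  by rewrite !mulr_ge0 ?(lam_ge0 s)// addr_ge0// (le_trans _ V1).
by exists 0, 1; split => // s; case: noS; exists s.
Qed.

Lemma is_derive_sgrp f s t : dominated f ->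
  is_derive t (1 : R) (fun t => sgrp t f s) (sgrp t (gen f) s).
Proof.
move=> [K [V [K0 V1 fK]]]; rewrite /sgrp.
have -> : (fun k => iter k gen (gen f) s / k`!%:R) =
          (fun k => iter k.+1 gen f s / k`!%:R).
  by apply/funext => k; rewrite iterSr.
exact: (is_derive_pseries_expo _ (fun k => iter_gen_le K0 V1 fK k s)).
Qed.

Lemma sgrp_le f K V t s : 0 <= K -> 1 <= V ->
  (forall s, `|f s| <= K * V ^+ lvl s) ->
  `|sgrp t f s| <= K * V ^+ lvl s * expR (lam * (V + 1) * `|t|).
Proof.
by move=> K0 V1 fK; apply: pseries_expo_le => k; exact: iter_gen_le.
Qed.

Lemma genD (a : R) f g : gen (fun s => a * f s + g s) = (fun s => a * gen f s + gen g s).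
Proof.
apply/funext => s; rewrite /gen mulr_sumr -big_split/=; apply: eq_bigr => j _.
by ring.
Qed.

Lemma iter_genD k (a : R) f g s : iter k gen (fun s => a * f s + g s) s =
  a * iter k gen f s + iter k gen g s.
Proof.
suff -> : iter k gen (fun s => a * f s + g s) =
  (fun s => a * iter k gen f s + iter k gen g s) by [].
by elim: k => [//|k IH]; rewrite !iterS IH genD.
Qed.

Lemma sgrpD t (a : R) f g s : dominated f -> dominated g ->
  sgrp t (fun s => a * f s + g s) s = a * sgrp t f s + sgrp t g s.
Proof.
move=> df dg; rewrite /sgrp; apply: cvg_lim => //.
have cf := @dominated_cvg f s df t; have cg := @dominated_cvg g s dg t.
have -> : pseries (fun k => iter k gen (fun s => a * f s + g s) s / k`!%:R) t =
  (fun n => a * pseries (fun k => iter k gen f s / k`!%:R) t n +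
    pseries (fun k => iter k gen g s / k`!%:R) t n).
  apply/funext => n; rewrite /pseries /series /= mulr_sumr -big_split/=.
  by apply: eq_bigr => k _; rewrite iter_genD mulrDl mulrDl !mulrA.
by apply: cvgD => //; apply: cvgMl_tmp.
Qed.

Lemma sgrp0 f s : sgrp 0 f s = f s.
Proof.
apply: cvg_lim => //.
have -> : pseries (fun k => iter k gen f s / k`!%:R) 0 =
    (fun n => (0 < n)%N%:R * f s).
  apply/funext => -[|n]; rewrite /pseries /series /=; first by rewrite big_nil mul0r.
  rewrite big_nat_recl//= expr0 fact0 divr1 mulr1 mul1r big1 ?addr0// => k _.
  by rewrite exprS mul0r mulr0.
rewrite -cvg_shiftS /=; under eq_fun do rewrite mul1r.
exact: cvg_cst.
Qed.

Lemma iter_gen0 k s : iter k gen (fun=> 0) s = 0.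
Proof.
suff -> : iter k gen (fun=> 0) = (fun=> 0) by [].
elim: k => //= k ->; apply/funext => s' /=.
by rewrite /gen big1// => j _; rewrite subr0 mulr0.
Qed.

Lemma sgrp_cst t (a : R) s : sgrp t (fun=> a) s = a.
Proof.
apply: cvg_lim => //; rewrite -cvg_shiftS /=.
suff -> : (fun n => pseries (fun k => iter k gen (fun=> a) s / k`!%:R) t n.+1) = (fun=> a).
  exact: cvg_cst.
apply/funext => n; rewrite /pseries /series /= big_nat_recl//= expr0 fact0 divr1 mulr1.
rewrite big1 ?addr0// => k _.
suff -> : gen (iter k gen (fun=> a)) s = 0 by rewrite !mul0r.
rewrite -iterS iterSr.
have -> : gen (fun=> a) = (fun=> 0).
  by apply/funext => s'; rewrite /gen big1// => j _; rewrite subrr mulr0.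
exact: iter_gen0.
Qed.

Lemma QpowE k s s' : Qpow jumps k s s' = iter k gen (fun x => (x == s')%:R) s.
Proof.
by elim: k s => [//|k IH] s /=; rewrite /gen; apply: eq_bigr => j _; rewrite !IH.
Qed.

Lemma ptransE t s s' : ptrans jumps t s s' = sgrp t (fun x => (x == s')%:R) s.
Proof.
rewrite /ptrans /sgrp; congr (lim (_ @ \oo)); apply/funext => n.
rewrite /pseries /series /= big_mkord; apply: eq_bigr => k _.
by rewrite QpowE mulrC mulrA mulrAC.
Qed.

Lemma dominated_bounded f K : 0 <= K -> (forall s, `|f s| <= K) -> dominated f.
Proof. by move=> K0 fK; exists K, 1; split=> // s; rewrite expr1n mulr1. Qed.

Lemma dominatedD (a : R) f g : dominated f -> dominated g ->
  dominated (fun s => a * f s + g s).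
Proof.
move=> [K [V [K0 V1 fK]]] [K' [V' [K'0 V'1 gK]]].
have VV : 1 <= V * V' by rewrite -[1]mulr1 ler_pM.
have V0 : 0 <= V by apply: le_trans V1.
have V'0 : 0 <= V' by apply: le_trans V'1.
exists (`|a| * K + K'), (V * V'); split=> // [|s]; first by rewrite addr_ge0// mulr_ge0.
apply: (le_trans (ler_normD _ _)); rewrite mulrDl lerD//.
  rewrite normrM -mulrA ler_wpM2l//; apply: (le_trans (fK s)).
  by rewrite ler_wpM2l// lerXn2r ?nnegrE ?mulr_ge0// ler_peMr.
apply: (le_trans (gK s)).
by rewrite ler_wpM2l// lerXn2r ?nnegrE ?mulr_ge0// ler_peMl.
Qed.

Lemma dominatedM f g : dominated f -> dominated g -> dominated (fun s => f s * g s).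
Proof.
move=> [K [V [K0 V1 fK]]] [K' [V' [K'0 V'1 gK]]].
exists (K * K'), (V * V'); split; [exact: mulr_ge0|by rewrite -[1]mulr1 ler_pM|].
by move=> s; rewrite normrM exprMn mulrACA ler_pM.
Qed.

Lemma dominated_sum (I : Type) (r : seq I) (F : I -> S -> R) :
  (forall i, dominated (F i)) -> dominated (fun s => \sum_(i <- r) F i s).
Proof.
move=> dF; elim: r => [|i r IH].
  by apply: (@dominated_bounded _ 0) => // s; rewrite big_nil normr0.
have -> : (fun s => \sum_(j <- i :: r) F j s) =
  (fun s => 1 * F i s + \sum_(j <- r) F j s).
  by apply/funext => s; rewrite big_cons mul1r.
exact: dominatedD.
Qed.

Lemma sgrp_sum (I : Type) (r : seq I) (F : I -> S -> R) t s :
  (forall i, dominated (F i)) ->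
  sgrp t (fun s => \sum_(i <- r) F i s) s = \sum_(i <- r) sgrp t (F i) s.
Proof.
move=> dF; elim: r => [|i r IH].
  by rewrite big_nil; under eq_fun do rewrite big_nil; rewrite sgrp_cst.
have -> : (fun s => \sum_(j <- i :: r) F j s) =
  (fun s => 1 * F i s + \sum_(j <- r) F j s).
  by apply/funext => s'; rewrite big_cons mul1r.
by rewrite sgrpD ?mul1r ?IH ?big_cons//; exact: dominated_sum.
Qed.

End semigroup.

(** * Probabilities and expectations for a countable chain *)

Section countable_events.
Context d (Omega : measurableType d) (R : realType) (P : probability Omega R).

Lemma measurable_countable (S : countType) (Y : Omega -> S) :
  (forall s, measurable [set w | Y w = s]) ->
  forall G : set S, measurable [set w | G (Y w)].
Proof.
move=> mY G.
have -> : [set w | G (Y w)] = \bigcup_n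
    [set w | exists s, [/\ @unpickle S n = Some s, G s & Y w = s]].
  apply/seteqP; split=> [w Gw|w [n _ [s [_ Gs Yw]]]]; last by rewrite /= Yw.
  by exists (pickle (Y w)) => //; exists (Y w); split => //; rewrite pickleK.
apply: bigcupT_measurable => n.
case En : (@unpickle S n) => [s|]; last first.
  rewrite (_ : mkset _ = set0)//; apply/seteqP; split=> // w [s []].
  by rewrite ?En.
have [Gs|nGs] := pselect (G s).
  rewrite (_ : mkset _ = [set w | Y w = s])//; apply/seteqP; split=> w /=.
    by move=> [s' [[->]]].
  by move=> Yw; exists s.
rewrite (_ : mkset _ = set0)//; apply/seteqP; split=> // w [s' [[<-]]].
by move=> /nGs.
Qed.

Lemma probability_mem (S : countType) (Y : Omega -> S) (r : seq S) :
  (forall s, measurable [set w | Y w = s]) -> uniq r ->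
  P [set w | Y w \in r] = (\sum_(s <- r) P [set w | Y w = s])%E.
Proof.
move=> mY; elim: r => [_|s r IH /= /andP[sr ur]].
  by rewrite big_nil (_ : mkset _ = set0) ?measure0//; apply/seteqP; split.
rewrite big_cons -IH// -measureU//.
- congr (P _); apply/seteqP; split=> w /=.
    by rewrite inE => /orP[/eqP|]; [left|right].
  by move=> [->|Yr]; rewrite inE ?eqxx// Yr orbT.
- exact: (@measurable_countable _ Y mY (fun s => s \in r)).
- by apply/seteqP; split=> // w [/= -> ]; rewrite (negbTE sr).
Qed.

End countable_events.

Section expectation.
Variables (R : realType) (S : countType) (jumps : S -> seq (R * S)).
Variables (lvl : S -> nat) (lam : R).
Hypothesis rate_ge0 : forall s j, j \in jumps s -> 0 <= j.1.
Hypothesis rate_le : forall s, \sum_(j <- jumps s) j.1 <= lam.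
Hypothesis lvl_jump : forall s j, j \in jumps s -> (lvl j.2 <= (lvl s).+1)%N.
Variable levels : nat -> seq S.
Hypothesis levels_uniq : forall K, uniq (levels K).
Hypothesis levelsE : forall K s, (s \in levels K) = (lvl s <= K)%N.
Variables (dO : measure_display) (Omega : measurableType dO).
Variables (P : probability Omega R) (X : R -> Omega -> S) (mu : S -> R).
Hypothesis XP : is_markov jumps P X mu.
Variable init : seq S.
Hypothesis init_uniq : uniq init.
Hypothesis init_total : \sum_(s <- init) mu s = 1.
Implicit Types (f g : S -> R) (s : S) (t : R).
Local Notation dominated := (dominated lvl).
Local Notation gen := (gen jumps).
Local Notation sgrp := (sgrp jumps).

(** Plays the role of the expectation of [f (X t)], but as a finite sum of power series, so that it
    is differentiable in [t] and linear in [f] by algebra. The process enters through positivity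
    ([EE_ge0]) and Markov's inequality ([prob_le_EE]). *)
Definition EE t f := \sum_(s0 <- init) mu s0 * sgrp t f s0.

Lemma is_derive_EE f t : dominated f ->
  is_derive t (1 : R) (fun t => EE t f) (EE t (gen f)).
Proof.
move=> df; rewrite /EE.
elim: init => [|s0 r IH].
  rewrite big_nil; under eq_fun do rewrite big_nil.
  exact: is_derive_cst.
rewrite big_cons; under eq_fun do rewrite big_cons.
have D := @is_derive_sgrp _ _ _ _ _ rate_ge0 rate_le lvl_jump f s0 t df.
apply: is_deriveD.

Qed.

Lemma EED t (a : R) f g : dominated f -> dominated g ->
  EE t (fun s => a * f s + g s) = a * EE t f + EE t g.
Proof.
move=> df dg; rewrite /EE mulr_sumr -big_split; apply: eq_bigr => s _ /=.
by rewrite (sgrpD rate_ge0 rate_le lvl_jump)// mulrDr mulrCA.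
Qed.

Lemma EE_cst t (a : R) : EE t (fun=> a) = a.
Proof.
rewrite /EE; under eq_bigr do rewrite sgrp_cst.
by rewrite -mulr_suml init_total mul1r.
Qed.

Lemma EE_sum (I : Type) (r : seq I) (F : I -> S -> R) t :
  (forall i, dominated (F i)) ->
  EE t (fun s => \sum_(i <- r) F i s) = \sum_(i <- r) EE t (F i).
Proof.
move=> dF; elim: r => [|i r IH].
  by rewrite big_nil; under eq_fun do rewrite big_nil; rewrite EE_cst.
have -> : (fun s => \sum_(j <- i :: r) F j s) =
  (fun s => 1 * F i s + \sum_(j <- r) F j s).
  by apply/funext => s'; rewrite big_cons mul1r.
by rewrite EED ?mul1r ?IH ?big_cons//; exact: dominated_sum.
Qed.

Lemma EE0 f : EE 0 f = \sum_(s0 <- init) mu s0 * f s0.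
Proof. by apply: eq_bigr => s _; rewrite sgrp0. Qed.

Lemma markov_pair t s0 s : 0 <= t ->
  P ([set w | X 0 w = s0] `&` [set w | X t w = s]) =
  (mu s0 * ptrans jumps t s0 s)%:E.
Proof.
move=> t0; have [_ [_ [_ /(_ s0 [:: (t, s)])]]] := XP.
by rewrite /= setIT subr0 mulr1; apply; split.
Qed.

Lemma markov_pair_ge0 t s0 s : 0 <= t -> 0 <= mu s0 * ptrans jumps t s0 s.
Proof. by move=> t0; rewrite -lee_fin -markov_pair//. Qed.

Lemma dominated_ind s : dominated (fun x => (x == s)%:R : R).
Proof.
by apply: (@dominated_bounded _ _ _ _ 1) => // x; case: eqP => _; rewrite ?normr1 ?normr0.
Qed.

Definition trunc f (K : nat) s : R := if (lvl s <= K)%N then f s else 0.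

(** A truncated function lives on the finitely many states of [levels K], hence is a finite
    combination of indicators, for which the series are transition probabilities. *)
Lemma EE_trunc t f K :
  EE t (trunc f K) =
  \sum_(s0 <- init) \sum_(s <- levels K) f s * (mu s0 * ptrans jumps t s0 s).
Proof.
apply: eq_bigr => s0 _.
have -> : trunc f K = (fun x => \sum_(s <- levels K) f s * (x == s)%:R + 0).
  apply/funext => x; rewrite /trunc addr0 -levelsE; case: ifPn => xK.
    rewrite (big_rem x)//= eqxx mulr1 big_seq_cond big1 ?addr0// => s.
    rewrite andbT mem_rem_uniq// inE => /andP[/negbTE].
    by rewrite eq_sym => ->; rewrite mulr0.
  rewrite big_seq big1// => s sK; case: eqP => [xs|_]; rewrite ?mulr0//.
  by rewrite xs sK in xK.
under eq_fun do rewrite addr0.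
rewrite (sgrp_sum rate_ge0 rate_le lvl_jump) ?mulr_sumr.
  apply: eq_bigr => s _; rewrite ptransE.
  rewrite (_ : (fun _ => _) = (fun x => f s * (x == s)%:R + 0)).
    rewrite (sgrpD rate_ge0 rate_le lvl_jump) ?sgrp_cst ?addr0 1?mulrCA//.
      exact: dominated_ind.
    by apply: (@dominated_bounded _ _ _ _ 0) => // x; rewrite normr0.
  by apply/funext => x; rewrite addr0.
move=> s; rewrite (_ : (fun _ => _) = (fun x => f s * (x == s)%:R + 0)).
  apply: dominatedD; first exact: dominated_ind.
  by apply: (@dominated_bounded _ _ _ _ 0) => // x; rewrite normr0.
by apply/funext => x; rewrite addr0.
Qed.

(** The discarded part sits at levels above [K]; measured with growth [2 * V] instead of [V] it is
    smaller by the factor [2^-K], and the semigroup bound keeps this factor. *)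
Lemma EE_trunc_cvg t f : dominated f -> EE t (trunc f K) @[K --> \oo] --> EE t f.
Proof.
move=> [K [V [K0 V1 fK]]]; rewrite /EE.
have V0 : 0 <= V by apply: le_trans V1.
apply: (cvg_big add_continuous) => s0 _; apply: cvgMl_tmp.
pose E := K * (V * 2) ^+ lvl s0 * expR (lam * (V * 2 + 1) * `|t|).
have V2 : 1 <= V * 2 by lra.
have dT k : dominated (trunc f k).
  exists K, V; split => // s; rewrite /trunc; case: ifP => // _.
  by rewrite normr0 mulr_ge0// exprn_ge0.
have H k : `|sgrp t f s0 - sgrp t (trunc f k) s0| <= E * 2^-1 ^+ k.
  have -> : sgrp t f s0 - sgrp t (trunc f k) s0 =
     sgrp t (fun s => (-1) * trunc f k s + f s) s0.
    rewrite (sgrpD rate_ge0 rate_le lvl_jump)//; last by exists K, V.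
    by rewrite mulN1r addrC.
  apply: (le_trans (@sgrp_le _ _ _ _ _ rate_ge0 rate_le lvl_jump _ (K * 2^-1 ^+ k) (V * 2) _ _ _ _ _)) => //.
  - by rewrite mulr_ge0// exprn_ge0// invr_ge0.
  - move=> s; rewrite /trunc mulN1r; case: leqP => sk.
      by rewrite addNr normr0 !mulr_ge0 ?exprn_ge0//; lra.
    rewrite oppr0 add0r; apply: (le_trans (fK s)).
    rewrite exprMn mulrACA ler_peMr ?mulr_ge0 ?exprn_ge0//.
    rewrite -(subnK (ltnW sk)) exprD mulrCA -exprMn mulVf// expr1n mulr1.
    by rewrite exprn_ege1//; lra.
  - by rewrite /E -!mulrA ler_wpM2l// mulrC -!mulrA.
apply/cvgrPdist_le => e e0.
have : E * 2^-1 ^+ k @[k --> \oo] --> E * 0.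
  apply: cvgMl_tmp; apply: cvg_expr.
  by rewrite ger0_norm; lra.
rewrite mulr0 => /cvgrPdist_le/(_ _ e0); apply: filterS => k.
rewrite sub0r normrN => h; apply: (le_trans (H k)).
by apply: le_trans (ler_norm _) h.
Qed.

(** Each truncation is a nonnegative combination of probabilities of the pair [(X 0, X t)], and
    positivity survives the limit in the level. *)
Lemma EE_ge0 t f : 0 <= t -> dominated f -> (forall s, 0 <= f s) -> 0 <= EE t f.
Proof.
move=> t0 df f0; apply: (cvgr_to_ge (@EE_trunc_cvg t f df)).
apply: nearW => K; rewrite EE_trunc; apply: sumr_ge0 => s0 _; apply: sumr_ge0 => s _.
by rewrite mulr_ge0// markov_pair_ge0.
Qed.

Lemma EE_le t f g : 0 <= t -> dominated f -> dominated g ->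
  (forall s, f s <= g s) -> EE t f <= EE t g.
Proof.
move=> t0 df dg fg; rewrite -subr_ge0.
have -> : EE t g - EE t f = EE t (fun s => -1 * f s + g s).
  by rewrite EED// mulN1r addrC.
apply: EE_ge0 => // [|s]; first exact: dominatedD.
by rewrite mulN1r addrC subr_ge0.
Qed.

Lemma measurable_state t : 0 <= t ->
  forall G : set S, measurable [set w | G (X t w)].
Proof.
by move=> t0 G; apply: measurable_countable => s; have [/(_ t s t0)] := XP.
Qed.

Lemma measurable_state2 t u : 0 <= t -> 0 <= u ->
  forall G : set (S * S), measurable [set w | G (X t w, X u w)].
Proof.
move=> t0 u0 G; apply: (@measurable_countable _ _ _ (fun w => (X t w, X u w))).
move=> [a b]; rewrite (_ : mkset _ = [set w | X t w = a] `&` [set w | X u w = b]).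
  by apply: measurableI; [exact: (measurable_state t0 (eq^~ a))|
                          exact: (measurable_state u0 (eq^~ b))].
by apply/seteqP; split=> w /= [-> ->].
Qed.

Lemma prob_init : P [set w | X 0 w \notin init] = 0%E.
Proof.
have -> : [set w | X 0 w \notin init] = ~` [set w | X 0 w \in init].
  by apply/seteqP; split=> w /= /negP.
rewrite probability_setC; last exact: (measurable_state (lexx 0) (fun s => s \in init)).
rewrite (@probability_mem _ _ _ _ _ (X 0))//; last first.
  by move=> s; exact: (measurable_state (lexx 0) (eq^~ s)).
have [_ [_ [_ H]]] := XP.
under eq_bigr.
  move=> s _; have := H s [::] I; rewrite /= setIT mulr1 => ->; over.
by rewrite sumEFin init_total subee.
Qed.

(** Markov's inequality. The event is cut at level [K] and decomposed over pairs of an initial and a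
    final state, whose probabilities are known; the cut is removed by continuity from below. *)
Lemma prob_le_EE t f (G : set S) : 0 <= t -> dominated f ->
  (forall s, 0 <= f s) -> (forall s, G s -> 1 <= f s) ->
  (P [set w | G (X t w)] <= (EE t f)%:E)%E.
Proof.
move=> t0 df f0 Gf.
pose GK K := [set w | G (X t w) /\ (lvl (X t w) <= K)%N].
have mGK K : measurable (GK K).
  exact: (measurable_state t0 (fun s => G s /\ (lvl s <= K)%N)).
have PK K : (P (GK K) <= (EE t (trunc f K))%:E)%E.
  pose r := [seq (s0, s) | s0 <- init, s <- [seq s <- levels K | `[< G s >]]].
  have ur : uniq r.
    apply: allpairs_uniq => //; first by rewrite filter_uniq.
    by move=> [? ?] [? ?] /= _ _ [-> ->].
  have mr : measurable [set w | (X 0 w, X t w) \in r].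
    exact: (measurable_state2 (lexx 0) t0 (fun p => p \in r)).
  have m0 : measurable [set w | X 0 w \notin init].
    exact: (measurable_state (lexx 0) (fun s => s \notin init)).
  have : (P (GK K) <= P ([set w | X 0 w \notin init] `|`
          [set w | (X 0 w, X t w) \in r]))%E.
    apply: le_measure; rewrite ?inE//; first exact: measurableU.
    move=> w [Gw Kw] /=; have [X0|] := boolP (X 0 w \in init); last by left.
    right; apply: allpairs_f => //; rewrite mem_filter levelsE Kw andbT.
    exact/asboolP.
  move=> /le_trans; apply.
  apply: (@le_trans _ _ (0 + P [set w | (X 0 w, X t w) \in r])%E).
    by rewrite -[X in (_ <= X + _)%E]prob_init; exact: measureU2.
  rewrite add0e.
  rewrite (@probability_mem _ _ _ _ _ (fun w => (X 0 w, X t w)))//; last first.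
    by move=> s; exact: (measurable_state2 (lexx 0) t0 (eq^~ s)).
  rewrite EE_trunc /r big_allpairs_dep/= -sumEFin.
  apply: lee_sum => s0 _; rewrite big_filter big_mkcond -sumEFin.
  apply: lee_sum => s _; case: asboolP => Gs.
    rewrite (_ : mkset _ = [set w | X 0 w = s0] `&` [set w | X t w = s]).
      by rewrite markov_pair// lee_fin ler_peMl ?markov_pair_ge0//; exact: Gf.
    by apply/seteqP; split=> w /= [-> ->].
  by rewrite lee_fin mulr_ge0// markov_pair_ge0.
have : P \o GK @ \oo --> P (\bigcup_K GK K).
  apply: nondecreasing_cvg_mu => //; first exact: bigcupT_measurable.
  by move=> i j ij; apply/subsetPset => w [Gw Kw]; split => //; exact: leq_trans Kw ij.
have -> : \bigcup_K GK K = [set w | G (X t w)].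
  apply/seteqP; split=> [w [K _ []]//|w Gw].
  by exists (lvl (X t w)).
have cvE : (EE t (trunc f K))%:E @[K --> \oo] --> (EE t f)%:E.
  by apply: cvg_EFin; [exact: nearW|exact: EE_trunc_cvg].
move=> cvP; apply: (lee_cvg_to cvP cvE).
exact: nearW PK.
Qed.

End expectation.

(** * Almost sure monotonicity of paths *)

Section monotone_paths.
Variables (R : realType) (S : countType) (jumps : S -> seq (R * S)).
Variables (dO : measure_display) (Omega : measurableType dO).
Variables (P : probability Omega R) (X : R -> Omega -> S) (mu : S -> R).
Hypothesis XP : is_markov jumps P X mu.
Variable le : S -> S -> Prop.
Hypothesis le_refl : forall s, le s s.
Hypothesis le_jump : forall s j s', j \in jumps s -> le j.2 s' -> le s s'.

(** [le_jump] carries [le] backwards along jumps, so a state not above [s] cannot be reached from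
    [s] in any number of steps. *)
Lemma Qpow_nle k s s' : ~ le s s' -> Qpow jumps k s s' = 0.
Proof.
elim: k s => [|k IH] s nle /=.
  by case: eqP => // ss'; case: nle; rewrite ss'; exact: le_refl.
rewrite big_seq big1// => j js.
by rewrite !IH ?subr0 ?mulr0// => /(le_jump js).
Qed.

Lemma ptrans_nle t s s' : ~ le s s' -> ptrans jumps t s s' = 0.
Proof.
move=> nle; apply: cvg_lim => //.
rewrite (_ : (fun _ => _) = (fun=> 0)); first exact: cvg_cst.
by apply/funext => m; rewrite big1// => k _; rewrite Qpow_nle ?mulr0.
Qed.

Lemma prob_pair_nle t u : 0 <= t -> t <= u ->
  P.-negligible [set w | ~ le (X t w) (X u w)].
Proof.
move=> t0 tu; have u0 := le_trans t0 tu.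
pose F n : set Omega := if (@unpickle (S * S * S)%type n) is Some (s0, a, b)
  then [set w | [/\ ~ le a b, X 0 w = s0, X t w = a & X u w = b]] else set0.
apply: (@negligibleS _ _ _ _ (\bigcup_n F n)).
  move=> w nle; exists (pickle (X 0 w, X t w, X u w)); first exact: I.
  by rewrite /F pickleK.
apply: negligible_bigcup => n; rewrite /F.
case: unpickle => [[[s0 a] b]|]; last exact: negligible_set0.
have [lab|nab] := pselect (le a b).
  by rewrite (_ : mkset _ = set0); [exact: negligible_set0|apply/seteqP; split=> // w []].
exists ([set w | X 0 w = s0] `&` ([set w | X t w = a] `&` ([set w | X u w = b] `&` setT))).
have [mX [_ [_ H]]] := XP.
split.
- by do !apply: measurableI => //; apply: mX.
- have := H s0 [:: (t, a); (u, b)]; rewrite /= => ->//.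
  by rewrite (ptrans_nle _ nab) mul0r !mulr0.
- by move=> w [].
Qed.

(** Right-continuity in a discrete state space makes the path constant just after [t] and just after
    [u], which reduces the uncountably many pairs of times to rational ones. *)
Lemma negligible_paths_nle :
  P.-negligible [set w | ~ forall t u, 0 <= t -> t <= u -> le (X t w) (X u w)].
Proof.
pose F n : set Omega := if (@unpickle (rat * rat)%type n) is Some (p, q)
  then [set w | [/\ 0 <= ratr p :> R, ratr p <= ratr q :> R &
     ~ le (X (ratr p) w) (X (ratr q) w)]] else set0.
apply: (@negligibleS _ _ _ _ (\bigcup_n F n)); last first.
  apply: negligible_bigcup => n; rewrite /F.
  case: unpickle => [[p q]|]; last exact: negligible_set0.
  have [p0|np] := boolP (0 <= ratr p :> R); last first.
    by rewrite (_ : mkset _ = set0); [exact: negligible_set0|apply/seteqP; split=> // w []].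
  have [pq|npq] := boolP (ratr p <= ratr q :> R); last first.
    by rewrite (_ : mkset _ = set0); [exact: negligible_set0|apply/seteqP; split=> // w []].
  apply: negligibleS (prob_pair_nle p0 pq).
  by move=> w [].
move=> w; apply: contra_notP => nF t u t0 tu.
have [_ [rc [_ _]]] := XP.
have [->|neq] := eqVneq t u; first exact: le_refl.
have {neq}tu' : t < u by rewrite lt_neqAle neq.
have [d1 [d10 H1]] := rc w t t0.
have [d2 [d20 H2]] := rc w u (le_trans t0 tu).
(* The rational replacing [t] must also stay below [u], to preserve the order of the two times. *)
have : t < Num.min (t + d1) u by rewrite lt_min ltrDl d10.
move=> /rat_in_itvoo[p]; rewrite in_itv /= lt_min => /and3P[tp pd pu].
have : u < u + d2 by rewrite ltrDl.
move=> /rat_in_itvoo[q]; rewrite in_itv /= => /andP[uq qd].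
rewrite -(H1 (ratr p))// ?(ltW tp)// -(H2 (ratr q))// ?(ltW uq)//.
apply: contrapT => nle; apply: nF; exists (pickle (p, q)); first exact: I.
rewrite /F pickleK; split; last exact: nle.
  exact: le_trans t0 (ltW tp).
exact: ltW (lt_trans pu uq).
Qed.

End monotone_paths.

(** * Extrema, a minimum principle for systems of equations, Gronwall *)

Section one_sided_extrema.
Variable R : realType.

Lemma is_derive_val (V W : normedModType R) (f : V -> W) (x v : V) (df : W) :
  is_derive x v f df -> derive f x v = df.
Proof. by move=> ?; exact: derive_val. Qed.

(** At the last time of a parabolic problem the extremum is known only towards the past, so only the
    left difference quotient is usable. *)
Lemma derive_left_min_le0 (g : R -> R) (dg a c : R) : a < c ->
  is_derive c 1 g dg -> (forall t, a <= t <= c -> g c <= g t) -> dg <= 0.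
Proof.
move=> ac Dg gmin.
have dc : derivable g c 1 by apply: ex_derive.
rewrite -(is_derive_val Dg) /derive cvg_at_leftE//.
apply: limr_le.
  rewrite -(cvg_at_leftE (fun h => h^-1 *: ((g \o shift c) _ - g c))) //.
  apply: cvg_trans dc; apply: cvg_app.
  move=> A [e egt0 Ae]; exists e => // x xe xgt0; apply: Ae => //.
  exact/ltr0_neq0.
near=> h; apply: mulr_le0_ge0.
  by rewrite invr_le0; apply: ltW; near: h; exists 1 => /=.
rewrite subr_ge0 [_%:A]mulr1 /=; apply: gmin; near: h.
exists (c - a); first by rewrite /= subr_gt0.
move=> h; rewrite /= distrC subr0.
by move=> /ltr_normlP []; lra.
Unshelve. all: by end_near. Qed.

(** Partial derivatives on row vectors are read along a line, where the one-variable mean value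
    theorem and chain rule apply. *)
Lemma is_derive_line (V : normedModType R) (F : V -> R) (x v : V) (h : R) :
  derivable F (x + h *: v) v ->
  is_derive h 1 (fun h => F (x + h *: v)) (derive F (x + h *: v) v).
Proof.
move=> dF.
have E : (fun k : R => k^-1 *: (((fun h => F (x + h *: v)) \o shift h) (k *: 1) - F (x + h *: v)))
  = (fun k : R => k^-1 *: ((F \o shift (x + h *: v)) (k *: v) - F (x + h *: v))).
  apply/funext => k /=; congr (_ *: (F _ - _)).
  by rewrite [_ *: 1]mulr1 scalerDl addrCA.
by split; rewrite /derivable /derive E.
Qed.

Lemma is_derive_line_inv (V : normedModType R) (F : V -> R) (x v : V) (D : R) :
  is_derive (0 : R) 1 (fun h => F (x + h *: v)) D -> is_derive x v F D.
Proof.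
move=> DF.
have E : (fun k : R => k^-1 *: (((fun h => F (x + h *: v)) \o shift 0) (k *: 1) - F (x + 0 *: v)))
  = (fun k : R => k^-1 *: ((F \o shift x) (k *: v) - F x)).
  apply/funext => k /=; rewrite scale0r !addr0 [_ *: 1]mulr1.
  by rewrite (addrC x).
have := @ex_derive _ _ _ _ _ _ _ DF; have := is_derive_val DF.
by rewrite /derivable /derive E => D1 D2; split.
Qed.

Lemma is_derive_mull (a t : R) : is_derive t 1 (fun h : R => a * h) a.
Proof. by rewrite -[X in is_derive _ _ _ X]mulr1; exact: (@is_deriveZ _ _ _ id a t 1). Qed.

Lemma is_derive_bigsum (V : normedModType R) (I : Type) (r : seq I)
    (f : I -> V -> R) (df : I -> R) (x v : V) :
  (forall i, is_derive x v (f i) (df i)) ->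
  is_derive x v (fun y => \sum_(i <- r) f i y) (\sum_(i <- r) df i).
Proof.
move=> Df; elim: r => [|i r IH].
  rewrite big_nil; under eq_fun do rewrite big_nil.
  exact: is_derive_cst.
rewrite big_cons; under eq_fun do rewrite big_cons.
exact: is_deriveD.
Qed.

(** The first derivative along the line vanishes at the maximum. A positive second derivative would
    make it positive just to the right, and by the mean value theorem the function would rise above
    its maximum. *)
Lemma derive2_max_le0 (V : normedModType R) (F : V -> R) (x v : V) :
  (forall y, derivable F y v) -> derivable (fun y => derive F y v) x v ->
  (forall h : R, F (x + h *: v) <= F x) ->
  derive (fun y => derive F y v) x v <= 0.
Proof.
move=> dF d2F Fmax; rewrite leNgt; apply/negP => a0.
set a : R := derive _ _ _ in a0.
pose g (h : R) : R := F (x + h *: v); pose g' (h : R) : R := derive F (x + h *: v) v.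
have Dg (h : R) : is_derive h 1 g (g' h) by exact: is_derive_line.
have g'0 : g' 0 = 0.
  have H : is_derive (0 : R) 1 g 0.
    apply: (@derive1_at_max _ _ (-1) 1); [lra| | |].
    - by move=> t _; exact: ex_derive.
    - by rewrite in_itv/=; lra.
    - by move=> t _; rewrite /g scale0r addr0.
  by rewrite -(is_derive_val (Dg 0)) (is_derive_val H).
have cv : h^-1 *: (((fun y => derive F y v) \o shift x) (h *: v) - derive F x v) @[h --> 0^'] --> a.
  exact: d2F.
have [e /= e0 He] := cvgr_gt a cv 0 a0.
have [c /[1!in_itv]/= /andP[c0 ce] E] : exists2 c, c \in `]0, e / 2[%R & g (e / 2) - g 0 = g' c * (e / 2 - 0).
  apply: (@MVT _ g g'); first lra.
  apply: derivable_within_continuous => t ?; exact: ex_derive.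
have : 0 < c^-1 *: (((fun y => derive F y v) \o shift x) (c *: v) - derive F x v).
  apply: He => /=; last exact: lt0r_neq0.
  by rewrite sub0r normrN gtr0_norm//; lra.
rewrite /= pmulr_rgt0 ?invr_gt0// subr_gt0 (addrC (c *: v)).
have -> : derive F x v = 0 by rewrite -g'0 /g' scale0r addr0.
rewrite -/(g' c) => g'c.
have : 0 < g (e / 2) - g 0 by rewrite E mulr_gt0//; lra.
by rewrite subr_gt0 /g scale0r addr0 ltNge Fmax.
Qed.

End one_sided_extrema.

Section ode.
Variable R : realType.

(** The sign of [dz] is required only at a minimising index and a positive time, where a generator
    pushes upwards. If the minimum of [z + e * t] over [J] and [[0, T]] were at a positive time, its
    left derivative would be both at most 0 and at least [e]. The predicate [J] serves to leave out
    diagonal pairs. *)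
Lemma ode_min_principle (I : finType) (J : pred I) (z dz : I -> R -> R) (T : R) :
  (forall i t, J i -> 0 <= t <= T -> is_derive t 1 (z i) (dz i t)) ->
  (forall i, J i -> 0 <= z i 0) ->
  (forall i t, J i -> 0 < t <= T -> (forall j, J j -> z i t <= z j t) ->
     0 <= dz i t) ->
  forall i t, J i -> 0 <= t <= T -> 0 <= z i t.
Proof.
move=> Dz z0 dz0 i0 t0 Ji0 /andP[t00 t0T].
have T0 : 0 <= T by apply: le_trans t0T.
suff H e : 0 < e -> 0 <= z i0 t0 + e * t0.
  apply/ler_addgt0Pr => e e0; rewrite (le_trans (H (e / (t0 + 1)) _))//.
    by rewrite divr_gt0// ltr_wpDl.
  rewrite lerD2l mulrAC ler_pdivrMr ?ltr_wpDl// ler_pM2l//; lra.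
move=> e0.
pose g i t := z i t + e * t.
have Dg i t : J i -> 0 <= t <= T -> is_derive t 1 (g i) (dz i t + e).
  move=> Ji tT; have Dzi := Dz i t Ji tT.
  apply: is_deriveD; rewrite -{2}[e]mulr1.
  exact: (@is_deriveZ _ _ _ id e t 1).
have min i : exists c, J i -> 0 <= c <= T /\ forall t, 0 <= t <= T -> g i c <= g i t.
  have [Ji|nJ] := boolP (J i); last by exists 0.
  have cg : {within `[0, T], continuous (g i)}.
    apply: derivable_within_continuous => t; rewrite in_itv/= => tT.
    by have := Dg i t Ji tT => ?; exact: ex_derive.
  have [c cT cmin] := EVT_min T0 cg.
  exists c => _; split=> [|t tT]; first by move: cT; rewrite in_itv.
  by apply: cmin; rewrite in_itv.
have {min} [c cP] := choice min.
case: (arg_minP (fun i => g i (c i)) Ji0) => i Ji imin.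
have [cT cmin] := cP i Ji.
have le_all j t : J j -> 0 <= t <= T -> g i (c i) <= g j t.
  by move=> Jj tT; rewrite (le_trans (imin j Jj))//; have [_] := cP j Jj; exact.
apply: (le_trans _ (le_all i0 t0 Ji0 _)); last by rewrite t00.
have [ci0|cin0] := eqVneq (c i) 0; first by rewrite /g ci0 mulr0 addr0 z0.
have cigt0 : 0 < c i by case/andP: cT => c0 _; rewrite lt_neqAle eq_sym cin0.
have d0 : 0 <= dz i (c i).
  apply: dz0 => //; first by rewrite cigt0; case/andP: cT.
  by move=> j Jj; have := le_all j (c i) Jj cT; rewrite /g lerD2r.
have : dz i (c i) + e <= 0.
  apply: (derive_left_min_le0 cigt0 (Dg i _ Ji cT)) => t /andP[t1 t2].
  by apply: cmin; rewrite t1 (le_trans t2)//; case/andP: cT.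
lra.
Qed.

(** The derivative is asked for in the open interval, because the limit path, a time integral from
    0, is shown to be differentiable at positive times. The function [expR (- s) * (G s + b)] is
    nonincreasing. *)
Lemma gronwall (G dG : R -> R) (b T : R) :
  {within `[0, T], continuous G} ->
  (forall t, 0 < t < T -> is_derive t 1 G (dG t)) ->
  (forall t, 0 < t < T -> dG t <= G t + b) ->
  forall t, 0 <= t <= T -> G t <= expR t * (G 0 + b) - b.
Proof.
move=> cG DG dGle t /andP[t0 tT].
pose H s := expR (- s) * (G s + b).
have DH s : 0 < s < T -> is_derive s 1 H (expR (- s) * (dG s - G s - b)).
  move=> sT; have D1 := DG s sT.
  have D2 : is_derive s 1 (fun s => expR (- s)) (- expR (- s)).
    have D3 : is_derive s 1 (expR \o -%R) (expR (- s) * -1) by exact: is_derive1_comp.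
    by rewrite -mulrN1.
  apply: is_derive_eq.
  by rewrite /GRing.scale/= addr0; ring.
have cH : {within `[0, T], continuous H}.
  move=> s; apply: cvgM; last by apply: cvgD; [exact: cG|exact: cvg_cst].
  have : continuous (fun s : R => expR (- s)).
    move=> u; apply: continuous_comp; first exact: opp_continuous.
    exact: continuous_expR.
  by move=> /(@continuous_subspaceT _ _ `[0, T]); exact.
have := @ler0_derive1_le_cc _ H 0 T _ _ cH t 0.
rewrite !in_itv/= lexx t0 tT (le_trans t0 tT) => HH.
have : H t <= H 0.
  apply: HH => // s; rewrite in_itv/= => sT; have Ds := DH s sT; first exact: ex_derive.
  rewrite derive1E derive_val mulr_ge0_le0 ?expR_ge0//.
  by have := dGle s sT; lra.
rewrite /H oppr0 expR0 mul1r expRN mulrC ler_pdivrMr ?expR_gt0// mulrC; lra.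
Qed.

End ode.

(** [y] ranges over the whole space: for periodic functions [x] is moved into the unit cube and [y]
    follows, possibly leaving it; for iterated integrals [y] lies on a parallel segment. *)
Lemma compact_unif_continuous (R : realType) (V : normedModType R) (K : set V) (f : V -> R) :
  compact K -> continuous f -> forall e : R, 0 < e ->
  exists2 r : R, 0 < r & forall x, K x -> forall y, `|x - y| < r -> `|f x - f y| < e.
Proof.
move=> /compact_near_coveringP cK cf e e0.
have e2 : 0 < e / 2 by rewrite divr_gt0.
pose Q (r : R) (x : V) := forall y, `|x - y| < r -> `|f x - f y| < e.
have H x : K x -> \forall x' \near x & i \near 0^'+, Q i x'.
  move=> Kx.
  have /cvgrPdist_lt/(_ _ e2)/nbhs_ballP[r /= r0 Hr] := cf x.
  exists (ball x (r / 2), [set s | s < r / 2]).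
    split; first by apply: nbhsx_ballx; rewrite divr_gt0.
    by apply: nbhs_right_lt; rewrite divr_gt0.
  move=> [x' s] [/= xx' sr] y x'y; rewrite /= in x'y.
  have h1 : `|f x - f x'| < e / 2.
    by apply: Hr; apply: le_ball xx'; rewrite ler_pdivrMr// ler_peMr ?ltW//; lra.
  have h2 : `|f x - f y| < e / 2.
    apply: Hr; rewrite -ball_normE /= -(subrKA x').
    apply: (le_lt_trans (ler_normD _ _)); move: xx'; rewrite -ball_normE /= => xx'.
    by rewrite [ltRHS]splitr ltrD// (lt_trans x'y).
  rewrite -(subrKA (f x)) (le_lt_trans (ler_normD _ _))// [ltRHS]splitr ltrD//.
  by rewrite distrC.
have [r /= r0 Hr] := cK R (0^'+) Q _ H.
exists (r / 2); first by rewrite divr_gt0.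
have r2 : 0 < r / 2 by rewrite divr_gt0.
have rr : ball_ Num.norm 0 r (r / 2).
  by rewrite /= sub0r normrN gtr0_norm//; lra.
by move=> x Kx y xy; exact: (Hr (r / 2) rr r2 x Kx y xy).
Qed.

(** * Periodic functions and the maximum principle for the heat equation *)

Section torus.
Variables (R : realType) (d : nat).
Implicit Types (f : 'rV[R]_d -> R) (x y z : 'rV[R]_d).

Lemma row_unitv (g : 'I_d -> R) : \row_i g i = \sum_i g i *: unitv R i.
Proof.
apply/rowP => j; rewrite mxE summxE (bigD1 j)//= !mxE eqxx mulr1 big1 ?addr0// => i ij.
by rewrite !mxE eq_sym (negbTE ij) mulr0.
Qed.

Lemma periodic_shift f : torus_periodic f ->
  forall (k : 'I_d -> int) x, f (x + \row_i (k i)%:~R) = f x.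
Proof.
move=> pf.
have nat_shift (m : nat) i x : f (x + m%:R *: unitv R i) = f x.
  elim: m x => [|m IH] x; first by rewrite scale0r addr0.
  by rewrite -natr1 scalerDl scale1r addrA pf.
have int_shift (m : int) i x : f (x + m%:~R *: unitv R i) = f x.
  case: m => m; first exact: nat_shift.
  by rewrite -(nat_shift m.+1 i (_ + _)) NegzE mulrNz scaleNr subrK.
move=> k x; rewrite row_unitv.
suff H (r : seq 'I_d) y : f (y + \sum_(i <- r) (k i)%:~R *: unitv R i) = f y by exact: H.
elim: r y => [|i r IH] y; first by rewrite big_nil addr0.
by rewrite big_cons addrA IH int_shift.
Qed.

Lemma torus_repr x : exists (k : 'I_d -> int) y,
  (forall i, 0 <= y 0 i < 1) /\ x = y + \row_i (k i)%:~R.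
Proof.
exists (fun i => Num.floor (x 0 i)), (\row_i (x 0 i - (Num.floor (x 0 i))%:~R)); split.
  move=> i; rewrite mxE subr_ge0 floor_le_tmp /= ltrBlDr addrC.
  by have := floorD1_gt (x 0 i); rewrite intrD.
by apply/rowP => i; rewrite !mxE subrK.
Qed.

Lemma compact_cube (a b : R) :
  compact [set x : 'rV[R]_d | forall i, a <= x 0 i <= b].
Proof.
have := @rV_compact R d (fun=> `[a, b]%classic) (fun=> @segment_compact R a b).
by congr compact; apply/seteqP; split=> x /= H i; have := H i; rewrite in_itv.
Qed.

Lemma periodic_bounded f : continuous f -> torus_periodic f ->
  exists2 K, 0 < K & forall x, `|f x| <= K.
Proof.
move=> cf pf.
have cn : {within [set x : 'rV[R]_d | forall i, 0 <= x 0 i <= 1],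
    continuous (fun x => `|f x|)}.
  by apply: continuous_subspaceT => x; exact: continuous_comp (cf x) (@norm_continuous _ _ _).
have [|c _ cmax] := @EVT_max_rV R d _ _ _ (@compact_cube 0 1) cn.
  by exists 0 => i /=; rewrite mxE lexx ler01.
exists (`|f c| + 1); first by rewrite ltr_wpDl.
move=> x; have [k [y [y01 ->]]] := torus_repr x.
rewrite periodic_shift// (le_trans (cmax _ _)) ?lerDl//.
by rewrite inE => i /=; have /andP[-> /ltW ->] := y01 i.
Qed.

Lemma periodic_unif_continuous f : continuous f -> torus_periodic f ->
  forall e, 0 < e ->
  exists2 r, 0 < r & forall x y, `|x - y| < r -> `|f x - f y| < e.
Proof.
move=> cf pf e e0.
have [r r0 Hr] := compact_unif_continuous (@compact_cube 0 1) cf e0.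
exists r => // x y xy; have [k [z [z01 xE]]] := torus_repr x.
rewrite -(subrK (\row_i (k i)%:~R) y) xE !periodic_shift//.
apply: Hr; first by move=> i /=; have /andP[-> /ltW ->] := z01 i.
by rewrite opprB addrA -xE.
Qed.

End torus.

Section heat_maximum_principle.
Variables (R : realType) (d : nat).
Implicit Types (f g : 'rV[R]_d -> R) (u v : 'rV[R]_d -> R -> R).

Lemma heat_solB f g u v : heat_sol f u -> heat_sol g v ->
  heat_sol (fun x => f x - g x) (fun x t => u x t - v x t).
Proof.
move=> [u0 [pu [cu Hu]]] [v0 [pv [cv Hv]]]; split; first by move=> x; rewrite u0 v0.
split; first by move=> x i t; rewrite pu pv.
split; first by move=> p; apply: cvgB; [exact: cu|exact: cv].
move=> x t t0; have [du [dxu eu]] := Hu x t t0; have [dv [dxv ev]] := Hv x t t0.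
split; first exact: derivableB.
have E i : (fun y => derive (fun z => u z t - v z t) y (unitv R i)) =
    (fun y => derive (fun z => u z t) y (unitv R i)) -
    (fun y => derive (fun z => v z t) y (unitv R i)).
  apply/funext => y.
  have [_ [/(_ i)[dy _] _]] := Hu y t t0; have [_ [/(_ i)[dy' _] _]] := Hv y t t0.
  exact: (deriveB dy dy').
split.
  move=> i; split; first by apply: derivableB; [have [] := dxu i|have [] := dxv i].
  by rewrite E; apply: derivableB; [have [] := dxu i|have [] := dxv i].
rewrite (_ : derive _ t 1 = derive (u x) t 1 - derive (v x) t 1); last exact: (deriveB du dv).
rewrite eu ev -sumrB; apply: eq_bigr => i _; rewrite E.
exact/esym/(deriveB (dxu i).2 (dxv i).2).
Qed.

(** Take a maximum of [u - e * t] over a period cell times [[0, T]]. At a positive time the second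
    derivatives are at most 0 there, while the time derivative, taken from the left, is at least
    [e]. *)
Lemma heat_le f u (c : R) : heat_sol f u -> (forall x, f x <= c) ->
  forall x t, 0 <= t -> u x t <= c.
Proof.
move=> [u0 [pu [cu Hu]]] fc x T T0.
have perx t (k : 'I_d -> int) y : u (y + \row_i (k i)%:~R) t = u y t.
  by rewrite (@periodic_shift _ _ (fun y => u y t))// => z i; exact: pu.
suff H e : 0 < e -> u x T <= c + e * T.
  apply/ler_addgt0Pr => e e0; rewrite (le_trans (H (e / (T + 1)) _))//.
    by rewrite divr_gt0// ltr_wpDl.
  rewrite lerD2l mulrAC ler_pdivrMr ?ltr_wpDl// ler_pM2l//; lra.
move=> e0.
pose K : set ('rV[R]_d * R) := [set x : 'rV[R]_d | forall i, 0 <= x 0 i <= 1] `*` `[0, T]%classic.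
have cK : compact K by apply: compact_setX; [exact: compact_cube|exact: segment_compact].
have K0 : K !=set0.
  by exists (0, 0); split => /=; [move=> i; rewrite mxE lexx ler01|rewrite in_itv/= lexx].
pose F (p : 'rV[R]_d * R) := u p.1 p.2 - e * p.2.
have cF : {within K, continuous F}.
  have cu' : {within K, continuous (fun p => u p.1 p.2)}.
    by apply: continuous_subspaceW cu => p [_ /=]; rewrite in_itv/= => /andP[].
  have c2 : {within K, continuous (fun p : 'rV[R]_d * R => e * p.2)}.
    apply: continuous_subspaceT => p; apply: cvgMl_tmp; exact: cvg_snd.
  by move=> p; apply: cvgB; [exact: cu'|exact: c2].
have [[a s] aK amax] := compact_EVT_max K0 cK cF.
have Fmax y t : 0 <= t <= T -> u y t - e * t <= u a s - e * s.
  move=> tT; have [k [z [z01 ->]]] := torus_repr y.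
  rewrite perx; apply: (amax (z, t)); rewrite inE; split => /=; last by rewrite in_itv.
  by move=> i; have /andP[-> /ltW ->] := z01 i.
move: aK; rewrite inE => -[_ /=]; rewrite in_itv/= => /andP[s0 sT].
have H1 : u x T - e * T <= u a s - e * s by apply: Fmax; rewrite T0 lexx.
have [s00|sn0] := eqVneq s 0.
  by rewrite s00 mulr0 subr0 u0 in H1; have := fc a; lra.
have {sn0}s0' : 0 < s by rewrite lt_neqAle eq_sym sn0.
have [dt [dx eq]] := Hu a s s0'.
have d2 i : derive (fun y => derive (fun z => u z s) y (unitv R i)) a (unitv R i) <= 0.
  apply: derive2_max_le0.
  - by move=> y; have [_ [/(_ i)[]]] := Hu y s s0'.
  - by have [] := dx i.
  - by move=> h; have := Fmax (a + h *: unitv R i) s; rewrite s0 sT => /(_ isT); lra.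
have dle0 : derive (u a) s 1 <= 0 by rewrite eq; apply: sumr_le0.
have : e - derive (u a) s 1 <= 0.
  apply: (@derive_left_min_le0 _ (fun t => e * t - u a t) _ 0 s) => //.
    have D1 : is_derive s 1 (u a) (derive (u a) s 1) by exact/derivableP.
    apply: is_deriveB; rewrite -{2}[e]mulr1.
    exact: (@is_deriveZ _ _ _ id e s 1).
  move=> t /andP[t0 ts]; have := Fmax a t; rewrite t0 (le_trans ts sT) => /(_ isT).
  lra.
lra.
Qed.

(** Contraction in the sup norm: through it a solution given only by the equation inherits estimates
    from explicit ones. *)
Lemma heat_dist f g u v (c : R) : heat_sol f u -> heat_sol g v ->
  (forall x, `|f x - g x| <= c) -> forall x t, 0 <= t -> `|u x t - v x t| <= c.
Proof.
move=> hu hv fg x t t0; rewrite ler_norml; apply/andP; split.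
  rewrite lerNl opprB; apply: (heat_le (heat_solB hv hu)) => // y.
  by have := fg y; rewrite distrC ler_norml => /andP[].
apply: (heat_le (heat_solB hu hv)) => // y.
by have := fg y; rewrite ler_norml => /andP[].
Qed.

End heat_maximum_principle.

(** * Trigonometric approximation of continuous periodic functions *)

Section trigonometric_sums.
Variable R : realType.
Implicit Types (x y h th : R).

Lemma cosD2pin x (n : nat) : cos (x + 2 * pi * n%:R) = cos x.
Proof.
rewrite -[RHS](periodicn (@cosD2pi R) n); congr cos.
by rewrite -(mulr_natr (pi *+ 2)) -(mulr_natl pi).
Qed.

Lemma sinD2pin x (n : nat) : sin (x + 2 * pi * n%:R) = sin x.
Proof.
rewrite -[RHS](periodicn (@sinD2pi R) n); congr sin.
by rewrite -(mulr_natr (pi *+ 2)) -(mulr_natl pi).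
Qed.

Lemma cosD2piz x (z : int) : cos (x + 2 * pi * z%:~R) = cos x.
Proof.
case: z => n; first exact: cosD2pin.
by rewrite NegzE mulrNz mulrN -[LHS](cosD2pin _ n.+1) subrK.
Qed.

Lemma sinsqDpiz x (z : int) : sin (x + pi * z%:~R) ^+ 2 = sin x ^+ 2.
Proof.
have H y : sin y ^+ 2 = (1 - cos (2 * y)) / 2.
  have -> : 2 * y = y *+ 2 by rewrite mulr_natl.
  by rewrite cos_mulr2n cos2sin2 mulr2n; field.
by rewrite !H mulrDr mulrA cosD2piz.
Qed.

Lemma cosX n x : cos x ^+ n =
  2^-1 ^+ n * \sum_(j < n.+1) 'C(n, j)%:R * cos ((n%:R - 2 * j%:R) * x).
Proof.
elim: n => [|n IH].
  by rewrite !expr0 big_ord_recl big_ord0 bin0 /= mulr0 subr0 mul0r cos0; ring.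
rewrite exprS IH mulrCA [in RHS]exprSr -mulrA; congr (_ * _).
rewrite mulr_sumr.
have E (j : nat) : cos x * ('C(n, j)%:R * cos ((n%:R - 2 * j%:R) * x)) =
  2^-1 * ('C(n, j)%:R * cos ((n.+1%:R - 2 * j%:R) * x) +
          'C(n, j)%:R * cos ((n.+1%:R - 2 * j.+1%:R) * x)).
  have -> : (n.+1%:R - 2 * j%:R) * x = (n%:R - 2 * j%:R) * x + x.
    by rewrite -natr1; ring.
  have -> : (n.+1%:R - 2 * j.+1%:R) * x = (n%:R - 2 * j%:R) * x - x.
    by rewrite -!natr1; ring.
  by rewrite cosD cosB; field.
rewrite (eq_bigr _ (fun j _ => E (nat_of_ord j))) -mulr_sumr; congr (_ * _).
rewrite big_split/= [in RHS]big_ord_recl /= bin0.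
under [in RHS]eq_bigr => j _ do rewrite /bump /= add1n binS natrD mulrDl.
rewrite big_split/= addrA; congr (_ + _).
rewrite big_ord_recl /= bin0; congr (_ + _).
rewrite [RHS]big_ord_recr/= bin_small// mul0r addr0.
by apply: eq_bigr => j _; rewrite /bump /= add1n.
Qed.

Lemma sum_cos_progression th h n : 2 * sin h * \sum_(a < n) cos (th - 2 * a%:R * h) =
  sin (th + h) - sin (th + h - 2 * n%:R * h).
Proof.
elim: n => [|n IH]; first by rewrite big_ord0 !mulr0 mul0r subr0 subrr.
rewrite big_ord_recr/= mulrDr IH.
have -> : th + h - 2 * n.+1%:R * h = (th - 2 * n%:R * h) - h by rewrite -natr1; ring.
have -> : th + h - 2 * n%:R * h = (th - 2 * n%:R * h) + h by ring.
by rewrite (sinD (th - _)) (sinB (th - _)); ring.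
Qed.

Variable M : nat.
Local Notation e := (eps R M).

Lemma eps_gt0 : 0 < e.
Proof. by rewrite /eps invr_gt0 ltr0n. Qed.

Lemma epsM : M.+1%:R * e = 1.
Proof. by rewrite /eps divff// pnatr_eq0. Qed.

(** Orthogonality on the grid. The telescoped sum is divided by [sin (pi * k * eps)], which is
    nonzero because the angle lies strictly between 0 and [pi]. *)
Lemma sum_cos_grid (k : nat) x : (0 < k < M.+1)%N ->
  \sum_(a < M.+1) cos (2 * pi * k%:R * (x - a%:R * e)) = 0.
Proof.
move=> /andP[k0 kM]; pose h := pi * k%:R * e.
have sh : sin h != 0.
  apply/lt0r_neq0/sin_gt0_pi; rewrite /h -mulrA.
  rewrite mulr_gt0 ?pi_gt0 ?mulr_gt0 ?eps_gt0 ?ltr0n//=.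
  by rewrite gtr_pMr ?pi_gt0// /eps ltr_pdivrMr ?ltr0n// mul1r ltr_nat.
have := sum_cos_progression (2 * pi * k%:R * x) h M.+1.
have -> : 2 * pi * k%:R * x + h - 2 * M.+1%:R * h =
   2 * pi * k%:R * x + h - 2 * pi * k%:R * (M.+1%:R * e) by rewrite /h; ring.
rewrite epsM mulr1 -[X in _ - X](sinD2pin _ k) subrK subrr.
rewrite (eq_bigr (fun a : 'I_M.+1 => cos (2 * pi * k%:R * (x - a%:R * e)))); last first.
  by move=> a _; congr cos; rewrite /h; ring.
by move/eqP; rewrite !mulf_eq0 pnatr_eq0/= (negbTE sh) => /eqP.
Qed.

(** The distance of [m] and [j]: one of the truncated differences is zero. *)
Definition absdist (m j : nat) := ((m - j) + (j - m))%N.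

Lemma cos_absdist (m j : nat) x :
  cos (((2 * m)%:R - 2 * j%:R) * (pi * x)) = cos (2 * pi * (absdist m j)%:R * x).
Proof.
rewrite /absdist natrM; have [jm|mj] := leqP j m.
  have /eqP -> : (j - m == 0)%N by rewrite subn_eq0.
  by rewrite addn0 natrB//; congr cos; ring.
have /eqP -> : (m - j == 0)%N by rewrite subn_eq0 ltnW.
rewrite add0n (natrB _ (ltnW mj)).
by rewrite -cosN; congr cos; ring.
Qed.

(** The de la Vallee Poussin kernel, unnormalised: nonnegative, of period 1, a trigonometric
    polynomial of degree [m] that concentrates at the integers. [kcoef] holds its cosine
    coefficients, [kmass] its sum over a grid. *)
Definition kern (m : nat) x := cos (pi * x) ^+ (2 * m).
Definition kcoef (m j : nat) : R := 2^-1 ^+ (2 * m) * 'C(2 * m, j)%:R.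
Definition kmass (m : nat) : R := M.+1%:R * (2^-1 ^+ (2 * m) * 'C(2 * m, m)%:R).

Lemma kernE m x : kern m x =
  \sum_(j < (2 * m).+1) kcoef m j * cos (2 * pi * (absdist m j)%:R * x).
Proof.
rewrite /kern cosX mulr_sumr; apply: eq_bigr => j _.
by rewrite cos_absdist mulrA.
Qed.

Lemma kern_ge0 m x : 0 <= kern m x.
Proof. by rewrite /kern exprM exprn_ge0// sqr_ge0. Qed.

(** All frequencies of [kern m] are at most [m], below the number of grid points, so only the
    constant term survives. The sum is exactly independent of [x], and the normalised kernels form a
    partition of unity. *)
Lemma sum_kern m x : (m < M.+1)%N -> \sum_(a < M.+1) kern m (x - a%:R * e) = kmass m.
Proof.
move=> mM.
under eq_bigr => a _ do rewrite kernE.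
rewrite exchange_big/=.
have mm : (m < (2 * m).+1)%N by rewrite ltnS mulSn mul1n leq_addr.
rewrite (bigD1 (Ordinal mm))//= [X in _ + X]big1 ?addr0.
  under eq_bigr => a _ do rewrite /absdist subnn addn0 mulr0 mul0r cos0 mulr1.
  by rewrite sumr_const card_ord -mulr_natl.
move=> j jm; rewrite -mulr_sumr sum_cos_grid ?mulr0//.
have {}jm : (j != m :> nat) by apply: contra jm => /eqP jm; apply/eqP/val_inj.
have jle : (j <= 2 * m)%N by rewrite -ltnS.
have [jltm|mltj|jeq] := ltngtP j m; last by rewrite jeq eqxx in jm.
  have /eqP E : (j - m == 0)%N by rewrite subn_eq0 ltnW.
  rewrite /absdist E addn0 subn_gt0 jltm/=.
  by rewrite (leq_ltn_trans (leq_subr _ _)).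
have /eqP E : (m - j == 0)%N by rewrite subn_eq0 ltnW.
rewrite /absdist E add0n subn_gt0 mltj/=.
by rewrite (leq_ltn_trans _ mM)// leq_subLR addnn -mul2n.
Qed.

Lemma kmass_gt0 m : 0 < kmass m.
Proof.
rewrite /kmass !mulr_gt0 ?ltr0n ?exprn_gt0 ?invr_gt0// bin_gt0.
by rewrite mulSn mul1n leq_addr.
Qed.

Lemma kmassS m : kmass m.+1 = kmass m * ((2 * m).+1%:R / (2 * m).+2%:R).
Proof.
have H : ((m.+1 * 'C(2 * m.+1, m.+1) = 2 * ((2 * m).+1 * 'C(2 * m, m)))%N).
  apply/eqP; rewrite -(eqn_pmul2r (ltn0Sn m)); apply/eqP.
  have mm : (m <= 2 * m)%N by rewrite mulSn mul1n leq_addr.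
  have -> : (2 * m.+1 = (2 * m).+2)%N by rewrite mulnS.
  have := mul_bin_diag (2 * m).+2 m; rewrite /= => <-.
  have := mul_bin_down (2 * m).+1 m; rewrite /=.
  have -> : ((2 * m).+1 - m = m.+1)%N by rewrite subSn// mulSn mul1n addnK.
  have E : ((2 * m).+2 = 2 * m.+1)%N by rewrite mulnS.
  by move=> ->; rewrite E !mulnA.
have m1 : (m.+1%:R : R) != 0 by rewrite pnatr_eq0.
have C' : ('C(2 * m.+1, m.+1)%:R : R) = 2 * (2 * m).+1%:R / m.+1%:R * 'C(2 * m, m)%:R.
  by apply: (mulfI m1); rewrite -[LHS]natrM H !natrM; field; rewrite nat1r.
rewrite /kmass C' mulnS !exprS.
have -> : ((2 * m).+2%:R : R) = 2 * m.+1%:R by rewrite -natrM mulnS.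
by field; rewrite nat1r.
Qed.

(** Since [sin^2 = 1 - cos^2], the weighted kernel is [kern m - kern m.+1], and the second moment is
    a difference of two consecutive masses. *)
Lemma sum_kern_sinsq m x : (m.+1 < M.+1)%N ->
  \sum_(a < M.+1) kern m (x - a%:R * e) * sin (pi * (x - a%:R * e)) ^+ 2 =
  kmass m / (2 * m).+2%:R.
Proof.
move=> mM.
have E a : kern m (x - a%:R * e) * sin (pi * (x - a%:R * e)) ^+ 2 =
    kern m (x - a%:R * e) - kern m.+1 (x - a%:R * e).
  by rewrite sin2cos2 mulrBr mulr1 /kern mulnS addnC exprD.
under eq_bigr do rewrite E.
rewrite sumrB !sum_kern//; last exact: ltnW.
rewrite kmassS -[(2 * m).+2%:R]natr1.
have : (2 * m).+1%:R + 1 != 0 :> R by rewrite natr1 pnatr_eq0.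
by move: ((2 * m).+1%:R) => q q0; field.
Qed.

End trigonometric_sums.

Section trigonometric_polynomials.
Variables (R : realType) (d : nat).
Implicit Types (f : 'rV[R]_d -> R) (x y : 'rV[R]_d) (k : 'I_d -> nat).

(** Amplitude, frequencies and centre of a product of cosines. In [trigsol] the damping [lam] is
    left open, so that one list of modes describes both the heat flow and its lattice
    counterpart. *)
Definition mode := (R * ('I_d -> nat) * 'rV[R]_d)%type.

Definition cosmode k y x := \prod_(i < d) cos (2 * pi * (k i)%:R * (x 0 i - y 0 i)).

Definition trigsol (lam : ('I_d -> nat) -> R) (p : seq mode) x (t : R) :=
  \sum_(m <- p) m.1.1 * (expR (- (lam m.1.2 * t)) * cosmode m.1.2 m.2 x).

Section kernel_approximation.
Variables (f : 'rV[R]_d -> R) (M m : nat).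
Hypothesis mM : (m.+1 < M.+1)%N.
Local Notation e := (eps R M).

Definition weight x (a : site d M) := \prod_(i < d) (kern m (x 0 i - (a i)%:R * e) / kmass R M m).

Lemma weight_ge0 x a : 0 <= weight x a.
Proof.
by apply: prodr_ge0 => i _; rewrite divr_ge0 ?kern_ge0// ltW// kmass_gt0.
Qed.

Lemma sum_weight x : \sum_a weight x a = 1.
Proof.
rewrite /weight -(bigA_distr_bigA (fun i (b : 'I_M.+1) => kern m (x 0 i - b%:R * e) / kmass R M m)).
rewrite big1// => i _; rewrite -mulr_suml sum_kern ?divff ?lt0r_neq0 ?kmass_gt0//.
exact: ltnW.
Qed.

Lemma sum_weight_sinsq x (i0 : 'I_d) :
  \sum_a weight x a * sin (pi * (x 0 i0 - (a i0)%:R * e)) ^+ 2 = (2 * m).+2%:R^-1.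
Proof.
pose s i (b : 'I_M.+1) : R := if i == i0 then sin (pi * (x 0 i0 - b%:R * e)) ^+ 2 else 1.
have E a : weight x a * sin (pi * (x 0 i0 - (a i0)%:R * e)) ^+ 2 =
   \prod_(i < d) (kern m (x 0 i - (a i)%:R * e) / kmass R M m * s i (a i)).
  by rewrite big_split/=; congr (_ * _); rewrite /s -big_mkcond big_pred1_eq.
under eq_bigr do rewrite E.
rewrite -(bigA_distr_bigA (fun i (b : 'I_M.+1) => kern m (x 0 i - b%:R * e) / kmass R M m * s i b)).
rewrite (bigD1 i0)//= [X in _ * X]big1 ?mulr1.
  rewrite /s eqxx; under eq_bigr do rewrite mulrAC.
  rewrite -mulr_suml sum_kern_sinsq// mulrAC divff ?mul1r//.
  by rewrite lt0r_neq0// kmass_gt0.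
move=> i /negbTE ii0; rewrite /s ii0; under eq_bigr do rewrite mulr1.
by rewrite -mulr_suml sum_kern ?divff ?lt0r_neq0 ?kmass_gt0// ltnW.
Qed.

Definition kernel_modes : seq mode :=
  [seq (f (pos R aJ.1) * \prod_i (kcoef R m (aJ.2 i) / kmass R M m),
        fun i => absdist m (aJ.2 i), pos R aJ.1)
  | aJ : (site d M * {ffun 'I_d -> 'I_(2 * m).+1})%type <- index_enum ((site d M) * {ffun 'I_d -> 'I_(2 * m).+1})%type].

Lemma kernel_modesE lam x :
  trigsol lam kernel_modes x 0 = \sum_a f (pos R a) * weight x a.
Proof.
rewrite /trigsol big_map -(pair_bigA _ (fun a J =>
  f (pos R a) * \prod_i (kcoef R m ((J : {ffun 'I_d -> 'I_(2 * m).+1}) i) / kmass R M m) *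
  (expR (- (lam (fun i => absdist m (J i)) * 0)) * cosmode (fun i => absdist m (J i)) (pos R a) x)))/=.
apply: eq_bigr => a _.
under eq_bigr do rewrite mulr0 oppr0 expR0 mul1r -mulrA -big_split/=.
rewrite -mulr_sumr; congr (_ * _); rewrite /weight.
rewrite -(bigA_distr_bigA (fun i (j : 'I_(2 * m).+1) => kcoef R m j / kmass R M m *
  cos (2 * pi * (absdist m j)%:R * (x 0 i - pos R a 0 i)))).
apply: eq_bigr => i _; rewrite kernE mulr_suml; apply: eq_bigr => j _.
by rewrite mxE mulrAC.
Qed.

End kernel_approximation.

(** [sin^2] of [pi * u] measures the distance of [u] to the integers; the witness is the nearest
    integer, which brings the angle into the range where [sin] is increasing. *)
Lemma sinsq_small (r u : R) : 0 < r -> r <= 1/4 -> sin (pi * u) ^+ 2 < sin (pi * r) ^+ 2 ->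
  exists z : int, `|u - z%:~R| < r.
Proof.
move=> r0 r4 us; exists (Num.floor (u + 1/2)).
set v := u - _.
have pi0 := pi_gt0 R.
have sv : sin (pi * v) ^+ 2 = sin (pi * u) ^+ 2.
  by rewrite -(sinsqDpiz (pi * v) (Num.floor (u + 1/2))) -mulrDr subrK.
have vle : `|v| <= 1/2.
  rewrite ler_norml; have := floor_le_tmp (u + 1/2); have := floorD1_gt (u + 1/2).
  by rewrite intrD /v => h1 h2; apply/andP; split; lra.
have nv : sin (pi * `|v|) ^+ 2 = sin (pi * v) ^+ 2.
  have [v0|v0] := leP 0 v; first by rewrite ger0_norm.
  by rewrite ltr0_norm// mulrN sinN sqrrN.
have p1 : pi * `|v| <= pi / 2 by have := ler_wpM2l (ltW pi0) vle; lra.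
have p0 : 0 <= pi * `|v| by rewrite mulr_ge0// ltW.
have q0 : 0 < pi * r by rewrite mulr_gt0.
have q1 : pi * r <= pi * (1/4) by rewrite ler_wpM2l// ltW.
have : sin (pi * `|v|) < sin (pi * r).
  rewrite -(@ltr_pXn2r _ 2)// ?nnegrE; first by rewrite nv sv.
    by rewrite sin_ge0_pi// p0; lra.
  by rewrite sin_ge0_pi// (ltW q0)/=; lra.
rewrite ltr_sin ?ltr_pM2l// in_itv/=; apply/andP; split; lra.
Qed.

(** Chebyshev's argument as in Bernstein's proof of the Weierstrass theorem: grid points near [x]
    modulo integers contribute at most [e / 2]; elsewhere [2 * K] is bounded by [2 * K / s] times a
    sum of [sin^2] whose mean is [d / (2 * m + 2)]. At time zero the damping is invisible, hence the
    uniformity in [lam]. *)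
Lemma trig_dense f : continuous f -> torus_periodic f -> forall e, 0 < e ->
  exists p, forall lam x, `|f x - trigsol lam p x 0| <= e.
Proof.
move=> cf pf e e0.
have e2 : 0 < e / 2 by rewrite divr_gt0.
have [r r0 Hr] := periodic_unif_continuous cf pf e2.
have [K K0 fK] := periodic_bounded cf pf.
pose r' := Num.min r (1/4).
have r'0 : 0 < r' by rewrite lt_min r0; lra.
have r'4 : r' <= 1/4 by rewrite ge_min lexx orbT.
have pi0 := pi_gt0 R.
pose s := sin (pi * r') ^+ 2.
have s0 : 0 < s.
  rewrite exprn_gt0// sin_gt0_pi// mulr_gt0//=.
  by have := ler_wpM2l (ltW pi0) r'4; lra.
have Ks0 : 0 <= 2 * K / s by apply: divr_ge0; [lra|exact: ltW].
pose B := 2 * K / s * d%:R.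
have B0 : 0 <= B by rewrite !mulr_ge0// ?invr_ge0 ltW.
have [m Hm] : exists m : nat, B / (2 * m).+2%:R <= e / 2.
  exists (Num.trunc (B / (e / 2))).+1.
  rewrite ler_pdivrMr// mulrC -ler_pdivrMr//.
  have := truncnS_gt (B / (e / 2)); set q := Num.trunc _ => /ltW/le_trans; apply.
  by rewrite ler_nat (leq_trans (leq_pmull _ (isT : 0 < 2)%N))// ltnW// ltnW.
(* [m + 2] points per direction are the fewest for which [sum_kern_sinsq] applies, as it also sums
   [kern m.+1]. *)
exists (kernel_modes f m.+1 m) => lam x; rewrite kernel_modesE.
have mM : (m.+1 < m.+2)%N by [].
rewrite -[f x]mulr1 -(sum_weight mM x) mulr_sumr -sumrB.
apply: (le_trans (ler_norm_sum _ _ _)).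
apply: (@le_trans _ _ (\sum_a (weight m x a * (e / 2) + \sum_(i < d) 2 * K / s *
   (weight m x a * sin (pi * (x 0 i - (a i)%:R * eps R m.+1)) ^+ 2)))).
  apply: ler_sum => a _; rewrite -mulrBl normrM (ger0_norm (weight_ge0 _ _ _)) mulrC.
  under [in leRHS]eq_bigr do rewrite mulrCA.
  rewrite -mulr_sumr -mulrDr ler_wpM2l ?weight_ge0//.
  have [far|near] := pselect (exists i, s <= sin (pi * (x 0 i - (a i)%:R * eps R m.+1)) ^+ 2).
    have [i si] := far.
    apply: (@le_trans _ _ (2 * K)).
      by apply: (le_trans (ler_normB _ _)); have := fK x; have := fK (pos R a); lra.
    rewrite ler_wpDl ?(ltW e2)// (bigD1 i)//= ler_wpDr//.
      by apply: sumr_ge0 => j _; rewrite mulr_ge0 ?sqr_ge0 ?Ks0.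
    apply: (@le_trans _ _ (2 * K / s * s)); last by rewrite ler_wpM2l.
    by rewrite divfK ?lt0r_neq0.
  have near' i : exists z : int, `|x 0 i - (a i)%:R * eps R m.+1 - z%:~R| < r'.
    apply: sinsq_small => //; rewrite ltNge; apply/negP => H.
    by apply: near; exists i.
  have [z Hz] := choice near'.
  rewrite ler_wpDr//.
    by apply: sumr_ge0 => i _; rewrite mulr_ge0 ?sqr_ge0 ?Ks0.
  rewrite -(periodic_shift pf z (pos R a)); apply/ltW/Hr.
  apply: (@lt_le_trans _ _ r'); last by rewrite ge_min lexx.
  rewrite -[`|_|]/(mx_norm _) mx_normrE (bigmax_lt _ _)//= => -[i j] _ /=.
  by rewrite !mxE ord1 opprD addrA; exact: Hz.
rewrite big_split/= -mulr_suml (sum_weight mM) mul1r exchange_big/=.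
under eq_bigr do rewrite -mulr_sumr (sum_weight_sinsq mM).
rewrite sumr_const card_ord [leRHS]splitr; apply: lerD => //.
apply: le_trans Hm; rewrite /B -(mulr_natr (_ / (2 * m).+2%:R)).
by rewrite -(mulrA _ d%:R) (mulrC d%:R) mulrA.
Qed.

End trigonometric_polynomials.

(** * Heat flows of trigonometric polynomials, continuum and lattice *)

Section trigonometric_heat.
Variables (R : realType) (d : nat).
Implicit Types (x y : 'rV[R]_d) (k : 'I_d -> nat) (p : seq (mode R d)).

(** The eigenvalue of minus the Laplacian on [cosmode k y]; [ldamping] is that of minus the lattice
    Laplacian scaled by [eps^-2]. *)
Definition damping k : R := \sum_(i < d) (2 * pi * (k i)%:R) ^+ 2.

Definition ldamping (M : nat) k : R :=
  \sum_(i < d) 2 * (1 - cos (2 * pi * (k i)%:R * eps R M)) / eps R M ^+ 2.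

Lemma damping_ge0 k : 0 <= damping k.
Proof. by apply: sumr_ge0 => i _; exact: sqr_ge0. Qed.

Lemma ldamping_ge0 M k : 0 <= ldamping M k.
Proof.
apply: sumr_ge0 => i _; rewrite divr_ge0 ?sqr_ge0// mulr_ge0//.
Qed.

Lemma norm_coord x i : `|x 0 i| <= `|x|.
Proof. by rewrite -[X in _ <= X]/(mx_norm _) mx_normrE (le_bigmax _ _ (0, i)). Qed.

Lemma norm_unitv (i : 'I_d) : `|unitv R i| = 1.
Proof.
rewrite -[LHS]/(mx_norm _) mx_normrE; apply/eqP; rewrite eq_le; apply/andP; split.
  apply: bigmax_le => // -[a b] _ /=; rewrite mxE.
  by case: (b == i); rewrite ?normr1 ?normr0.
apply: (@le_trans _ _ `|unitv R i 0 i|); first by rewrite mxE eqxx normr1.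
exact: (le_bigmax _ _ (0, i)).
Qed.

Definition cosmode' k y (i : 'I_d) x := \prod_(j < d | j != i) cos (2 * pi * (k j)%:R * (x 0 j - y 0 j)).

Lemma cosmodeE k y i x :
  cosmode k y x = cos (2 * pi * (k i)%:R * (x 0 i - y 0 i)) * cosmode' k y i x.
Proof. by rewrite /cosmode (bigD1 i). Qed.

Lemma cosmode'_line k y i x (h : R) : cosmode' k y i (x + h *: unitv R i) = cosmode' k y i x.
Proof.
by apply: eq_bigr => j ji; rewrite !mxE (negbTE ji) mulr0 addr0.
Qed.

Lemma is_derive_cosmode k y i x : is_derive x (unitv R i) (cosmode k y)
  (- (2 * pi * (k i)%:R) * sin (2 * pi * (k i)%:R * (x 0 i - y 0 i)) * cosmode' k y i x).
Proof.
apply: is_derive_line_inv; set a := 2 * pi * (k i)%:R.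
have -> : (fun h : R => cosmode k y (x + h *: unitv R i)) =
   (fun h : R => cosmode' k y i x * cos (a * h + a * (x 0 i - y 0 i))).
  apply/funext => h; rewrite (cosmodeE _ _ i) cosmode'_line mulrC; congr (_ * cos _).
  by rewrite !mxE eqxx mulr1; rewrite /a; ring.
have D1 : is_derive (0 : R) 1 (fun h => a * h + a * (x 0 i - y 0 i)) a.
  have D0 := is_derive_mull a 0.
  by apply: is_derive_eq; rewrite addr0.
have D2 : is_derive (0 : R) 1 (cos \o (fun h => a * h + a * (x 0 i - y 0 i)))
    (- sin (a * 0 + a * (x 0 i - y 0 i)) * a) by exact: is_derive1_comp.
have D3 := @is_deriveZ _ _ _ _ (cosmode' k y i x) (0 : R) 1 _ D2.
by apply: (is_derive_eq D3); rewrite /GRing.scale/= mulr0 add0r; ring.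
Qed.

Lemma is_derive_cosmode2 k y i x : is_derive x (unitv R i)
  (fun x => - (2 * pi * (k i)%:R) * sin (2 * pi * (k i)%:R * (x 0 i - y 0 i)) * cosmode' k y i x)
  (- (2 * pi * (k i)%:R) ^+ 2 * cosmode k y x).
Proof.
apply: is_derive_line_inv; set a := 2 * pi * (k i)%:R.
rewrite (_ : (fun h : R => _) =
   (fun h : R => (- a * cosmode' k y i x) * sin (a * h + a * (x 0 i - y 0 i)))); last first.
  apply/funext => h; rewrite cosmode'_line mulrAC; congr (_ * sin _).
  by rewrite !mxE eqxx mulr1; rewrite /a; ring.
have D1 : is_derive (0 : R) 1 (fun h => a * h + a * (x 0 i - y 0 i)) a.
  have D0 := is_derive_mull a 0.
  by apply: is_derive_eq; rewrite addr0.
have D2 : is_derive (0 : R) 1 (sin \o (fun h => a * h + a * (x 0 i - y 0 i)))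
    (cos (a * 0 + a * (x 0 i - y 0 i)) * a) by exact: is_derive1_comp.
have D3 := @is_deriveZ _ _ _ _ (- a * cosmode' k y i x) (0 : R) 1 _ D2.
by apply: (is_derive_eq D3); rewrite (cosmodeE _ _ i) /GRing.scale/= mulr0 add0r; ring.
Qed.

Lemma is_derive_trigsol lam p x (t : R) : is_derive t 1 (trigsol lam p x)
  (\sum_(m <- p) m.1.1 * (- lam m.1.2 * (expR (- (lam m.1.2 * t)) * cosmode m.1.2 m.2 x))).
Proof.
apply: is_derive_bigsum => -[[c k] y] /=.
have D1 : is_derive t 1 (fun t : R => - (lam k * t)) (- lam k).
  by have D0 := is_derive_mull (lam k) t; exact: is_deriveN.
have D2 : is_derive t 1 (expR \o (fun t : R => - (lam k * t)))
    (expR (- (lam k * t)) * - lam k) by exact: is_derive1_comp.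
have D3 := @is_deriveZ _ _ _ _ (c * cosmode k y x) t 1 _ D2.
apply: (is_derive_eq (f' := (c * cosmode k y x) *: (expR (- (lam k * t)) * - lam k))).
  have -> : (fun t0 : R => c * (expR (- (lam k * t0)) * cosmode k y x)) =
     (c * cosmode k y x) \*: (expR \o (fun t : R => - (lam k * t))).
    by apply/funext => s /=; rewrite /GRing.scale/=; ring.
  exact: D3.
by rewrite /GRing.scale/=; ring.
Qed.

Lemma cosmode_continuous k y : continuous (cosmode k y).
Proof.
move=> x; have FF : Filter (nbhs x) by exact: nbhs_filter.
rewrite /cosmode; apply: (cvg_big mul_continuous FF) => i _.
apply: (@cvg_comp _ _ _ (fun x => 2 * pi * (k i)%:R * (x 0 i - y 0 i)) cos); last exact: continuous_cos.
by apply: cvgMl_tmp; apply: cvgB; [exact: coord_continuous|exact: cvg_cst].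
Qed.

Lemma trigsol_continuous lam p :
  continuous (fun q : 'rV[R]_d * R => trigsol lam p q.1 q.2).
Proof.
move=> q; apply: (cvg_big add_continuous) => m _; apply: cvgMl_tmp; apply: cvgM.
  apply: (@cvg_comp _ _ _ (fun q : 'rV[R]_d * R => - (lam m.1.2 * q.2)) expR); last exact: continuous_expR.
  by apply: cvgN; apply: cvgMl_tmp; exact: cvg_snd.
apply: (@cvg_comp _ _ _ fst (cosmode m.1.2 m.2)); [exact: cvg_fst|exact: cosmode_continuous].
Qed.

Lemma cosmode_periodic k y : torus_periodic (cosmode k y).
Proof.
move=> x i; rewrite /cosmode; apply: eq_bigr => j _.
rewrite !mxE -[RHS](cosD2pin _ ((k j) * (j == i))); congr cos.
by rewrite natrM; ring.
Qed.

Lemma heat_sol_trigsol p :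
  heat_sol (fun x => trigsol damping p x 0) (trigsol damping p).
Proof.
split => //; split.
  by move=> x i t; apply: eq_bigr => m _; rewrite cosmode_periodic.
split; first exact/continuous_subspaceT/trigsol_continuous.
move=> x t t0; have Dt := is_derive_trigsol damping p x t.
split; first exact: ex_derive.
pose df i x := \sum_(m <- p) (m.1.1 * expR (- (damping m.1.2 * t))) * (- (2 * pi * (m.1.2 i)%:R) *
     sin (2 * pi * (m.1.2 i)%:R * (x 0 i - m.2 0 i)) * cosmode' m.1.2 m.2 i x).
have D1 i y : is_derive y (unitv R i) (fun y => trigsol damping p y t) (df i y).
  rewrite /trigsol /df; under eq_fun do under eq_bigr do rewrite mulrA.
  apply: is_derive_bigsum => m.
  exact: (@is_deriveZ _ _ _ _ _ y (unitv R i) _ (is_derive_cosmode _ _ _ _)).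
have E i : (fun y => derive (fun z => trigsol damping p z t) y (unitv R i)) = df i.
  by apply/funext => y; exact: is_derive_val.
have D2 i : is_derive x (unitv R i) (df i) (\sum_(m <- p)
   (m.1.1 * expR (- (damping m.1.2 * t))) * (- (2 * pi * (m.1.2 i)%:R) ^+ 2 * cosmode m.1.2 m.2 x)).
  apply: is_derive_bigsum => m.
  exact: (@is_deriveZ _ _ _ _ _ x (unitv R i) _ (is_derive_cosmode2 _ _ _ _)).
split; first by move=> i; rewrite E; split; exact: ex_derive.
rewrite (is_derive_val Dt).
under [RHS]eq_bigr do rewrite E (is_derive_val (D2 _)).
rewrite exchange_big/=; apply: eq_bigr => m _.
rewrite -mulr_sumr -mulr_suml sumrN -/(damping _); ring.
Qed.

Definition lipconst p : R :=
  \sum_(m <- p) `|m.1.1| * \sum_(i < d) 2 * pi * (m.1.2 i)%:R.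

Lemma cosmode_le1 k y x : `|cosmode k y x| <= 1.
Proof.
rewrite normr_prod; apply: prodr_ile1 => i _.
by rewrite normr_ge0 cos_max.
Qed.

Lemma expRN_le1 (a t : R) : 0 <= a -> 0 <= t -> expR (- (a * t)) <= 1.
Proof. by move=> a0 t0; rewrite -expR0 ler_expR oppr_le0 mulr_ge0. Qed.

Lemma cos_lip (a b : R) : `|cos a - cos b| <= `|a - b|.
Proof.
wlog ab : a b / a <= b.
  by move=> H; have [/H//|/ltW/H] := leP a b; rewrite distrC (distrC b).
move: ab; rewrite le_eqVlt => /predU1P[->|ab]; first by rewrite !subrr normr0.
have [|c _] := @MVT R cos (fun x : R => - sin x) a b ab _.
  by apply: continuous_subspaceT; exact: continuous_cos.
by rewrite distrC (distrC a) => ->; rewrite normrM ler_piMl// normrN sin_max.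
Qed.

Lemma prod_lip (I : Type) (r : seq I) (F G : I -> R) :
  (forall i, `|F i| <= 1) -> (forall i, `|G i| <= 1) ->
  `|\prod_(i <- r) F i - \prod_(i <- r) G i| <= \sum_(i <- r) `|F i - G i|.
Proof.
move=> F1 G1; elim: r => [|i r IH]; first by rewrite !big_nil subrr normr0.
rewrite !big_cons.
have -> : F i * \prod_(j <- r) F j - G i * \prod_(j <- r) G j =
  (F i - G i) * \prod_(j <- r) F j + G i * (\prod_(j <- r) F j - \prod_(j <- r) G j) by ring.
apply: (le_trans (ler_normD _ _)); rewrite !normrM lerD//.
  rewrite ler_piMr// normr_prod; apply: prodr_ile1 => j _; by rewrite normr_ge0 F1.
by apply: le_trans IH; rewrite ler_piMl.
Qed.

(** The constant depends on the modes alone, since the exponential factors are at most 1: it serves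
    both flows, every mesh and every time down to zero. *)
Lemma trigsol_lip lam p x y (t : R) : (forall k, 0 <= lam k) -> 0 <= t ->
  `|trigsol lam p x t - trigsol lam p y t| <= lipconst p * `|x - y|.
Proof.
move=> l0 t0; rewrite /trigsol -sumrB mulr_suml.
apply: (le_trans (ler_norm_sum _ _ _)); apply: ler_sum => m _.
rewrite -mulrBr -mulrBr normrM -mulrA ler_wpM2l// normrM.
apply: (@le_trans _ _ `|cosmode m.1.2 m.2 x - cosmode m.1.2 m.2 y|).
  by rewrite ler_piMl// ger0_norm ?expR_ge0// expRN_le1.
apply: (le_trans (prod_lip _ _ _)); [by move=> i; exact: cos_max..|].
rewrite mulr_suml; apply: ler_sum => i _.
apply: (le_trans (cos_lip _ _)); rewrite -mulrBr normrM ger0_norm.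
  rewrite ler_wpM2l ?mulr_ge0 ?pi_ge0//.
  rewrite opprB addrA subrK; apply: le_trans (norm_coord (x - y) i).
  by rewrite !mxE.
by rewrite !mulr_ge0// pi_ge0.
Qed.

End trigonometric_heat.

Section lattice_heat.
Variables (R : realType) (d M : nat).
Local Notation e := (eps R M).
Local Notation site := (site d M).
Implicit Types (x : site) (l : 'I_d) (b : bool).

Definition sgnb b : R := if b then 1 else -1.

(** Neighbours wrap around in their index, so the position moves by [eps] only up to an integer
    vector; [k] records the wrap. *)
Lemma pos_nbr x l b : exists k : 'I_d -> int,
  pos R (nbr x l b) = pos R x + (sgnb b * e) *: unitv R l + \row_i (k i)%:~R.
Proof.
exists (fun i => if i == l then
  (if b then (if x i == M :> nat then -1 else 0)
        else (if x i == 0%N :> nat then 1 else 0)) else 0).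
apply/rowP => i; rewrite !mxE ffunE; have [->|il] := eqVneq i l; last first.
  by rewrite mulr0 !addr0.
have eM : M%:R * e + e = 1 by have := epsM R M; rewrite -natr1 mulrDl mul1r.
rewrite mulr1; case: b => /=.
  rewrite /sgnb mul1r; case: eqP => xM.
    by rewrite xM modnn mul0r; lra.
  have lt : ((x l).+1 < M.+1)%N by rewrite ltnS ltn_neqAle; apply/andP; split; [exact/eqP|rewrite -ltnS].
  by rewrite modn_small// -natr1 mulr0z addr0; ring.
rewrite /sgnb; case: eqP => x0.
  by rewrite x0 add0n /= modn_small// mulr1z mul0r; lra.
have xpos : (0 < x l)%N by rewrite lt0n; apply/eqP.
have xlt : ((x l).-1 < M.+1)%N by rewrite (leq_ltn_trans (leq_pred _)).
rewrite -[X in (X + _).-1](prednK xpos) addSn /= modnDr modn_small// mulr0z addr0.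
by rewrite -[in RHS](prednK xpos) -natr1; ring.
Qed.

Lemma periodic_nbr (f : 'rV[R]_d -> R) x l b : torus_periodic f ->
  f (pos R (nbr x l b)) = f (pos R x + (sgnb b * e) *: unitv R l).
Proof. by move=> pf; have [k ->] := pos_nbr x l b; rewrite periodic_shift. Qed.

Lemma lattice_laplacian_cosmode k y x :
  e ^- 2 * (\sum_(l < d) \sum_(b : bool)
    (cosmode k y (pos R (nbr x l b)) - cosmode k y (pos R x))) =
  - ldamping R M k * cosmode k y (pos R x).
Proof.
rewrite /ldamping -sumrN mulr_suml mulr_sumr; apply: eq_bigr => l _.
rewrite big_bool /= !(periodic_nbr _ _ _ (cosmode_periodic _ _)).
rewrite !(cosmodeE _ _ l) !cosmode'_line !mxE eqxx !mulr1.
set a := 2 * pi * (k l)%:R; set u := (x l)%:R * e - y 0 l; set Q := cosmode' _ _ _ _.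
have -> : a * ((x l)%:R * e + sgnb true * e - y 0 l) = a * u + a * e.
  by rewrite /u /sgnb; ring.
have -> : a * ((x l)%:R * e + sgnb false * e - y 0 l) = a * u - a * e.
  by rewrite /u /sgnb; ring.
have e0 : e != 0 by rewrite lt0r_neq0// eps_gt0.
by rewrite cosD cosB; field.
Qed.

Lemma is_derive_lattice_trigsol (p : seq (mode R d)) x (t : R) :
  is_derive t 1 (trigsol (ldamping R M) p (pos R x))
    (e ^- 2 * (\sum_(l < d) \sum_(b : bool)
      (trigsol (ldamping R M) p (pos R (nbr x l b)) t -
       trigsol (ldamping R M) p (pos R x) t))).
Proof.
have D := is_derive_trigsol (ldamping R M) p (pos R x) t.
apply: (is_derive_eq D).
under [in RHS]eq_bigr => l _ do under eq_bigr => b _ do rewrite /trigsol -sumrB.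
under [in RHS]eq_bigr => l _ do rewrite exchange_big/=.
rewrite exchange_big/= mulr_sumr; apply: eq_bigr => m _.
under [in RHS]eq_bigr => l _ do under eq_bigr => b _ do rewrite -mulrBr -mulrBr mulrA.
under [in RHS]eq_bigr => l _ do rewrite -mulr_sumr.
by rewrite -mulr_sumr [RHS]mulrCA lattice_laplacian_cosmode; ring.
Qed.

End lattice_heat.

Section damping_convergence.
Variables (R : realType) (d : nat).

(** The expression is the square of [2 * sin (a / 2 * h) / h], a difference quotient at 0 of a
    function with derivative [a]. *)
Lemma cos_quotient_cvg (a e : R) : 0 < e -> exists2 r : R, 0 < r &
  forall h, 0 < h < r -> `|2 * (1 - cos (a * h)) / h ^+ 2 - a ^+ 2| <= e.
Proof.
move=> e0; pose G h : R := 2 * sin (a / 2 * h).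
have DG : is_derive (0 : R) 1 G a.
  have D0 := is_derive_mull (a / 2) 0.
  have D1 : is_derive (0 : R) 1 (sin \o (fun h => a / 2 * h)) (cos (a / 2 * 0) * (a / 2)).
    exact: is_derive1_comp.
  have D2 := @is_deriveZ _ _ _ _ 2 (0 : R) 1 _ D1.
  by apply: (is_derive_eq D2); rewrite /GRing.scale/= mulr0 cos0; field.
have cv : h^-1 *: ((G \o shift 0) (h *: 1) - G 0) @[h --> 0^'] --> a.
  by have := @ex_derive _ _ _ _ _ _ _ DG; rewrite /derivable -(is_derive_val DG).
have cv2 : (h^-1 *: ((G \o shift 0) (h *: 1) - G 0)) *
    (h^-1 *: ((G \o shift 0) (h *: 1) - G 0)) @[h --> 0^'] --> a * a.
  by apply: cvgM.
have /cvgrPdist_le/(_ _ e0)[r /= r0 Hr] := cv2.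
exists r => // h /andP[h0 hr].
have := Hr h; rewrite /= sub0r normrN gtr0_norm// => /(_ hr (lt0r_neq0 h0)).
rewrite addr0 [h *: 1]mulr1 /G mulr0 sin0 mulr0 subr0 distrC expr2.
suff -> : (h^-1 *: (2 * sin (a / 2 * h))) * (h^-1 *: (2 * sin (a / 2 * h))) =
   2 * (1 - cos (a * h)) / h ^+ 2 by [].
have -> : a * h = (a / 2 * h) *+ 2 by rewrite mulr2n; field.
rewrite cos_mulr2n cos2sin2 /GRing.scale/= mulr2n; field.
exact: lt0r_neq0.
Qed.

Lemma common_radius (I : eqType) (s : seq I) (P : I -> R -> Prop) :
  (forall i, exists2 r : R, 0 < r & forall h, 0 < h < r -> P i h) ->
  exists2 r : R, 0 < r & forall i, i \in s -> forall h, 0 < h < r -> P i h.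
Proof.
move=> HP; elim: s => [|i s [r r0 Hr]]; first by exists 1.
have [r' r'0 Hr'] := HP i.
exists (Num.min r r'); first by rewrite lt_min r0.
move=> j; rewrite inE => /predU1P[->|js] h; rewrite lt_min => /and3P[h0 h1 h2].
  by apply: Hr'; rewrite h0.
by apply: Hr => //; rewrite h0.
Qed.

Lemma ldamping_cvg (k : 'I_d -> nat) (e : R) : 0 < e -> exists2 r : R, 0 < r &
  forall M, eps R M < r -> `|ldamping R M k - damping R k| <= e.
Proof.
move=> e0.
have d0 : 0 < e / d.+1%:R by rewrite divr_gt0.
have [r r0 Hr] := common_radius (enum 'I_d) (fun i => @cos_quotient_cvg (2 * pi * (k i)%:R) _ d0).
exists r => // M Mr; rewrite /ldamping /damping -sumrB.
apply: (le_trans (ler_norm_sum _ _ _)).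
apply: (@le_trans _ _ (\sum_(i < d) e / d.+1%:R)).
  apply: ler_sum => i _; apply: (Hr i _ (eps R M)); first by rewrite mem_enum.
  by rewrite eps_gt0.
rewrite sumr_const card_ord -(mulr_natr (e / _)) -mulrA ler_piMr ?(ltW e0)//.
by rewrite mulrC ler_pdivrMr// mul1r ler_nat.
Qed.

Lemma expRN_lip (a b t : R) : 0 <= a -> 0 <= b -> 0 <= t ->
  `|expR (- (a * t)) - expR (- (b * t))| <= `|a - b| * t.
Proof.
move=> + + t0; wlog ab : a b / a <= b.
  move=> H a0 b0; have [ab|/ltW ba] := leP a b; first exact: H.
  by rewrite distrC (distrC a); exact: H.
move=> a0 b0; rewrite ger0_norm; last first.
  by rewrite subr_ge0 ler_expR lerN2 ler_wpM2r.
rewrite (distrC a) (ger0_norm (_ : 0 <= b - a)) ?subr_ge0//.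
have -> : expR (- (b * t)) = expR (- (a * t)) * expR (- ((b - a) * t)).
  by rewrite -expRD; congr expR; ring.
have := expR_ge1Dx (- ((b - a) * t)); have := expRN_le1 a0 t0.
have := expR_ge0 (- (a * t)).
have : 0 <= (b - a) * t by rewrite mulr_ge0// subr_ge0.
move: (expR (- (a * t))) ((b - a) * t) => u v v0 u0 u1.
move: (expR _) => w wv; rewrite -[X in X - _]mulr1 -mulrBr.
have [w1|w1] := leP 0 (1 - w); last by rewrite (le_trans _ v0)// mulr_ge0_le0// ltW.
by apply: (@le_trans _ _ (1 - w)); [rewrite ler_piMl|lra].
Qed.

Lemma trigsol_cvg (p : seq (mode R d)) (T e : R) : 0 <= T -> 0 < e ->
  exists2 r : R, 0 < r & forall M, eps R M < r -> forall x t, 0 <= t <= T ->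
    `|trigsol (ldamping R M) p x t - trigsol (@damping R d) p x t| <= e.
Proof.
move=> T0; elim: p e => [|m p IH] e e0.
  by exists 1 => // M _ x t _; rewrite /trigsol !big_nil subrr normr0 ltW.
have e2 : 0 < e / 2 by rewrite divr_gt0.
have e3 : 0 < e / 2 / (`|m.1.1| * T + 1) by rewrite divr_gt0// ltr_wpDl// mulr_ge0.
have [r1 r10 H1] := IH _ e2.
have [r2 r20 H2] := ldamping_cvg m.1.2 e3.
exists (Num.min r1 r2); first by rewrite lt_min r10.
move=> M; rewrite lt_min => /andP[Mr1 Mr2] x t tT; have /andP[t0 tT'] := tT.
rewrite /trigsol !big_cons -/(trigsol _ _ _ _) -/(trigsol _ _ _ _) opprD addrACA.
apply: (le_trans (ler_normD _ _)); rewrite [leRHS]splitr; apply: lerD; last exact: H1.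
rewrite -mulrBr -mulrBl !normrM.
apply: (@le_trans _ _ (`|m.1.1| * (`|ldamping R M m.1.2 - damping R m.1.2| * t))).
  rewrite ler_wpM2l//; apply: (@le_trans _ _ `|expR (- (ldamping R M m.1.2 * t)) - expR (- (damping R m.1.2 * t))|).
    by rewrite ler_piMr// cosmode_le1.
  by apply: expRN_lip => //; rewrite ?ldamping_ge0 ?damping_ge0.
apply: (@le_trans _ _ (`|m.1.1| * (e / 2 / (`|m.1.1| * T + 1) * T))).
  by rewrite ler_wpM2l// ler_pM// H2.
rewrite mulrCA mulrAC ler_pdivrMr ?ltr_wpDl ?mulr_ge0// ler_pM2l//.
by rewrite lerDl.
Qed.

End damping_convergence.

(** * Iterated integrals and Riemann sums *)

Section segment_integral.
Variable R : realType.
Implicit Types (a b c r : R) (f g h : R -> R).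
Local Notation mu := (@lebesgue_measure R).

Lemma integrable_continuous a b f : continuous f -> mu.-integrable `[a, b] (EFin \o f).
Proof.
move=> cf; apply: continuous_compact_integrable; first exact: segment_compact.
exact: continuous_subspaceT.
Qed.

Lemma int_cst a b c : a <= b -> \int[mu]_(y in `[a, b]) c = c * (b - a).
Proof.
move=> ab; rewrite Rintegral_cst//= lebesgue_measure_itv/= lte_fin.
by move: ab; rewrite le_eqVlt => /predU1P[->|->]; rewrite ?ltxx ?subrr.
Qed.

Lemma int_lin a b c f g : continuous f -> continuous g ->
  \int[mu]_(y in `[a, b]) (c * f y + g y) =
  c * \int[mu]_(y in `[a, b]) f y + \int[mu]_(y in `[a, b]) g y.
Proof.
move=> cf cg; rewrite RintegralD//; last 2 first.
- by apply: integrable_continuous => x; apply: cvgMl_tmp; exact: cf.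
- exact: integrable_continuous.
by rewrite RintegralZl//; exact: integrable_continuous.
Qed.

Lemma int_le a b f g : continuous f -> continuous g ->
  (forall y, a <= y <= b -> f y <= g y) ->
  \int[mu]_(y in `[a, b]) f y <= \int[mu]_(y in `[a, b]) g y.
Proof.
move=> cf cg fg; apply: le_Rintegral => //.
- exact: integrable_continuous.
- exact: integrable_continuous.
Qed.

Lemma int_dist a b r f g : a <= b -> continuous f -> continuous g ->
  (forall y, a <= y <= b -> `|f y - g y| <= r) ->
  `|\int[mu]_(y in `[a, b]) f y - \int[mu]_(y in `[a, b]) g y| <= r * (b - a).
Proof.
move=> ab cf cg fg; rewrite -RintegralB//; last 2 first.
- exact: integrable_continuous.
- exact: integrable_continuous.
have cfg : continuous (fun y => f y - g y) by move=> y; apply: cvgB; [exact: cf|exact: cg].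
apply: (le_trans (le_normr_Rintegral _ _)) => //; first exact: integrable_continuous.
rewrite -int_cst//; apply: int_le => //; last exact: cst_continuous.
by move=> y; exact: continuous_comp (cfg y) (@norm_continuous _ _ _).
Qed.

Lemma int_split a b c f : a <= c <= b -> continuous f ->
  \int[mu]_(y in `[a, b]) f y =
  \int[mu]_(y in `[a, c]) f y + \int[mu]_(y in `[c, b]) f y.
Proof.
move=> /andP[ac cb] cf; have := @Rintegral_itvB R f (BLeft a) (BRight b) c.
move=> /(_ (integrable_continuous _ _ cf)); rewrite !bnd_simp => /(_ ac cb).
rewrite Rintegral_itv_obnd_cbnd.
  by move=> <-; rewrite addrCA subrr addr0.
apply: integrableS (integrable_continuous c b cf) => //.
by apply: subset_itvr; rewrite bnd_simp.
Qed.

Lemma riemann_sum1 M r h : continuous h ->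
  (forall y y', `|y - y'| <= eps R M -> `|h y - h y'| <= r) ->
  `|\int[mu]_(y in `[0, 1]) h y - eps R M * \sum_(a < M.+1) h (a%:R * eps R M)| <= r.
Proof.
move=> ch hr; set e := eps R M; have e0 := eps_gt0 R M.
suff H n : `|\int[mu]_(y in `[0, n%:R * e]) h y - e * \sum_(a < n) h (a%:R * e)| <= r * (n%:R * e).
  by have := H M.+1; rewrite epsM mulr1.
elim: n => [|n IH].
  by rewrite big_ord0 mul0r !mulr0 subr0 set_itv1 Rintegral_set1 normr0.
have nle : n%:R * e <= n.+1%:R * e by rewrite ler_pM2r// ler_nat.
rewrite (@int_split _ _ (n%:R * e))//; last by rewrite nle andbT mulr_ge0// ltW.
rewrite big_ord_recr/= mulrDr opprD addrACA.
apply: (le_trans (ler_normD _ _)); rewrite -natr1 mulrDl mul1r mulrDr lerD//.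
have -> : e * h (n%:R * e) = \int[mu]_(y in `[n%:R * e, n%:R * e + e]) h (n%:R * e).
  by rewrite int_cst ?lerDl ?ltW// mulrC; congr (_ * _); ring.
apply: le_trans (int_dist _ ch _ _) _; [by rewrite lerDl ltW|exact: cst_continuous| |].
  move=> y /andP[y1 y2]; apply: hr; rewrite ger0_norm ?subr_ge0//.
  by rewrite lerBlDl.
by rewrite addrAC subrr add0r.
Qed.

End segment_integral.

Section iterated_integral.
Variables (R : realType) (d : nat).
Implicit Types (f g : 'rV[R]_d -> R) (x y z : 'rV[R]_d) (s : seq 'I_d) (i : 'I_d).
Variables lo hi : 'I_d -> R.
Hypothesis lohi : forall i, lo i <= hi i.
Local Notation iint s f := (iint_aux s lo hi f).

Lemma norm_rV_le x (r : R) : 0 <= r -> (forall i, `|x 0 i| <= r) -> `|x| <= r.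
Proof.
move=> r0 xr; rewrite -[`|x|]/(mx_norm _) mx_normrE; apply: bigmax_le => // -[a b] _ /=.
by rewrite ord1.
Qed.

Lemma norm_setcoord x x' i (y : R) : `|setcoord x i y - setcoord x' i y| <= `|x - x'|.
Proof.
apply: norm_rV_le => // j; rewrite !mxE; case: (j == i); first by rewrite subrr normr0.
by apply: le_trans (norm_coord (x - x') j); rewrite !mxE.
Qed.

Lemma norm_setcoord2 x i (y y' : R) : `|setcoord x i y - setcoord x i y'| <= `|y - y'|.
Proof.
apply: norm_rV_le => // j; rewrite !mxE; case: (j == i) => //.
by rewrite subrr normr0.
Qed.

Lemma setcoord_continuous x i : continuous (setcoord x i).
Proof.
move=> y; apply/cvgrPdist_le => r r0; near=> y'.
apply: (le_trans (norm_setcoord2 _ _ _ _)); near: y'.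
by apply: cvgr_dist_le => //; exact: cvg_id.
Unshelve. all: by end_near. Qed.

Lemma slice_continuous f x i : continuous f -> continuous (fun y : R => f (setcoord x i y)).
Proof.
move=> cf y; apply: continuous_comp; [exact: setcoord_continuous|exact: cf].
Qed.

(** Uniform continuity is taken on the compact segment of points [setcoord x i y]; its free second
    point covers the parallel segments through nearby [x']. *)
Lemma iint_continuous s f : continuous f -> continuous (iint s f).
Proof.
move=> cf; elim: s => //= i s IH x; have FF : Filter (nbhs x) by exact: nbhs_filter.
apply/cvgrPdist_le => r r0.
pose L := hi i - lo i + 1.
have L0 : 0 < L by rewrite ltr_wpDl// subr_ge0.
have rL : 0 < r / L by rewrite divr_gt0.
have cK : compact (setcoord x i @` `[lo i, hi i]%classic).
  apply: continuous_compact; last exact: segment_compact.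
  exact/continuous_subspaceT/setcoord_continuous.
have [q q0 Hq] := compact_unif_continuous cK IH rL.
near=> x'.
apply: (le_trans (int_dist (lohi i) (slice_continuous IH) (slice_continuous IH) (r := r / L) _)).
  move=> y ylh; apply/ltW/Hq; first by exists y => //=; rewrite in_itv.
  apply: le_lt_trans (norm_setcoord _ _ _ _) _; near: x'.
  by apply: cvgr_dist_lt => //; exact: cvg_id.
rewrite mulrAC ler_pdivrMr// ler_pM2l// /L; lra.
Unshelve. all: by end_near. Qed.

Lemma iint_lin s c f g x : continuous f -> continuous g ->
  iint s (fun x => c * f x + g x) x = c * iint s f x + iint s g x.
Proof.
move=> cf cg; elim: s x => //= i s IH x.
under eq_Rintegral do rewrite IH.
by apply: int_lin; apply: slice_continuous; exact: iint_continuous.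
Qed.

Lemma iint_le_in s f g x : continuous f -> continuous g ->
  (forall z, (forall i, i \in s -> lo i <= z 0 i <= hi i) ->
     (forall i, i \notin s -> z 0 i = x 0 i) -> f z <= g z) ->
  iint s f x <= iint s g x.
Proof.
move=> cf cg; elim: s x => [|i s IH] x fg /=; first exact: fg.
apply: int_le => [||y yi].
- by apply: slice_continuous; exact: iint_continuous.
- by apply: slice_continuous; exact: iint_continuous.
apply: IH => z zs zns; apply: fg => j.
  rewrite inE; case/boolP: (j \in s) => [/zs//|js]; rewrite orbF => /eqP ji.
  by rewrite zns// mxE ji eqxx.
by rewrite inE negb_or => /andP[ji js]; rewrite zns// mxE (negbTE ji).
Qed.

Lemma iint_cst s c x : iint s (fun=> c) x = c * \prod_(i <- s) (hi i - lo i).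
Proof.
elim: s x => [|i s IH] x /=; first by rewrite big_nil mulr1.
under eq_Rintegral do rewrite IH.
by rewrite int_cst// big_cons -mulrA; congr (_ * _); rewrite mulrC.
Qed.

End iterated_integral.

Section torus_integral.
Variables (R : realType) (d : nat).
Implicit Types (f g : 'rV[R]_d -> R) (x y z : 'rV[R]_d) (s : seq 'I_d) (i : 'I_d).

Lemma torint_lin (c : R) f g : continuous f -> continuous g ->
  torint (fun x => c * f x + g x) = c * torint f + torint g.
Proof. exact: iint_lin. Qed.

Lemma torint_le f g : continuous f -> continuous g -> (forall x, f x <= g x) ->
  torint f <= torint g.
Proof. by move=> cf cg fg; apply: iint_le_in => // z _ _; exact: fg. Qed.

Lemma torint_cst (c : R) : torint (fun _ : 'rV[R]_d => c) = c.
Proof. by rewrite /torint /boxint iint_cst// big1 ?mulr1// => i _; rewrite subr0. Qed.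

Lemma torintB f g : continuous f -> continuous g ->
  torint (fun x => f x - g x) = torint f - torint g.
Proof.
move=> cf cg; have -> : (fun x => f x - g x) = (fun x => -1 * g x + f x).
  by apply/funext => x; rewrite mulN1r addrC.
by rewrite torint_lin// mulN1r addrC.
Qed.

Lemma torint_norm_le f (K : R) : continuous f -> (forall x, `|f x| <= K) -> `|torint f| <= K.
Proof.
move=> cf fK; rewrite ler_norml; apply/andP; split.
  rewrite -[leLHS]torint_cst; apply: torint_le => //; first exact: cst_continuous.
  by move=> x; have := fK x; rewrite ler_norml => /andP[].
rewrite -[leRHS]torint_cst; apply: torint_le => //; first exact: cst_continuous.
by move=> x; have := fK x; rewrite ler_norml => /andP[].
Qed.

Section riemann.
Variable M : nat.
Local Notation e := (eps R M).

(** The Riemann sum built one coordinate at a time, in the pattern of [iint_aux], so that the error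
    is one modulus of continuity per coordinate. *)
Fixpoint isum s g x : R := match s with
  | [::] => g x
  | i :: s' => e * \sum_(a < M.+1) isum s' g (setcoord x i (a%:R * e))
  end.

Definition overwrite s x (a : site d M) : 'rV[R]_d :=
  \row_j (if j \in s then (a j)%:R * e else x 0 j).

(** [H] ignores coordinate [i] of its site, so the free index [b] can be taken to be that
    coordinate. Cyclic shifts of it realise the reindexing, and each of the [M.+1] shifts gives the
    same sum. *)
Lemma sum_site_fiber i (H : 'I_M.+1 -> site d M -> R) :
  (forall b (a a' : site d M), (forall j, j != i -> a j = a' j) -> H b a = H b a') ->
  \sum_b \sum_a H b a = M.+1%:R * \sum_(a : site d M) H (a i) a.
Proof.
move=> Hi; pose sh (c : 'I_M.+1) (a : site d M) : site d M :=
  [ffun j => if j == i then a j + c else a j].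
have shK c : cancel (sh c) (sh (- c)).
  by move=> a; apply/ffunP => j; rewrite !ffunE; case: eqP => // _; rewrite addrK.
rewrite exchange_big/=.
have E a : \sum_b H b a = \sum_c H (sh c a i) (sh c a).
  rewrite (reindex_inj (addrI (a i)))/=; apply: eq_bigr => c _.
  rewrite ffunE eqxx; apply: Hi => j ji; by rewrite ffunE (negbTE ji).
under eq_bigr do rewrite E.
rewrite exchange_big/= (eq_bigr (fun=> \sum_(a : site d M) H (a i) a)).
  by rewrite sumr_const card_ord mulr_natl.
by move=> c _; rewrite [RHS](reindex_inj (can_inj (shK c))).
Qed.

Lemma card_site : (#|{: site d M}|%:R : R) * e ^+ d = 1.
Proof.
rewrite card_ffun !card_ord natrX -exprMn epsM expr1n //.
Qed.

Lemma isumE s g x : uniq s -> isum s g x = e ^+ d * \sum_a g (overwrite s x a).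
Proof.
elim: s x => [|i s IH] x /=.
  move=> _; rewrite (eq_bigr (fun=> g x)); last first.
    by move=> a _; congr g; apply/rowP => j; rewrite mxE.
  rewrite sumr_const -(mulr_natl (g x)) mulrA (mulrC _ #|_|%:R).
  by rewrite (_ : #|_|%:R * _ = 1) ?mul1r//; exact: card_site.
move=> /andP[is_ us]; under eq_bigr do rewrite IH//.
rewrite -mulr_sumr (sum_site_fiber (i := i) (H := fun b a => g (overwrite s (setcoord x i (b%:R * e)) a))).
  have r3 (a u b w : R) : a * (u * (b * w)) = (b * a) * (u * w) by ring.
  rewrite r3 epsM mul1r.
  congr (_ * _); apply: eq_bigr => a _; congr g; apply/rowP => j; rewrite !mxE inE.
  by have [->|] := eqVneq j i; rewrite /= ?(negbTE is_).
move=> b a a' aa'; congr g; apply/rowP => j; rewrite !mxE; case: ifP => // js.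
by rewrite aa'//; apply: contraTneq js => ->.
Qed.

Lemma isum_pos g : isum (enum 'I_d) g 0 = e ^+ d * \sum_(a : site d M) g (pos R a).
Proof.
rewrite isumE ?enum_uniq//; congr (_ * _); apply: eq_bigr => a _; congr g.
by apply/rowP => j; rewrite !mxE mem_enum.
Qed.

Lemma iint_modulus s g (q r : R) : continuous g ->
  (forall z z', `|z - z'| <= q -> `|g z - g z'| <= r) ->
  forall z z', `|z - z'| <= q ->
  `|iint_aux s (fun=> 0) (fun=> 1) g z - iint_aux s (fun=> 0) (fun=> 1) g z'| <= r.
Proof.
move=> cg; elim: s => //= i s IH gr z z' zz'.
rewrite -[leRHS]mulr1 -[X in r * X]subr0.
apply: int_dist => //.
- by apply: slice_continuous; exact: iint_continuous.
- by apply: slice_continuous; exact: iint_continuous.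
by move=> y _; apply: IH => //; exact: le_trans (norm_setcoord _ _ _ _) zz'.
Qed.

Lemma riemann_sum s g (r : R) x : continuous g ->
  (forall z z', `|z - z'| <= e -> `|g z - g z'| <= r) ->
  `|iint_aux s (fun=> 0) (fun=> 1) g x - isum s g x| <= r * (size s)%:R.
Proof.
move=> cg gr; elim: s x => [|i s IH] x /=; first by rewrite subrr normr0 mulr0.
set I := iint_aux s _ _ g.
have cI : continuous (fun y : R => I (setcoord x i y)).
  by apply: slice_continuous; exact: iint_continuous.
have e0 := eps_gt0 R M.
rewrite -(subrKA (e * \sum_(a < M.+1) I (setcoord x i (a%:R * e)))).
apply: (le_trans (ler_normD _ _)); rewrite -nat1r mulrDr mulr1 lerD//.
  apply: (riemann_sum1 cI) => y y' yy'; apply: iint_modulus gr _ _ _ => //.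
  exact: le_trans (norm_setcoord2 _ _ _ _) yy'.
rewrite -mulrBr -sumrB normrM gtr0_norm//.
apply: (@le_trans _ _ (e * \sum_(a < M.+1) r * (size s)%:R)).
  rewrite ler_pM2l//; apply: (le_trans (ler_norm_sum _ _ _)).
  by apply: ler_sum => a _; exact: IH.
by rewrite sumr_const card_ord -(mulr_natl (r * _)) mulrA (mulrC e) epsM mul1r.
Qed.

Lemma torint_riemann g (r : R) : continuous g ->
  (forall z z', `|z - z'| <= e -> `|g z - g z'| <= r) ->
  `|torint g - e ^+ d * \sum_(a : site d M) g (pos R a)| <= r * d%:R.
Proof.
move=> cg gr; rewrite -isum_pos.
by have := riemann_sum (enum 'I_d) 0 cg gr; rewrite size_enum_ord.
Qed.

Lemma init_param_approx (rho0 : 'rV[R]_d -> R) (n : nat) (a : site d M) (r : R) :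
  continuous rho0 ->
  (forall z, `|z - pos R a| <= e -> `|rho0 z - rho0 (pos R a)| <= r) ->
  `|init_param rho0 n a - n%:R * e ^+ d * rho0 (pos R a)| <= n%:R * e ^+ d * r.
Proof.
move=> cr hr; have e0 := eps_gt0 R M.
pose lo i := pos R a 0 i - e / 2; pose hi i := pos R a 0 i + e / 2.
have lohi i : lo i <= hi i by rewrite /lo /hi; lra.
have vol : \prod_(i <- enum 'I_d) (hi i - lo i) = e ^+ d.
  rewrite big_enum/= (eq_bigr (fun=> e)) ?prodr_const ?card_ord// => i _.
  by rewrite /hi /lo; field.
have near z : (forall i, i \in enum 'I_d -> lo i <= z 0 i <= hi i) -> `|z - pos R a| <= e.
  move=> zb; apply: norm_rV_le => [|i]; first exact: ltW.
  rewrite !mxE; have := zb i; rewrite mem_enum => /(_ isT); rewrite /lo /hi !mxE => zi.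
  by rewrite ler_norml; lra.
have up : boxint lo hi rho0 <= (rho0 (pos R a) + r) * e ^+ d.
  rewrite -vol -(iint_cst lohi (enum 'I_d) _ 0); apply: iint_le_in => //; first exact: cst_continuous.
  by move=> z /near/hr; rewrite ler_norml; lra.
have dn : (rho0 (pos R a) - r) * e ^+ d <= boxint lo hi rho0.
  rewrite -vol -(iint_cst lohi (enum 'I_d) _ 0); apply: iint_le_in => //; first exact: cst_continuous.
  by move=> z /near/hr; rewrite ler_norml; lra.
have -> : init_param rho0 n a = n%:R * boxint lo hi rho0 by [].
rewrite -!mulrA -mulrBr normrM ger0_norm// ler_wpM2l// ler_norml; nra.
Qed.

End riemann.

End torus_integral.

Local Close Scope classical_set_scope.

(** * Lattice geometry and the generator of the exclusion process *)

Section neighbours.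
Variables (R : realType) (d M : nat).
Local Notation site := (site d M).
Implicit Types (x y : site) (l : 'I_d) (b : bool).

Lemma nbrK x l b : nbr (nbr x l b) l (~~ b) = x.
Proof.
apply/ffunP => i; rewrite !ffunE; case: eqP => // ->.
by case: b; rewrite /= ?ordSK ?ord_predK.
Qed.

Lemma adj_nbr x l b : adj x (nbr x l b).
Proof. by apply/existsP; exists l; apply/existsP; exists b. Qed.

Lemma adjP x y : reflect (exists l b, y = nbr x l b) (adj x y).
Proof.
apply: (iffP idP) => [|[l [b ->]]]; last exact: adj_nbr.
by rewrite /adj => /existsP[l /existsP[b /eqP ->]]; exists l, b.
Qed.

Lemma adj_sym x y : adj x y = adj y x.
Proof.
suff H (a c : site) : adj a c -> adj c a by apply/idP/idP; exact: H.
move=> /adjP[l [b ->]].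
by have := adj_nbr (nbr a l b) l (~~ b); rewrite nbrK.
Qed.

Lemma ordS_neq (i : 'I_M.+1) : (1 <= M)%N -> ordS i != i.
Proof.
move=> M1; apply/eqP => /(congr1 val) /=.
have := ltn_ord i; have [->|iM] := eqVneq (i : nat) M; first by rewrite modnn; lia.
by move=> lt; rewrite modn_small; lia.
Qed.

Lemma ord_pred_neq (i : 'I_M.+1) : (1 <= M)%N -> ord_pred i != i.
Proof. by move=> M1; rewrite -{2}(ord_predK i) eq_sym ordS_neq. Qed.

Lemma ordS_neq_pred (i : 'I_M.+1) : (2 <= M)%N -> ordS i != ord_pred i.
Proof.
move=> M2; apply/eqP => /(congr1 val) /=; have lti := ltn_ord i.
have -> : ((i + M.+1).-1 %% M.+1 = if i == 0%N :> nat then M else i.-1)%N.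
  case: eqP => i0; first by rewrite i0 add0n /= modn_small.
  have -> : ((i + M.+1).-1 = i.-1 + M.+1)%N by lia.
  by rewrite modnDr modn_small; lia.
have [->|iM] := eqVneq (i : nat) M; first by rewrite modnn; case: eqP; lia.
by rewrite modn_small; [case: eqP; lia|lia].
Qed.

Lemma nbr_neq x l b : (1 <= M)%N -> nbr x l b != x.
Proof.
move=> M1; apply/eqP => /ffunP/(_ l)/eqP; rewrite ffunE eqxx.
by case: b; rewrite ?(negbTE (ordS_neq _ M1)) ?(negbTE (ord_pred_neq _ M1)).
Qed.

Lemma adj_neq x y : (1 <= M)%N -> adj x y -> y != x.
Proof. by move=> M1 /adjP[l [b ->]]; exact: nbr_neq. Qed.

Lemma nbr_inj2 x : (2 <= M)%N -> injective (fun q : 'I_d * bool => nbr x q.1 q.2).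
Proof.
move=> M2; have M1 : (1 <= M)%N by apply: leq_trans M2.
move=> [l b] [l' b'] /= /ffunP E.
have ll' : l = l'.
  apply/eqP/negP => /negP ll'; have := E l; rewrite !ffunE eqxx (negbTE ll').
  by move=> /eqP; case: b {E}; rewrite ?(negbTE (ordS_neq _ M1)) ?(negbTE (ord_pred_neq _ M1)).
subst l'; congr pair; have := E l; rewrite !ffunE eqxx.
have := ordS_neq_pred (x l) M2.
by case: b {E}; case: b' => // /eqP H /esym H'; case: H; rewrite ?H'.
Qed.

(** Jump rates count adjacent pairs, collision numbers count directions and signs. With at least
    three sites per direction the [2 * d] neighbours are distinct and the two counts agree. *)
Lemma sum_adj x (g : site -> R) : (2 <= M)%N ->
  \sum_(y | adj x y) g y = \sum_(l < d) \sum_(b : bool) g (nbr x l b).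
Proof.
move=> M2; rewrite pair_bigA/=.
pose h (q : 'I_d * bool) := nbr x q.1 q.2.
have hi : {in predT &, injective h} by move=> ? ? _ _; exact: nbr_inj2.
have := big_imset g hi; rewrite /h /=.
move=> <-; apply: eq_bigl => y; apply/idP/imsetP.
  by move=> /adjP[l [b ->]]; exists (l, b); rewrite ?inE.
by move=> [[l b] _ ->]; exact: adj_nbr.
Qed.

End neighbours.

Section exclusion_generator.
Variables (R : realType) (d M : nat).
Local Notation site := (site d M).
Local Notation state := (state d M).
Local Notation e := (eps R M).
Implicit Types (s : state) (f : state -> R) (A : {set site}) (x y : site).

(** The level function: every transition increments exactly one counter, so this is the number of
    past jumps, and it bounds each collision counter. *)
Definition njumps s : nat := (\sum_(q : site * site) (st_W s q + st_C s q))%N.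

Definition rate_bound : R := e ^- 2 * (#|{: site * site}| * 2)%:R.

Lemma exclusion_rate_ge0 s j : j \in exclusion_jumps R s -> 0 <= j.1.
Proof.
by rewrite mem_cat => /orP[/mapP[p _ ->]|/mapP[p _ ->]] /=;
  rewrite invr_ge0 exprn_ge0// invr_ge0.
Qed.

Lemma exclusion_rate_le s : \sum_(j <- exclusion_jumps R s) j.1 <= rate_bound.
Proof.
rewrite big_cat !big_map/= !big_enum/= !sumr_const /rate_bound -mulrnDr -(mulr_natr (e ^- 2)).
rewrite ler_wpM2l ?invr_ge0 ?exprn_ge0 ?invr_ge0// ler_nat muln2 -addnn.
by rewrite leq_add// max_card.
Qed.

Lemma njumps_coll s p : njumps (coll_st s p) = (njumps s).+1.
Proof.
rewrite /njumps (bigD1 p)//= [in RHS](bigD1 p)//= !ffunE eqxx addnA addn1 addSn.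
congr (_ + _).+1; apply: eq_bigr => q qp; rewrite !ffunE (negbTE qp) addn0 //.
Qed.

Lemma njumps_move s p : njumps (move_st s p) = (njumps s).+1.
Proof.
rewrite /njumps (bigD1 p)//= [in RHS](bigD1 p)//= !ffunE eqxx addn1 !addSn.
congr (_ + _).+1; apply: eq_bigr => q qp; rewrite !ffunE (negbTE qp) addn0 //.
Qed.

Lemma exclusion_njumps s j : j \in exclusion_jumps R s -> (njumps j.2 <= (njumps s).+1)%N.
Proof.
by rewrite mem_cat => /orP[/mapP[p _ ->]|/mapP[p _ ->]] /=;
  rewrite ?njumps_coll ?njumps_move.
Qed.

Definition exclusion_levels (K : nat) : seq state :=
  undup [seq s <- [seq (r.1.1, [ffun q => val (r.1.2 q)], [ffun q => val (r.2 q)])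
     | r : {ffun site -> bool} * {ffun site * site -> 'I_K.+1} *
        {ffun site * site -> 'I_K.+1} <- index_enum _] | (njumps s <= K)%N].

Lemma exclusion_levels_uniq K : uniq (exclusion_levels K).
Proof. exact: undup_uniq. Qed.

Lemma exclusion_levelsE K s : (s \in exclusion_levels K) = (njumps s <= K)%N.
Proof.
rewrite mem_undup mem_filter; case: leqP => //= sK; apply/mapP.
have le q : (st_W s q + st_C s q <= K)%N.
  by apply: leq_trans sK; rewrite /njumps (bigD1 q)//= leq_addr.
have leW q : (st_W s q < K.+1)%N by rewrite ltnS (leq_trans (leq_addr _ _) (le q)).
have leC q : (st_C s q < K.+1)%N by rewrite ltnS (leq_trans (leq_addl _ _) (le q)).
exists (st_eta s, [ffun q => Ordinal (leW q)], [ffun q => Ordinal (leC q)]).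
  exact: mem_index_enum.
case: s {sK le} leW leC => [[eta W] C] /= leW leC.
by congr (_, _, _); apply/ffunP => q; rewrite !ffunE.
Qed.

Lemma genE f s : gen (@exclusion_jumps R d M) f s =
  e ^- 2 * (\sum_(p | adj p.1 p.2 && st_eta s p.1 && ~~ st_eta s p.2) (f (move_st s p) - f s) +
            \sum_(p | adj p.1 p.2 && st_eta s p.1 && st_eta s p.2) (f (coll_st s p) - f s)).
Proof.
by rewrite /gen big_cat !big_map/= !big_enum/= -!mulr_sumr -mulrDr.
Qed.

Definition occ A s : R := \prod_(x in A) (st_eta s x)%:R.

Lemma occ_bound A s : `|occ A s| <= 1.
Proof.
by rewrite normr_prod; apply: prodr_ile1 => x _; case: (st_eta s x); rewrite ?normr1 ?normr0 ?lexx ?ler01.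
Qed.

Lemma occ_ge0 A s : 0 <= occ A s.
Proof. exact: prodr_ge0. Qed.

(** Self-duality: seen through [occ], the set [A] itself performs the exclusion dynamics. Only pairs
    across the boundary of [A] matter, and there the two opposite moves together exchange the
    occupations. *)
Lemma gen_occ A s : gen (@exclusion_jumps R d M) (occ A) s =
  e ^- 2 * \sum_(x in A) \sum_(y | (y \notin A) && adj x y)
     (occ (y |: A :\ x) s - occ A s).
Proof.
rewrite genE [X in _ + X]big1 ?addr0; last by move=> p _; rewrite subrr.
congr (_ * _); pose eta := st_eta s.
(* The exclusion rule becomes a factor, so that sums run over all adjacent pairs and can be split by
   membership in [A]. *)
pose T x y : R := (eta x && ~~ eta y)%:R * (occ A (move_st s (x, y)) - occ A s).
have -> : \sum_(p | adj p.1 p.2 && st_eta s p.1 && ~~ st_eta s p.2)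
    (occ A (move_st s p) - occ A s) = \sum_x \sum_(y | adj x y) T x y.
  rewrite pair_big_dep/= [RHS](bigID (fun p => eta p.1 && ~~ eta p.2))/= [X in _ + X]big1 ?addr0.
    rewrite (eq_bigl (fun p => adj p.1 p.2 && (eta p.1 && ~~ eta p.2))) => [|p]; last by rewrite andbA.
    apply: eq_bigr => -[x y] /= /andP[_ /andP[h1 h2]].
    by rewrite /T h1 h2 mul1r.
  by move=> [x y] /= /andP[_ /negbTE h]; rewrite /T h mul0r.
have occ_false (B : {set site}) x (s' : state) : x \in B -> st_eta s' x = false -> occ B s' = 0.
  by move=> xB h; rewrite /occ (bigD1 x)//= h mul0r.
have T0 x y : (x \in A) = (y \in A) -> T x y = 0.
  move=> xyA; rewrite /T; case/boolP: (_ && _) => [/andP[hx hy]|]; last by rewrite mul0r.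
  rewrite mul1r; case/boolP: (x \in A) => xA.
    rewrite (occ_false A x (move_st _ _))// ?ffunE ?eqxx//.
    by rewrite (occ_false A y s) ?subrr -?xyA//; exact/negbTE.
  suff -> : occ A (move_st s (x, y)) = occ A s by rewrite subrr.
  apply: eq_bigr => z zA; rewrite ffunE /=.
  have [zx|_] := eqVneq z x; first by rewrite zx (negbTE xA) in zA.
  have [zy|//] := eqVneq z y; first by rewrite zy -xyA (negbTE xA) in zA.
have Txy x y : x \in A -> y \notin A -> T x y + T y x = occ (y |: A :\ x) s - occ A s.
  move=> xA yA; have xy : x != y by apply: contraNneq yA => <-.
  pose Q : R := occ (A :\ x) s.
  have EA : occ A s = (eta x)%:R * Q.
    by rewrite /occ (bigD1 x)//=; congr (_ * _); apply: eq_bigl => z; rewrite !inE andbC.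
  have EB : occ (y |: A :\ x) s = (eta y)%:R * Q.
    by rewrite /occ big_setU1//= !inE negb_and yA orbT.
  have EA1 : occ A (move_st s (x, y)) = 0 by rewrite (occ_false _ x)// ffunE eqxx.
  have EA2 : occ A (move_st s (y, x)) = Q.
    rewrite /occ (bigD1 x)//= ffunE /= (negbTE xy) eqxx mul1r.
    apply: eq_big => [z|z /andP[zA zx]]; first by rewrite !inE andbC.
    rewrite ffunE /= (negbTE zx); have [zy|//] := eqVneq z y.
    by rewrite zy (negbTE yA) in zA.
  rewrite /T EA1 EA2 EA EB.
  by case: (eta x); case: (eta y) => /=; ring.
rewrite (bigID (mem A))/=.
have -> : \sum_(i in A) \sum_(j | adj i j) T i j = \sum_(x in A) \sum_(y | (y \notin A) && adj x y) T x y.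
  apply: eq_bigr => x xA; rewrite (bigID (mem A))/= big1 ?add0r.
    by apply: eq_bigl => y; rewrite andbC.
  by move=> y /andP[_ yA]; rewrite T0// xA yA.
have -> : \sum_(i | i \notin A) \sum_(j | adj i j) T i j =
   \sum_(x in A) \sum_(y | (y \notin A) && adj x y) T y x.
  rewrite (eq_bigr (fun i => \sum_(j | (j \in A) && adj i j) T i j)); last first.
    move=> i iA; rewrite (bigID (mem A))/= [X in _ + X]big1 ?addr0.
      by apply: eq_bigl => y; rewrite andbC.
    by move=> y /andP[_ yA]; rewrite T0// (negbTE iA) (negbTE yA).
  rewrite (exchange_big_dep (mem A))/=; last by move=> ? ? _ /andP[].
  apply: eq_bigr => x xA; apply: eq_bigl => y.
  by rewrite [x \in A]xA adj_sym.
rewrite -big_split/=; apply: eq_bigr => x xA.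
by rewrite -big_split/=; apply: eq_bigr => y /andP[yA _]; exact: Txy.
Qed.

End exclusion_generator.

(** * Correlation functions of the exclusion process *)

Section product_rule.
Variable R : realType.

Lemma is_derive_bigprod (I : eqType) (r : seq I) (f : I -> R -> R) (df : I -> R) (t : R) :
  uniq r -> (forall i, is_derive t 1 (f i) (df i)) ->
  is_derive t 1 (fun t => \prod_(i <- r) f i t)
    (\sum_(i <- r) df i * \prod_(j <- r | j != i) f j t).
Proof.
move=> ur Df; elim: r ur => [_|i r IH /= /andP[ir ur]].
  rewrite big_nil; under eq_fun do rewrite big_nil; exact: is_derive_cst.
under eq_fun do rewrite big_cons.
have D1 := IH ur; have D2 := Df i.
apply: is_derive_eq; rewrite /GRing.scale/= big_cons addrC; congr (_ + _).
  rewrite mulrC; congr (_ * _).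
  rewrite big_cons eqxx/= big_seq [in RHS]big_seq_cond.
  apply: eq_bigl => j; case/boolP: (j \in r) => //= jr.
  by apply/esym; apply: contraNneq ir => <-.
rewrite mulr_sumr; apply: eq_big_seq => j jr.
rewrite big_cons; have -> : i != j by apply: contraNneq ir => ->.
by rewrite mulrCA.
Qed.

Lemma is_derive_setprod (I : finType) (A : {set I}) (f : I -> R -> R) (df : I -> R) (t : R) :
  (forall i, is_derive t 1 (f i) (df i)) ->
  is_derive t 1 (fun t => \prod_(i in A) f i t)
    (\sum_(i in A) df i * \prod_(j in A :\ i) f j t).
Proof.
move=> Df; have D := @is_derive_bigprod _ (enum A) f df t (enum_uniq _) Df.
have -> : (fun t => \prod_(i in A) f i t) = (fun t => \prod_(i <- enum A) f i t).
  by apply/funext => s; rewrite big_enum.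
apply: (is_derive_eq D); rewrite big_enum/=; apply: eq_bigr => i iA; congr (_ * _).
by rewrite big_enum_cond/=; apply: eq_bigl => j; rewrite !inE andbC.
Qed.

End product_rule.

Section exclusion_expectation.
Variables (R : realType) (d M n : nat) (rho0 : 'rV[R]_d -> R).
Variables (dO : measure_display) (Omega : measurableType dO).
Variables (P : probability Omega R) (X : R -> Omega -> state d M).
Hypothesis XP : is_markov (@exclusion_jumps R d M) P X (init_law rho0 n).
Local Notation site := (site d M).
Local Notation state := (state d M).
Local Notation e := (eps R M).
Local Notation jumps := (@exclusion_jumps R d M).
Local Notation mu := (init_law rho0 n).
Local Notation p := (@init_param R d M rho0 n).
Implicit Types (s : state) (f g : state -> R) (A : {set site}) (x y : site) (t : R).

(** The counters start at zero, so these finitely many states carry the whole initial law. *)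
Definition init_states : seq state :=
  [seq (eta, [ffun=> 0%N], [ffun=> 0%N]) | eta <- index_enum {ffun site -> bool}].

Lemma init_states_uniq : uniq init_states.
Proof. by rewrite map_inj_uniq ?index_enum_uniq// => a b []. Qed.

Definition Ex t f : R := EE jumps mu init_states t f.

Lemma init_law_eta (eta : {ffun site -> bool}) :
  mu (eta, [ffun=> 0%N], [ffun=> 0%N]) = \prod_x (if eta x then p x else 1 - p x).
Proof. by rewrite /init_law /st_W /st_C /= !eqxx mul1r. Qed.

Lemma init_occ A : \sum_(s <- init_states) mu s * occ R A s = \prod_(x in A) p x.
Proof.
have E (eta : {ffun site -> bool}) : occ R A (eta, [ffun=> 0%N], [ffun=> 0%N]) =
   \prod_x (if x \in A then (eta x)%:R else 1) by rewrite /occ big_mkcond.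
rewrite big_map; under eq_bigr => eta _ do rewrite init_law_eta E -big_split/=.
rewrite /= -(bigA_distr_bigA (fun x (b : bool) => (if b then p x else 1 - p x) *
   (if x \in A then b%:R else 1))).
rewrite [RHS]big_mkcond; apply: eq_bigr => x _; rewrite big_bool /=.
by case: ifP => _; ring.
Qed.

Lemma init_total : \sum_(s <- init_states) mu s = 1.
Proof.
have := init_occ finset.set0; rewrite finset.big_set0 => <-.
by apply: eq_bigr => s _; rewrite /occ finset.big_set0 mulr1.
Qed.

Local Notation dominated := (@dominated R _ (@njumps d M)).

Lemma dominated_occ A : dominated (occ R A).
Proof. exact: (dominated_bounded _ ler01 (occ_bound R A)). Qed.

Lemma is_derive_Ex f t : dominated f ->
  is_derive t 1 (fun t => Ex t f) (Ex t (gen jumps f)).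
Proof.
exact: (is_derive_EE (@exclusion_rate_ge0 R d M) (@exclusion_rate_le R d M)
  (@exclusion_njumps R d M)).
Qed.

Lemma ExD t (a : R) f g : dominated f -> dominated g ->
  Ex t (fun s => a * f s + g s) = a * Ex t f + Ex t g.
Proof.
exact: (EED (@exclusion_rate_ge0 R d M) (@exclusion_rate_le R d M)
  (@exclusion_njumps R d M)).
Qed.

Lemma Ex_cst t (a : R) : Ex t (fun=> a) = a.
Proof. exact: EE_cst init_total _ _. Qed.

Lemma dominated_cst (a : R) : dominated (fun=> a).
Proof. exact: (@dominated_bounded _ _ _ _ `|a|). Qed.

Lemma ExZ t (a : R) f : dominated f -> Ex t (fun s => a * f s) = a * Ex t f.
Proof.
move=> df; have -> : (fun s => a * f s) = (fun s => a * f s + (fun=> 0) s).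
  by apply/funext => s; rewrite addr0.
by rewrite ExD ?Ex_cst ?addr0//; exact: dominated_cst.
Qed.

Lemma Ex_sum (I : Type) (r : seq I) (F : I -> state -> R) t :
  (forall i, dominated (F i)) ->
  Ex t (fun s => \sum_(i <- r) F i s) = \sum_(i <- r) Ex t (F i).
Proof.
exact: (EE_sum (@exclusion_rate_ge0 R d M) (@exclusion_rate_le R d M)
  (@exclusion_njumps R d M) init_total).
Qed.

Lemma Ex_ge0 t f : 0 <= t -> dominated f -> (forall s, 0 <= f s) -> 0 <= Ex t f.
Proof.
exact: (EE_ge0 (@exclusion_rate_ge0 R d M) (@exclusion_rate_le R d M)
  (@exclusion_njumps R d M) (@exclusion_levels_uniq d M) (@exclusion_levelsE d M) XP).
Qed.

Lemma Ex_le t f g : 0 <= t -> dominated f -> dominated g ->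
  (forall s, f s <= g s) -> Ex t f <= Ex t g.
Proof.
exact: (EE_le (@exclusion_rate_ge0 R d M) (@exclusion_rate_le R d M)
  (@exclusion_njumps R d M) (@exclusion_levels_uniq d M) (@exclusion_levelsE d M) XP).
Qed.

Lemma prob_le_Ex t f (G : set state) : 0 <= t -> dominated f ->
  (forall s, 0 <= f s) -> (forall s, G s -> 1 <= f s) ->
  (P [set w | G (X t w)]%classic <= (Ex t f)%:E)%E.
Proof.
exact: (prob_le_EE (@exclusion_rate_ge0 R d M) (@exclusion_rate_le R d M)
  (@exclusion_njumps R d M) (@exclusion_levels_uniq d M) (@exclusion_levelsE d M) XP
  init_states_uniq init_total).
Qed.

Definition corr A t : R := Ex t (occ R A).
Definition dens x t : R := corr [set x]%SET t.

Lemma corr0 A : corr A 0 = \prod_(x in A) p x.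
Proof. by rewrite /corr /Ex EE0 init_occ. Qed.

Lemma corr_ge0 A t : 0 <= t -> 0 <= corr A t.
Proof. by move=> t0; apply: Ex_ge0 => // [|s]; [exact: dominated_occ|exact: occ_ge0]. Qed.

Lemma is_derive_corr A t : is_derive t 1 (corr A)
  (e ^- 2 * \sum_(x in A) \sum_(y | (y \notin A) && adj x y)
     (corr (y |: A :\ x)%SET t - corr A t)).
Proof.
have D := is_derive_Ex t (dominated_occ A); apply: (is_derive_eq D).
have -> : gen jumps (occ R A) = (fun s => e ^- 2 * \sum_(x in A) \sum_(y | (y \notin A) && adj x y)
     (occ R (y |: A :\ x)%SET s - occ R A s)).
  by apply/funext => s; rewrite gen_occ.
have dB B C : dominated (fun s => occ R B s - occ R C s).
  rewrite (_ : (fun s => _) = (fun s => -1 * occ R C s + occ R B s)).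
    by apply: dominatedD; exact: dominated_occ.
  by apply/funext => s; rewrite mulN1r addrC.
have EB B C : Ex t (fun s => occ R B s - occ R C s) = corr B t - corr C t.
  rewrite (_ : (fun s => _) = (fun s => -1 * occ R C s + occ R B s)).
    by rewrite ExD; [rewrite mulN1r addrC|exact: dominated_occ..].
  by apply/funext => s; rewrite mulN1r addrC.
rewrite ExZ; last first.
  under eq_fun do rewrite -big_enum; apply: dominated_sum => x.
  under eq_fun do rewrite -big_filter; apply: dominated_sum => y; exact: dB.
congr (_ * _).
under eq_fun do rewrite -big_enum/=; rewrite Ex_sum; last first.
  by move=> x; under eq_fun do rewrite -big_filter; apply: dominated_sum => y; exact: dB.
rewrite big_enum/=; apply: eq_bigr => x _.
under eq_fun do rewrite -big_filter; rewrite Ex_sum; last by move=> y; exact: dB.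
by rewrite big_filter; apply: eq_bigr => y _; exact: EB.
Qed.

Lemma is_derive_dens x t : is_derive t 1 (dens x)
  (e ^- 2 * \sum_(y | (y != x) && adj x y) (dens y t - dens x t)).
Proof.
have D := is_derive_corr [set x]%SET t; apply: (is_derive_eq D).
rewrite big_set1; congr (_ * _); apply: eq_big => [y|y _]; first by rewrite inE.
rewrite (_ : (y |: [set x] :\ x)%SET = [set y]%SET)//.
by apply/setP => z; rewrite !inE; case: (z == x); rewrite ?orbF.
Qed.

(* Liggett's inequality: symmetric exclusion started from a product measure is
   negatively correlated. The product of densities is a supersolution because
   the missing terms combine to squares of density differences. *)
Lemma corr_le_prod A t : 0 <= t -> corr A t <= \prod_(x in A) dens x t.
Proof.
move=> t0; rewrite -subr_ge0.
pose h A t := \prod_(x in A) dens x t.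
pose ud x t := e ^- 2 * \sum_(y | (y != x) && adj x y) (dens y t - dens x t).
pose wd A t := e ^- 2 * \sum_(x in A) \sum_(y | (y \notin A) && adj x y)
     (corr (y |: A :\ x)%SET t - corr A t).
pose z A t := h A t - corr A t.
pose dz A t := \sum_(x in A) ud x t * h (A :\ x)%SET t - wd A t.
have e2 : 0 <= e ^- 2 by rewrite invr_ge0 exprn_ge0// invr_ge0.
have h_ge0 (B : {set site}) (s : R) : 0 <= s -> 0 <= h B s.
  by move=> s0; apply: prodr_ge0 => x _; exact: corr_ge0.
suff H : forall (B : {set site}) (s : R), true -> 0 <= s <= t -> 0 <= z B s by apply: H; rewrite // t0 lexx.
apply: (@ode_min_principle _ _ (fun=> true) z dz).
- move=> B s _ _; apply: is_deriveB; last exact: is_derive_corr.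
  by apply: is_derive_setprod => x; exact: is_derive_dens.
- move=> B _; rewrite /z corr0 /h subr_ge0.
  by rewrite le_eqVlt (_ : _ == _)//; apply/eqP/eq_bigr => x _; rewrite /dens corr0 big_set1.
move=> B s _ /andP[s0 _] zmin.
have hB x y : x \in B -> y \notin B -> h (y |: B :\ x)%SET s = dens y s * h (B :\ x)%SET s.
  by move=> xB yB; rewrite /h big_setU1//= !inE negb_and yB orbT.
have hBx x : x \in B -> h B s = dens x s * h (B :\ x)%SET s.
  move=> xB; rewrite /h (bigD1 x)//=; congr (_ * _); apply: eq_bigl => y.
  by rewrite !inE andbC.
pose T x y := (dens y s - dens x s) * h (B :\ x)%SET s.
(* Densities jump to every neighbour, the set only to sites outside [B]; the second sum collects the
   jumps that exclusion suppresses. *)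
have E1 : \sum_(x in B) ud x s * h (B :\ x)%SET s =
    e ^- 2 * (\sum_(x in B) \sum_(y | (y \notin B) && adj x y) T x y +
              \sum_(x in B) \sum_(y | [&& y \in B, y != x & adj x y]) T x y).
  rewrite -big_split/= mulr_sumr; apply: eq_bigr => x xB.
  rewrite /ud -mulrA mulr_suml; congr (_ * _).
  rewrite (bigID (mem B))/= addrC; congr (_ + _); apply: eq_bigl => y.
    case/boolP: (y \in B) => yB; rewrite ?andbF//= andbT.
    by case: eqP => [yx|//]; rewrite yx xB in yB.
  by rewrite -andbA andbC -andbA; case: (adj x y); rewrite ?andbF ?andbT//; case: (y \in B); rewrite /= ?andbT ?andbF.
have E2 : wd B s = e ^- 2 * (\sum_(x in B) \sum_(y | (y \notin B) && adj x y) T x y -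
   \sum_(x in B) \sum_(y | (y \notin B) && adj x y) (z (y |: B :\ x)%SET s - z B s)).
  rewrite /wd -sumrB; congr (_ * _); apply: eq_bigr => x xB.
  rewrite -sumrB; apply: eq_bigr => y /andP[yB _].
  rewrite /T /z (hB x y)// (hBx x xB); ring.
have ring1 (a b c : R) : a + b - (a - c) = b + c by ring.
rewrite /dz E1 E2 -mulrBr ring1 mulr_ge0// addr_ge0//; last first.
  by apply: sumr_ge0 => x _; apply: sumr_ge0 => y _; rewrite subr_ge0; exact: zmin.
set S := \sum_(x in B) _.
have S2 : S + S = \sum_(x in B) \sum_(y | [&& y \in B, y != x & adj x y])
    (T x y + T y x).
  rewrite {2}/S (exchange_big_dep (mem B))/=; last by move=> x y _ /and3P[].
  rewrite /S -big_split/=; apply: eq_bigr => x xB; rewrite big_split/=; congr (_ + _).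
  by apply: eq_bigl => y; rewrite [x \in B]xB eq_sym adj_sym.
suff : 0 <= S + S by lra.
rewrite S2; apply: sumr_ge0 => x xB; apply: sumr_ge0 => y /and3P[yB yx _].
rewrite /T.
have -> : h (B :\ x)%SET s = dens y s * h (B :\ x :\ y)%SET s.
  rewrite /h (bigD1 y)/=; last by rewrite !inE yx.
  by congr (_ * _); apply: eq_bigl => u; rewrite !inE andbC.
have -> : h (B :\ y)%SET s = dens x s * h (B :\ x :\ y)%SET s.
  rewrite /h (bigD1 x)/=; last by rewrite !inE eq_sym yx.
  congr (_ * _); apply: eq_bigl => u; rewrite !inE.
  by case: (u == x); case: (u == y); case: (u \in B).
have -> : forall a b c : R, (a - b) * (a * c) + (b - a) * (b * c) = (a - b) ^+ 2 * c.
  by move=> a b c; ring.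
by rewrite mulr_ge0 ?sqr_ge0// h_ge0// ltW.
Qed.

End exclusion_expectation.

(** * Lattice comparison and the lower bound for pairs *)

Section lattice_heat_comparison.
Variables (R : realType) (d M : nat).
Local Notation site := (site d M).
Local Notation e := (eps R M).

Definition lheat (v : site -> R -> R) := forall x t,
  is_derive t (1 : R) (v x) (e ^- 2 * \sum_(y | adj x y) (v y t - v x t)).

Lemma eps2_ge0 : 0 <= e ^- 2.
Proof. by rewrite invr_ge0 exprn_ge0// invr_ge0. Qed.

Lemma lheat_le v w (c : R) : lheat v -> lheat w ->
  (forall x, v x 0 <= w x 0 + c) -> forall x t, 0 <= t -> v x t <= w x t + c.
Proof.
move=> hv hw vw x t t0; rewrite -subr_ge0.
pose z x t := w x t - v x t + c.
pose dz x t := e ^- 2 * \sum_(y | adj x y) (w y t - w x t) -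
               e ^- 2 * \sum_(y | adj x y) (v y t - v x t).
have E y s : w y s + c - v y s = z y s by rewrite /z; ring.
rewrite E; suff H : forall y s, true -> 0 <= s <= t -> 0 <= z y s.
  by apply: H; rewrite // t0 lexx.
apply: (@ode_min_principle _ _ (fun=> true) z dz).
- move=> y s _ _; have D1 := hv y s; have D2 := hw y s.
  by apply: is_derive_eq; rewrite addr0.
- by move=> y _; rewrite -E subr_ge0.
move=> y s _ _ ymin; rewrite /dz -mulrBr mulr_ge0 ?eps2_ge0// -sumrB sumr_ge0// => u _.
by have := ymin u isT; rewrite /z; lra.
Qed.

Lemma lheat_dist v w (c : R) : lheat v -> lheat w ->
  (forall x, `|v x 0 - w x 0| <= c) -> forall x t, 0 <= t -> `|v x t - w x t| <= c.
Proof.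
move=> hv hw vw x t t0; rewrite ler_norml.
have H1 : v x t <= w x t + c.
  by apply: lheat_le => // y; have := vw y; rewrite ler_norml; lra.
have H2 : w x t <= v x t + c.
  by apply: lheat_le => // y; have := vw y; rewrite ler_norml; lra.
by lra.
Qed.

Lemma lheat_trigsol (nu : R) (p : seq (mode R d)) : (2 <= M)%N ->
  lheat (fun x t => nu * trigsol (ldamping R M) p (pos R x) t).
Proof.
move=> M2 x t; have D := is_derive_lattice_trigsol p x t.
have D2 := @is_deriveZ _ _ _ _ nu t 1 _ D; apply: (is_derive_eq D2).
rewrite sum_adj// /GRing.scale/= mulrCA; congr (_ * _).
rewrite mulr_sumr; apply: eq_bigr => l _; rewrite mulr_sumr; apply: eq_bigr => b _.
by rewrite mulrBr.
Qed.

End lattice_heat_comparison.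

Section barrier.
Variables (R : realType) (d M : nat).
Local Notation site := (site d M).
Local Notation e := (eps R M).
Implicit Types x y : site.

Lemma sin_lip0 (a : R) : `|sin a| <= `|a|.
Proof.
wlog a0 : a / 0 <= a.
  move=> H; have [/H//|/ltW a0] := leP 0 a.
  by rewrite -normrN -sinN -[leRHS]normrN; apply: H; rewrite oppr_ge0.
move: a0; rewrite le_eqVlt => /predU1P[<-|a0]; first by rewrite sin0.
have [|c _] := @MVT R sin (fun x : R => cos x) 0 a a0 _.
  by apply: continuous_subspaceT; exact: continuous_sin.
by rewrite sin0 !subr0 => ->; rewrite normrM ler_piMl// cos_max.
Qed.

Lemma one_sub_cos_le (a : R) : 2 * (1 - cos a) <= a ^+ 2.
Proof.
have -> : a = (a / 2) *+ 2 by rewrite mulr2n; field.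
rewrite cos_mulr2n cos2sin2.
have : sin (a / 2) ^+ 2 <= (a / 2) ^+ 2.
  by rewrite -[X in X <= _]real_normK ?num_real// -[leRHS]real_normK ?num_real// lerXn2r ?nnegrE// sin_lip0.
rewrite !mulr2n; nra.
Qed.

Lemma sin_ge_half (a : R) : 0 <= a <= 1 -> a / 2 <= sin a.
Proof.
move=> /andP[]; rewrite le_eqVlt => /predU1P[<- _|a0 a1]; first by rewrite sin0 mul0r.
have [|c] := @MVT R sin (fun x : R => cos x) 0 a a0 _.
  by apply: continuous_subspaceT; exact: continuous_sin.
rewrite in_itv/= sin0 !subr0 => /andP[c0 ca] ->.
have := one_sub_cos_le c; have : c ^+ 2 <= 1 by rewrite expr_le1 ?ltW//; lra.
by nra.
Qed.

(** A periodic stand-in for the l1 norm of a displacement: it vanishes at contact and is of order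
    [eps] at adjacent sites, and the kinks of [|sin|] only raise its second differences. *)
Definition sinsum (a : 'rV[R]_d) : R := \sum_(i < d) `|sin (pi * a 0 i)|.

Lemma sinsum_periodic (y : 'rV[R]_d) : torus_periodic (fun a => sinsum (a - y)).
Proof.
move=> a i; apply: eq_bigr => j _; rewrite !mxE.
case: (j == i); last by rewrite addr0.
by rewrite addrAC mulrDr mulr1 sinDpi normrN.
Qed.

Definition sepn x y : R := sinsum (pos R x - pos R y).

Lemma sepn_sym x y : sepn x y = sepn y x.
Proof.
apply: eq_bigr => i _; rewrite -normrN -sinN; congr (`|sin _|).
by rewrite !mxE; ring.
Qed.

Lemma sepn_ge0 x y : 0 <= sepn x y.
Proof. by apply: sumr_ge0. Qed.

Lemma sepn_le x y : sepn x y <= d%:R.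
Proof.
rewrite -[d%:R]mulr1 mulr_natl -[X in _ *+ X]card_ord -sumr_const.
by apply: ler_sum => i _; exact: sin_max.
Qed.

Lemma sepn_xx x : sepn x x = 0.
Proof.
by rewrite /sepn subrr /sinsum big1// => i _; rewrite mxE mulr0 sin0 normr0.
Qed.

(** Up to wrapping, one coordinate differs by [e]. Since [e <= 1/4] gives [pi * e <= 1], one has
    [sin (pi * e) >= pi * e / 2 >= e]. *)
Lemma sepn_adj x y : e <= 1/4 -> adj x y -> e <= sepn x y.
Proof.
move=> e4 /adjP[l [b ->]]; rewrite sepn_sym /sepn.
rewrite (periodic_nbr _ _ _ (sinsum_periodic (pos R x))) addrAC subrr add0r.
rewrite /sinsum (bigD1 l)//= ler_wpDr ?sumr_ge0//.
rewrite !mxE eqxx mulr1.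
have -> : `|sin (pi * (sgnb R b * e))| = `|sin (pi * e)|.
  by rewrite /sgnb; case: b; rewrite ?mul1r// mulN1r mulrN sinN normrN.
apply: le_trans (ler_norm _).
have pi2 := pi_ge2 R; have pi4 := pihalf_lt2 R; have e0 := eps_gt0 R M.
apply: le_trans (sin_ge_half _).
  by rewrite ler_pdivlMr// mulrC ler_pM2r.
apply/andP; split; first by rewrite mulr_ge0 ?pi_ge0// ltW.
have pi4' : pi <= 4 :> R by lra.
by have := ler_pM (pi_ge0 R) (ltW e0) pi4' e4; lra.
Qed.

(** By the triangle inequality [|sin (a + h)| + |sin (a - h)| >= 2 * |sin a| * cos h], at kinks as
    elsewhere, and [2 * (1 - cos h) <= h ^+ 2]. *)
Lemma sepn_laplacian x y : (2 <= M)%N ->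
  - (d%:R * (pi * e) ^+ 2) <= \sum_(x' | adj x x') (sepn x' y - sepn x y).
Proof.
move=> M2; rewrite sum_adj//.
have E l : \sum_(b : bool) (sepn (nbr x l b) y - sepn x y) =
  \sum_(b : bool) (`|sin (pi * (pos R x 0 l - pos R y 0 l) + pi * (sgnb R b * e))| -
     `|sin (pi * (pos R x 0 l - pos R y 0 l))|).
  apply: eq_bigr => b _; rewrite /sepn (periodic_nbr _ _ _ (sinsum_periodic (pos R y))).
  rewrite /sinsum (bigD1 l)//= [X in _ - X](bigD1 l)//=.
  rewrite (eq_bigr (fun i => `|sin (pi * (pos R x - pos R y) 0 i)|)); last first.
    by move=> i il; rewrite !mxE (negbTE il) mulr0 addr0.
  rewrite opprD addrACA subrr addr0 !mxE eqxx mulr1; congr (`|sin _| - _); ring.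
under eq_bigr do rewrite E.
rewrite -mulrN mulr_natl -[X in _ *+ X]card_ord -sumr_const; apply: ler_sum => l _.
rewrite big_bool /= /sgnb mul1r mulN1r mulrN.
set a := pi * (_ - _); set h := pi * e.
have : 2 * (`|sin a| * cos h) <= `|sin (a + h)| + `|sin (a - h)|.
  apply: le_trans (ler_normD _ _); rewrite sinD sinB.
  have -> : sin a * cos h + cos a * sin h + (sin a * cos h - cos a * sin h) =
    2 * (sin a * cos h) by ring.
  by rewrite normrM ger0_norm// ler_pM2l// normrM ler_wpM2l// ler_norm.
have := one_sub_cos_le h; have := cos_le1 h; have : `|sin a| <= 1 by exact: sin_max.
move: (`|sin a|) (cos h) (h ^+ 2) => u c q u1 c1 cq.
have : u * (1 - c) <= 1 * (1 - c) by rewrite ler_wpM2r// subr_ge0.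
by rewrite mulrBr mulr1 mul1r; lra.
Qed.

End barrier.

Section pair_correlations.
Variables (R : realType) (d M n : nat) (rho0 : 'rV[R]_d -> R).
Variables (dO : measure_display) (Omega : measurableType dO).
Variables (P : probability Omega R) (X : R -> Omega -> state d M).
Hypothesis XP : is_markov (@exclusion_jumps R d M) P X (init_law rho0 n).
Hypothesis M2 : (2 <= M)%N.
Local Notation site := (site d M).
Local Notation e := (eps R M).
Local Notation p := (@init_param R d M rho0 n).
Local Notation corr := (@corr R d M n rho0).
Local Notation dens := (@dens R d M n rho0).
Implicit Types (x y : site) (t : R).

Let M1 : (1 <= M)%N. Proof. exact: leq_trans M2. Qed.

Lemma lheat_dens : lheat dens.
Proof.
move=> x t; have D := is_derive_dens n rho0 x t; apply: (is_derive_eq D).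
congr (_ * _); apply: eq_bigl => y; case/boolP: (adj x y) => h; rewrite ?andbF//.
by rewrite (adj_neq M1 h).
Qed.

Definition pcorr x y t := corr [set x; y]%SET t.

(** The generator of two exclusion particles: each walks freely but may not jump onto the other. *)
Definition pair_gen (f : site -> site -> R) x y : R := e ^- 2 *
  (\sum_(x' | (x' != y) && adj x x') (f x' y - f x y) +
   \sum_(y' | (y' != x) && adj y y') (f x y' - f x y)).

Lemma is_derive_pcorr x y t : x != y ->
  is_derive t 1 (pcorr x y) (pair_gen (fun x y => pcorr x y t) x y).
Proof.
move=> xy; have D := is_derive_corr n rho0 [set x; y]%SET t; apply: (is_derive_eq D).
rewrite /pair_gen; congr (_ * _).
rewrite big_setU1/= ?inE// big_set1; congr (_ + _).
  apply: eq_big => [x'|x' /andP[hx _]].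
    rewrite !inE negb_or; case/boolP: (adj x x') => h; rewrite ?andbF//=.
    by rewrite (adj_neq M1 h).
  rewrite (_ : (x' |: [set x; y] :\ x)%SET = [set x'; y]%SET)//; apply/setP => z; rewrite !inE.
  by have [->|] := eqVneq z x; rewrite ?(negbTE xy) ?orbF//= andbT.
apply: eq_big => [y'|y' /andP[hy _]].
  rewrite !inE negb_or; case/boolP: (adj y y') => h; rewrite ?andbF//=.
  by rewrite (adj_neq M1 h) !andbT.
rewrite (_ : (y' |: [set x; y] :\ y)%SET = [set x; y']%SET)//; apply/setP => z; rewrite !inE.
have [->|zy] := eqVneq z y; last by rewrite /= orbF orbC.
by rewrite /= orbF (eq_sym y x) (negbTE xy).
Qed.

(** Two independent walks minus the blocked jumps, which exist only for adjacent pairs and would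
    lead to the diagonal. *)
Lemma pair_gen_split (f : site -> site -> R) x y : x != y -> pair_gen f x y =
  e ^- 2 * (\sum_(x' | adj x x') (f x' y - f x y) + \sum_(y' | adj y y') (f x y' - f x y) -
   (adj x y)%:R * (f y y - f x y + (f x x - f x y))).
Proof.
move=> xy; rewrite /pair_gen; congr (_ * _).
have H (a b : site) (g : site -> R) : \sum_(c | (c != b) && adj a c) g c =
   \sum_(c | adj a c) g c - (adj a b)%:R * g b.
  case/boolP: (adj a b) => ab; last first.
    rewrite mul0r subr0; apply: eq_bigl => c; have [->|//] := eqVneq c b.
    by rewrite (negbTE ab).
  rewrite [in RHS](bigD1 b)//= mul1r addrAC subrr add0r.
  by apply: eq_bigl => c; rewrite andbC.
by rewrite !H (adj_sym y x); ring.
Qed.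

(* The barrier [e * sum_i |sin (pi (x_i - y_i))|] is subharmonic up to [O(e)] and has
   generator of order one at adjacent pairs, so it pays for the time spent there. *)
Lemma pcorr_ge (v : site -> R -> R) (B c : R) : e <= 1/4 -> lheat v -> 0 <= B ->
  (forall x y t, 0 <= t -> adj x y -> e ^- 2 * (v x t - v y t) ^+ 2 <= B) ->
  (forall x y, x != y -> v x 0 * v y 0 - c <= p x * p y) ->
  forall x y t, x != y -> 0 <= t ->
  v x t * v y t - c - B / 2 * (e * d%:R + 2 * (d%:R * pi ^+ 2) * e * t) <= pcorr x y t.
Proof.
move=> e4 hv B0 vB vc x y t xy t0; rewrite -subr_ge0.
pose K := B / 2; have K0 : 0 <= K by rewrite divr_ge0.
have e0 := eps_gt0 R M.
(* [d - sepn] keeps the barrier nonnegative, and the term linear in [t] pays for the error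
   [2 * d * pi^2] in the generator of [sepn]. With [K = B / 2] the gain [2 / e] at adjacent pairs
   amounts to exactly [B]. *)
pose bar x y t : R := K * (e * (d%:R - sepn R x y) + 2 * (d%:R * pi ^+ 2) * e * t).
pose z (q : site * site) t := pcorr q.1 q.2 t - v q.1 t * v q.2 t + c + bar q.1 q.2 t.
pose dv x t := e ^- 2 * \sum_(y | adj x y) (v y t - v x t).
pose dz (q : site * site) t := pair_gen (fun x y => pcorr x y t) q.1 q.2 -
  (dv q.1 t * v q.2 t + v q.1 t * dv q.2 t) + K * (2 * (d%:R * pi ^+ 2) * e).
suff H : forall q s, (fun q : site * site => q.1 != q.2) q -> 0 <= s <= t -> 0 <= z q s.
  have := H (x, y) t xy; rewrite t0 lexx => /(_ isT) /le_trans; apply.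
  rewrite /z /bar /= -/K; have := mulr_ge0 K0 (mulr_ge0 (ltW e0) (sepn_ge0 R x y)); nra.
apply: (@ode_min_principle _ _ _ z dz).
- move=> [a b] s /= ab _.
  have D1 := is_derive_pcorr s ab; have D2 := hv a s; have D3 := hv b s.
  have D4 := is_derive_mull (2 * (d%:R * pi ^+ 2) * e) s.
  apply: is_derive_eq; rewrite /GRing.scale/= /dz /dv /=; ring.
- move=> [a b] /= ab; rewrite /z /= /pcorr corr0 big_setU1/= ?inE// big_set1.
  have := vc a b ab; rewrite /bar mulr0 addr0.
  have : 0 <= K * (e * (d%:R - sepn R a b)).
    by rewrite !mulr_ge0 ?subr_ge0 ?sepn_le// ltW.
  by lra.
move=> [a b] s /= ab /andP[s0 _] zmin; have s0' := ltW s0.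
have zg : 0 <= pair_gen (fun x y => z (x, y) s) a b.
  rewrite /pair_gen mulr_ge0 ?eps2_ge0// addr_ge0//; apply: sumr_ge0 => u /andP[ub _];
    by rewrite subr_ge0; apply: (zmin (_, _)); rewrite //= eq_sym.
have E : pair_gen (fun x y => pcorr x y s) a b = pair_gen (fun x y => z (x, y) s) a b +
    pair_gen (fun x y => v x s * v y s) a b + K * e * pair_gen (@sepn R d M) a b.
  have S1 (Q : pred site) : \sum_(u | Q u) (pcorr u b s - pcorr a b s) =
      \sum_(u | Q u) (z (u, b) s - z (a, b) s) +
      \sum_(u | Q u) (v u s * v b s - v a s * v b s) +
      K * e * \sum_(u | Q u) (sepn R u b - sepn R a b).
    rewrite mulr_sumr -!big_split/=; apply: eq_bigr => u _; rewrite /z /bar /=; ring.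
  have S2 (Q : pred site) : \sum_(u | Q u) (pcorr a u s - pcorr a b s) =
      \sum_(u | Q u) (z (a, u) s - z (a, b) s) +
      \sum_(u | Q u) (v a s * v u s - v a s * v b s) +
      K * e * \sum_(u | Q u) (sepn R a u - sepn R a b).
    rewrite mulr_sumr -!big_split/=; apply: eq_bigr => u _; rewrite /z /bar /=; ring.
  by rewrite /pair_gen S1 S2; ring.
(* The two blocked jumps of the product [v x * v y] add up to a squared difference; this is the loss
   to be absorbed. *)
have Ev : pair_gen (fun x y => v x s * v y s) a b =
    dv a s * v b s + v a s * dv b s - (adj a b)%:R * (e ^- 2 * (v a s - v b s) ^+ 2).
  have S1 : \sum_(u | adj a u) (v u s * v b s - v a s * v b s) =
      (\sum_(u | adj a u) (v u s - v a s)) * v b s.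
    by rewrite mulr_suml; apply: eq_bigr => u _; ring.
  have S2 : \sum_(u | adj b u) (v a s * v u s - v a s * v b s) =
      v a s * (\sum_(u | adj b u) (v u s - v b s)).
    by rewrite mulr_sumr; apply: eq_bigr => u _; ring.
  by rewrite pair_gen_split// S1 S2 /dv; ring.
have Es : - (2 * (d%:R * pi ^+ 2)) + (adj a b)%:R * (2 / e) <= pair_gen (@sepn R d M) a b.
  rewrite pair_gen_split//.
  have h1 := @sepn_laplacian R d M a b M2.
  have h2 : - (d%:R * (pi * e) ^+ 2) <= \sum_(y' | adj b y') (sepn R a y' - sepn R a b).
    under eq_bigr => u _ do rewrite (sepn_sym R a u) (sepn_sym R a b).
    exact: sepn_laplacian.
  rewrite !sepn_xx.
  have h3 : (adj a b)%:R * e <= (adj a b)%:R * sepn R a b.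
    by case/boolP: (adj a b) => h; rewrite ?mul0r// !mul1r sepn_adj.
  have -> : - (2 * (d%:R * pi ^+ 2)) + (adj a b)%:R * (2 / e) =
    e ^- 2 * (- (d%:R * (pi * e) ^+ 2) - (d%:R * (pi * e) ^+ 2) + 2 * ((adj a b)%:R * e)).
    by field; exact: lt0r_neq0.
  by rewrite ler_wpM2l ?eps2_ge0//; lra.
rewrite /dz /= E Ev.
have h4 : (adj a b)%:R * (e ^- 2 * (v a s - v b s) ^+ 2) <= (adj a b)%:R * B.
  by case/boolP: (adj a b) => h; rewrite ?mul0r// !mul1r; exact: vB.
have h5 : K * e * (- (2 * (d%:R * pi ^+ 2)) + (adj a b)%:R * (2 / e)) <= K * e * pair_gen (@sepn R d M) a b.
  by rewrite ler_wpM2l// mulr_ge0// ltW.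
have h6 : K * e * (- (2 * (d%:R * pi ^+ 2)) + (adj a b)%:R * (2 / e)) =
   - (K * (2 * (d%:R * pi ^+ 2) * e)) + (adj a b)%:R * B.
  by rewrite /K; field; exact: lt0r_neq0.
by rewrite h6 in h5; lra.
Qed.

End pair_correlations.

(** * Second moments of the collision number *)

Section collisions.
Variables (R : realType) (d M n : nat) (rho0 : 'rV[R]_d -> R).
Variables (dO : measure_display) (Omega : measurableType dO).
Variables (P : probability Omega R) (X : R -> Omega -> state d M).
Hypothesis XP : is_markov (@exclusion_jumps R d M) P X (init_law rho0 n).
Hypothesis M2 : (2 <= M)%N.
Local Notation site := (site d M).
Local Notation state := (state d M).
Local Notation e := (eps R M).
Local Notation jumps := (@exclusion_jumps R d M).
Local Notation corr := (@corr R d M n rho0).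
Local Notation dens := (@dens R d M n rho0).
Local Notation pcorr := (@pcorr R d M n rho0).
Local Notation Ex := (@Ex R d M n rho0).
Local Notation dominated := (@dominated R _ (@njumps d M)).
Implicit Types (s : state) (f g : state -> R) (t : R).

Definition dbond := (site * 'I_d * bool)%type.
Definition tail (i : dbond) : site := i.1.1.
Definition head (i : dbond) : site := nbr i.1.1 i.1.2 i.2.
Definition ends (i : dbond) : {set site} := [set tail i; head i]%SET.
Implicit Types i j : dbond.

Variables (Phi : dbond -> R) (c : R).
Hypotheses (Phi_ge0 : forall i, 0 <= Phi i) (Phi_le : forall i, Phi i <= c).

Let M1 : (1 <= M)%N. Proof. exact: leq_trans M2. Qed.

Let c_ge0 (i : dbond) : 0 <= c. Proof. exact: le_trans (Phi_ge0 i) (Phi_le i). Qed.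

Lemma tail_neq_head i : tail i != head i.
Proof. by rewrite eq_sym nbr_neq. Qed.

Lemma adj_ends i : adj (tail i) (head i).
Proof. exact: adj_nbr. Qed.

Lemma occ_ends i s : occ R (ends i) s = (st_eta s (tail i))%:R * (st_eta s (head i))%:R.
Proof. by rewrite /occ big_setU1/= ?inE ?tail_neq_head// big_set1. Qed.

Lemma sum_tail x : \sum_i ((tail i == x)%:R : R) = (2 * d)%:R.
Proof.
rewrite -(pair_bigA _ (fun u (b : bool) => (tail (u, b) == x)%:R))/=.
rewrite -(pair_bigA _ (fun z (l : 'I_d) => \sum_(b : bool) (tail (z, l, b) == x)%:R))/=.
rewrite (bigD1 x)//= [X in _ + X]big1 ?addr0.
  rewrite (eq_bigr (fun=> 2)) ?sumr_const ?card_ord ?natrM ?mulr_natr// => l _.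
  by rewrite big_bool /= /tail /= eqxx.
by move=> z zx; rewrite big1// => l _; rewrite big1// => b _; rewrite /tail /= (negbTE zx).
Qed.

Lemma sum_head x : \sum_i ((head i == x)%:R : R) = (2 * d)%:R.
Proof.
rewrite -(pair_bigA _ (fun u (b : bool) => (head (u, b) == x)%:R))/=.
rewrite -(pair_bigA _ (fun z (l : 'I_d) => \sum_(b : bool) (head (z, l, b) == x)%:R))/=.
rewrite exchange_big/= (eq_bigr (fun=> 2)) ?sumr_const ?card_ord ?natrM ?mulr_natr// => l _.
rewrite exchange_big/= big_bool/=.
have H b : \sum_(z : site) ((nbr z l b == x)%:R : R) = 1.
  rewrite (bigD1 (nbr x l (~~ b)))//= -{2}(negbK b) nbrK eqxx [X in _ + X]big1 ?addr0//.
  move=> z zx; case: eqP => // zb; case/eqP: zx.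
  by rewrite -zb nbrK.
by rewrite /head /= !H.
Qed.

Lemma card_dbond : (#|{: dbond}|%:R : R) * e ^+ d = (2 * d)%:R.
Proof.
have := card_site R d M; rewrite !card_prod card_bool card_ord => H.
by rewrite -mulnA natrM mulrAC H mul1r mulnC.
Qed.

Lemma occE A s : occ R A s = (A \subset [set x | st_eta s x]%SET)%:R.
Proof.
case/boolP: (A \subset _) => [/fintype.subsetP H|/fintype.subsetPn[x xA]].
  by rewrite /occ big1// => x /H; rewrite inE => ->.
by rewrite inE => h; rewrite /occ (bigD1 x)//= (negbTE h) mul0r.
Qed.

Lemma occU A B s : occ R A s * occ R B s = occ R (A :|: B)%SET s.
Proof. by rewrite !occE finset.subUset -natrM mulnb. Qed.

Lemma corrU_le A B t : 0 <= t -> corr (A :|: B)%SET t <= corr A t.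
Proof.
move=> t0; apply: (Ex_le XP) => //; [exact: dominated_occ..|].
by move=> s; rewrite -occU ler_piMr ?occ_ge0// (le_trans (ler_norm _))// occ_bound.
Qed.

Definition bdens i t := dens (tail i) t * dens (head i) t.

Lemma prod_ends i t : \prod_(x in ends i) dens x t = bdens i t.
Proof. by rewrite big_setU1/= ?inE ?tail_neq_head// big_set1. Qed.

Lemma dens_ge0 x t : 0 <= t -> 0 <= dens x t.
Proof. exact: corr_ge0 XP _ _. Qed.

Lemma bdens_ge0 i t : 0 <= t -> 0 <= bdens i t.
Proof. by move=> t0; rewrite mulr_ge0// dens_ge0. Qed.

(** Counts coinciding end points rather than testing for an intersection, so that its sum over [j]
    splits into four sums of type [sum_tail] or [sum_head], in total [8 * d]. *)
Definition touch i j : R := (tail j == tail i)%:R + (head j == tail i)%:R +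
  ((tail j == head i)%:R + (head j == head i)%:R).

Lemma touch_ge0 i j : 0 <= touch i j.
Proof. by rewrite !addr_ge0. Qed.

(** Disjoint bonds fall under the four-point product bound. Otherwise the second bond is dropped,
    and the remaining two-point correlation is at most [U], which is paid by [touch] being at least
    1. *)
Lemma corr2_le i j t (U : R) : 0 <= t -> bdens i t <= U ->
  corr (ends i :|: ends j)%SET t <= bdens i t * bdens j t + touch i j * U.
Proof.
move=> t0 bU; have U0 : 0 <= U by apply: le_trans bU; exact: bdens_ge0.
have [dis|ndis] := boolP [disjoint ends i & ends j].
  apply: (le_trans (corr_le_prod XP _ t0)).
  rewrite (eq_bigl (mem [predU ends i & ends j])) => [|x]; last by rewrite !inE.
  rewrite bigU//= !prod_ends.
  by rewrite lerDl mulr_ge0 ?touch_ge0.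
apply: (le_trans (corrU_le _ _ t0)); apply: (le_trans (corr_le_prod XP _ t0)).
rewrite prod_ends; apply: (le_trans bU); apply: ler_wpDl; first by rewrite mulr_ge0 ?bdens_ge0.
rewrite ler_peMl//; move: ndis; rewrite -finset.setI_eq0 => /finset.set0Pn[x].
have h (b : bool) : 0 <= b%:R :> R by [].
have hA := h (tail j == tail i); have hB := h (head j == tail i).
have hC := h (tail j == head i); have hD := h (head j == head i).
rewrite !inE => /andP[/orP[/eqP xi|/eqP xi] /orP[/eqP xj|/eqP xj]].
- have E : tail j == tail i by rewrite -xi -xj.
  by move: hA hB hC hD; rewrite /touch E /=; lra.
- have E : head j == tail i by rewrite -xi -xj.
  by move: hA hB hC hD; rewrite /touch E /=; lra.
- have E : tail j == head i by rewrite -xi -xj.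
  by move: hA hB hC hD; rewrite /touch E /=; lra.
- have E : head j == head i by rewrite -xi -xj.
  by move: hA hB hC hD; rewrite /touch E /=; lra.
Qed.

(** [sc] scales the collision number and [sc1 = eps^-2 * sc] its drift; [sc1] is the inverse square
    of [eps^(d/2) * n]. *)
Definition sc1 : R := (e ^+ d * n%:R ^+ 2)^-1.
Definition sc : R := e ^+ 2 / (e ^+ d * n%:R ^+ 2).

Lemma sc1_ge0 : 0 <= sc1.
Proof. by rewrite invr_ge0 mulr_ge0 ?sqr_ge0// exprn_ge0// ltW// eps_gt0. Qed.

Lemma scE : e ^- 2 * sc = sc1.
Proof. by rewrite /sc mulrA mulVf ?mul1r// lt0r_neq0// exprn_gt0// eps_gt0. Qed.

Lemma sc_ge0 : 0 <= sc.
Proof. by rewrite mulr_ge0 ?sqr_ge0 ?sc1_ge0. Qed.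

Definition coll s : R := sc * \sum_i (st_C s (tail i, head i))%:R * Phi i.
Definition cint s : R := sc1 * \sum_i Phi i * occ R (ends i) s.

Definition cjump (p : site * site) : R := sc * \sum_i ((tail i, head i) == p)%:R * Phi i.

Lemma coll_collst s p : coll (coll_st s p) = coll s + cjump p.
Proof.
rewrite /coll /cjump -mulrDr -big_split/=; congr (_ * _); apply: eq_bigr => i _.
by rewrite ffunE natrD mulrDl.
Qed.

Lemma cjump_ge0 p : 0 <= cjump p.
Proof. by rewrite mulr_ge0 ?sc_ge0// sumr_ge0// => i _; rewrite mulr_ge0. Qed.

Lemma cjump_le p : cjump p <= sc * (c * (2 * d)%:R).
Proof.
case: p => p1 p2; rewrite ler_wpM2l ?sc_ge0// -(sum_tail p1) mulr_sumr.
apply: ler_sum => i _; rewrite xpair_eqE mulrC.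
have [_|_] /= := eqVneq (tail i) p1; last by rewrite !mulr0.
by case: eqP => _; rewrite ?mulr0 !mulr1 ?(c_ge0 i).
Qed.

Lemma sum_cjump s : e ^- 2 * \sum_(p | adj p.1 p.2 && st_eta s p.1 && st_eta s p.2) cjump p = cint s.
Proof.
rewrite /cjump -mulr_sumr mulrA scE; congr (_ * _); rewrite exchange_big/=.
apply: eq_bigr => i _; rewrite -mulr_suml mulrC; congr (_ * _).
rewrite occ_ends big_mkcond (bigD1 (tail i, head i))//= eqxx big1 ?addr0.
  by rewrite adj_ends; case: (st_eta s (tail i)); case: (st_eta s (head i)); rewrite ?mulr0 ?mul0r ?mulr1.
move=> q qi; case: ifP => // _; by rewrite eq_sym (negbTE qi).
Qed.

Lemma gen_coll s : gen jumps coll s = cint s.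
Proof.
rewrite genE [X in X + _]big1 ?add0r; last by move=> p _; rewrite subrr.
by rewrite -sum_cjump; congr (_ * _); apply: eq_bigr => p _; rewrite coll_collst addrAC subrr add0r.
Qed.

Definition qrate : R := sc * (c * (2 * d)%:R).

(** Expanding the square of a jump leaves the sum of squared jumps. Each jump is at most [qrate], so
    this sum is at most [qrate] times the drift: a bound on the quadratic variation. *)
Lemma gen_coll2_le s : gen jumps (fun s => coll s * coll s) s <= 2 * coll s * cint s + qrate * cint s.
Proof.
rewrite genE [X in X + _]big1 ?add0r; last by move=> p _; rewrite subrr.
rewrite -sum_cjump !(mulrCA _ (e ^- 2)) -mulrDr ler_wpM2l ?eps2_ge0//.
rewrite !mulr_sumr -big_split/=; apply: ler_sum => p _; rewrite coll_collst.
have := cjump_le p; have := cjump_ge0 p; rewrite -/qrate => h0 h1.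
have : cjump p * cjump p <= qrate * cjump p by rewrite ler_wpM2r.
lra.
Qed.

Lemma dominated_cint : dominated cint.
Proof.
rewrite /cint; have -> : (fun s => sc1 * \sum_i Phi i * occ R (ends i) s) =
   (fun s => sc1 * (\sum_i (Phi i * occ R (ends i) s + 0)) + 0).
  by apply/funext => s; rewrite addr0; under [in RHS]eq_bigr do rewrite addr0.
apply: dominatedD; last exact: dominated_cst.
apply: dominated_sum => i; apply: dominatedD; [exact: dominated_occ|exact: dominated_cst].
Qed.

Lemma dominated_coll : dominated coll.
Proof.
rewrite /coll; have -> : (fun s : state => sc * \sum_i (st_C s (tail i, head i))%:R * Phi i) =
   (fun s => sc * (\sum_i (Phi i * (st_C s (tail i, head i))%:R + 0)) + 0).
  by apply/funext => s; rewrite addr0; congr (_ * _); apply: eq_bigr => i _; rewrite addr0 mulrC.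
apply: dominatedD; last exact: dominated_cst.
apply: dominated_sum => i; apply: dominatedD; last exact: dominated_cst.
(* A counter is at most the level, and a number is below 2 to its power, so growth with base 2 is
   enough. *)
exists 1, 2; split; rewrite ?ler1n// => s; rewrite mul1r ger0_norm//.
rewrite -natrX ler_nat; apply: (@leq_trans (njumps s)); last by rewrite ltnW// ltn_expl.
by rewrite /njumps (bigD1 (tail i, head i))//= -addnA addnCA leq_addr.
Qed.

Definition fluct (a : R) t : R := Ex t (fun s => (coll s - a) ^+ 2).

Lemma Ex_coll2E a t : fluct a t = Ex t (fun s => coll s * coll s) - 2 * a * Ex t coll + a ^+ 2.
Proof.
have d1 := dominated_coll; have d2 := dominatedM d1 d1; have d3 := @dominated_cst R d M.
rewrite /fluct (_ : (fun s => _) = (fun s => (1 : R) * (coll s * coll s) + (- (2 * a) * coll s + a ^+ 2))).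
  rewrite (ExD n rho0 t 1 d2); last by apply: dominatedD.
  by rewrite (ExD n rho0 t _ d1)// Ex_cst; ring.
by apply/funext => s; ring.
Qed.

Lemma Ex_cint2E y t : Ex t (fun s => (cint s - y) ^+ 2) =
  Ex t (fun s => cint s * cint s) - 2 * y * Ex t cint + y ^+ 2.
Proof.
have d1 := dominated_cint; have d2 := dominatedM d1 d1; have d3 := @dominated_cst R d M.
rewrite (_ : (fun s => _) = (fun s => (1 : R) * (cint s * cint s) + (- (2 * y) * cint s + y ^+ 2))).
  rewrite (ExD n rho0 t 1 d2); last by apply: dominatedD.
  by rewrite (ExD n rho0 t _ d1)// Ex_cst; ring.
by apply/funext => s; ring.
Qed.

Local Open Scope classical_set_scope.
Local Open Scope ring_scope.

(** Since [2 u v <= u^2 + v^2] with [u = coll - a] and [v = cint - y], the derivative of the mean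
    square of [u] is at most that mean square plus [V], and [V] involves one-time moments only. *)
Lemma fluct_gronwall (a y : R -> R) (T V : R) :
  {within `[0, T]%classic, continuous a} -> a 0 = 0 ->
  (forall t, 0 < t < T -> is_derive t 1 a (y t)) ->
  (forall t, 0 <= t <= T ->
     Ex t (fun s => (cint s - y t) ^+ 2) + qrate * Ex t cint <= V) ->
  forall t, 0 <= t <= T -> fluct (a t) t <= expR t * V - V.
Proof.
move=> ca a0 Da HV.
have d1 := dominated_coll; have d2 := dominatedM d1 d1; have d3 := @dominated_cst R d M.
have d4 := dominated_cint; have d5 := dominatedM d4 d4.
pose m1 t := Ex t coll; pose m2 t := Ex t (fun s => coll s * coll s).
have D1 t : is_derive t 1 m1 (Ex t cint).
  have := is_derive_Ex n rho0 t d1; congr (is_derive _ _ _ (Ex _ _)).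
  by apply/funext => s; rewrite gen_coll.
have D2 t : is_derive t 1 m2 (Ex t (gen jumps (fun s => coll s * coll s))).
  exact: is_derive_Ex.
pose G t := m2 t - 2 * (a t * m1 t) + a t * a t.
pose dG t := Ex t (gen jumps (fun s => coll s * coll s)) -
  2 * (y t * m1 t + a t * Ex t cint) + 2 * (a t * y t).
have GE t : fluct (a t) t = G t by rewrite Ex_coll2E /G /m1 /m2; ring.
have cG : {within `[0, T]%classic, continuous G}.
  have cm1 : {within `[0, T]%classic, continuous m1}.
    by apply: derivable_within_continuous => t _; have := D1 t => ?; exact: ex_derive.
  have cm2 : {within `[0, T]%classic, continuous m2}.
    by apply: derivable_within_continuous => t _; have := D2 t => ?; exact: ex_derive.
  move=> t; apply: cvgD; last by apply: cvgM; exact: ca.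
  apply: cvgB; first exact: cm2.
  by apply: cvgMl_tmp; apply: cvgM; [exact: ca|exact: cm1].
have DG t : 0 < t < T -> is_derive t 1 G (dG t).
  move=> tT; have Dat := Da t tT; have D1t := D1 t; have D2t := D2 t.
  have D3 : is_derive t 1 (fun t => a t * m1 t) (a t * Ex t cint + m1 t * y t) by exact: is_deriveM.
  have D4 : is_derive t 1 (fun t => a t * a t) (a t * y t + a t * y t) by exact: is_deriveM.
  have D5 : is_derive t 1 (fun t => 2 * (a t * m1 t)) (2 * (a t * Ex t cint + m1 t * y t)).
    exact: (@is_deriveZ _ _ _ (fun t => a t * m1 t) 2 t 1).
  have D6 : is_derive t 1 (fun t => m2 t - 2 * (a t * m1 t))
     (Ex t (gen jumps (fun s => coll s * coll s)) - 2 * (a t * Ex t cint + m1 t * y t)).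
    exact: is_deriveB.
  have D7 := is_deriveD D6 D4.
  by apply: (is_derive_eq D7); rewrite /dG; ring.
have dGle t : 0 < t < T -> dG t <= G t + V.
  move=> /andP[t0 tT]; have t0' := ltW t0.
  have tT' : 0 <= t <= T by rewrite t0' ltW.
  have H : Ex t (gen jumps (fun s => coll s * coll s)) <=
     Ex t (fun s => (1 : R) * (coll s * coll s) + ((2 * (y t - a t)) * coll s + (1 * (cint s * cint s) +
       ((qrate + 2 * (a t - y t)) * cint s + (a t - y t) ^+ 2)))).
    apply: (Ex_le XP) => //.
    - exact: (dominated_gen (@exclusion_rate_ge0 R d M) (@exclusion_rate_le R d M) (@exclusion_njumps R d M)).
    - by do ?apply: dominatedD.
    move=> s; apply: (le_trans (gen_coll2_le s)).
    have := sqr_ge0 (coll s - a t - (cint s - y t)).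
    by move: (coll s) (cint s) (a t) (y t) qrate => C I A Y q; nra.
  rewrite (ExD n rho0 t 1 d2) in H; last by do ?apply: dominatedD.
  rewrite (ExD n rho0 t _ d1) in H; last by do ?apply: dominatedD.
  rewrite (ExD n rho0 t _ d5) in H; last by do ?apply: dominatedD.
  rewrite (ExD n rho0 t _ d4) // Ex_cst in H.
  have := HV t tT'; rewrite Ex_cint2E.
  rewrite /dG /G -/(m1 t) -/(m2 t) in H *; lra.
move=> t tT; rewrite GE; have := gronwall cG DG dGle tT.
have -> : G 0 = 0.
  rewrite -GE a0 /fluct /Ex EE0 big_map big1// => eta _.
  rewrite subr0 /coll big1 ?mulr0 ?expr0n ?mulr0// => i _.
  by rewrite ffunE mul0r.
by rewrite add0r.
Qed.

Lemma Ex_cintE t : Ex t cint = sc1 * \sum_i Phi i * pcorr (tail i) (head i) t.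
Proof.
have dd i : dominated (fun s => Phi i * occ R (ends i) s).
  rewrite (_ : (fun s => _) = (fun s => Phi i * occ R (ends i) s + 0)).
    by apply: dominatedD; [exact: dominated_occ|exact: dominated_cst].
  by apply/funext => s; rewrite addr0.
rewrite ExZ; last exact: dominated_sum.
congr (_ * _); rewrite Ex_sum//; apply: eq_bigr => i _.
by rewrite ExZ//; exact: dominated_occ.
Qed.

Lemma Ex_cint_le t : 0 <= t -> Ex t cint <= sc1 * \sum_i Phi i * bdens i t.
Proof.
move=> t0; rewrite Ex_cintE ler_wpM2l ?sc1_ge0//; apply: ler_sum => i _.
rewrite ler_wpM2l//; apply: (le_trans (corr_le_prod XP _ t0)).
by rewrite prod_ends.
Qed.

(** The product parts of the pair bounds assemble to the square of the first-order bound; [touch]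
    sums to [8 * d] for each bond, so the remainder is only linear in the number of bonds. *)
Lemma Ex_cint2_le t (U : R) : 0 <= t -> (forall i, bdens i t <= U) ->
  Ex t (fun s => cint s * cint s) <= (sc1 * \sum_i Phi i * bdens i t) ^+ 2 +
    sc1 ^+ 2 * (c ^+ 2 * U * (8 * d)%:R * #|{: dbond}|%:R).
Proof.
move=> t0 bU.
have E : (fun s => cint s * cint s) =
   (fun s => sc1 ^+ 2 * \sum_i \sum_j (Phi i * Phi j) * occ R (ends i :|: ends j)%SET s).
  apply/funext => s; rewrite /cint mulrACA -expr2; congr (_ * _).
  rewrite mulr_suml; apply: eq_bigr => i _; rewrite mulr_sumr; apply: eq_bigr => j _.
  by rewrite mulrACA occU.
have dd i j : dominated (fun s => (Phi i * Phi j) * occ R (ends i :|: ends j)%SET s).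
  rewrite (_ : (fun s => _) = (fun s => (Phi i * Phi j) * occ R (ends i :|: ends j)%SET s + 0)).
    by apply: dominatedD; [exact: dominated_occ|exact: dominated_cst].
  by apply/funext => s; rewrite addr0.
have dd2 i : dominated (fun s => \sum_j (Phi i * Phi j) * occ R (ends i :|: ends j)%SET s).
  by apply: dominated_sum.
rewrite E ExZ; last exact: dominated_sum.
rewrite exprMn -mulrDr ler_wpM2l ?sqr_ge0// Ex_sum//.
under eq_bigr do rewrite Ex_sum//.
rewrite expr2 mulr_suml.
apply: (@le_trans _ _ (\sum_i (Phi i * bdens i t * (\sum_j Phi j * bdens j t) + c ^+ 2 * U * (8 * d)%:R))); last first.
  by rewrite big_split/= lerD2l sumr_const -(mulr_natr (c ^+ 2 * U * _)).
apply: ler_sum => i _.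
have U0 : 0 <= U by apply: le_trans (bU i); exact: bdens_ge0.
apply: (@le_trans _ _ (\sum_j (Phi i * bdens i t * (Phi j * bdens j t) + c ^+ 2 * U * touch i j))).
  apply: ler_sum => j _; rewrite ExZ; last exact: dominated_occ.
  have h1 := corr2_le j t0 (bU i).
  apply: (le_trans (ler_wpM2l (mulr_ge0 (Phi_ge0 i) (Phi_ge0 j)) h1)).
  rewrite mulrDr mulrACA lerD2l [touch i j * U]mulrC mulrA ler_wpM2r ?touch_ge0//.
  by rewrite ler_wpM2r// expr2 ler_pM.
rewrite big_split/= -mulr_sumr lerD2l -mulr_sumr /touch !big_split/= !sum_tail !sum_head.
apply: ler_wpM2l; first by rewrite mulr_ge0 ?sqr_ge0.
rewrite !natrM; lra.
Qed.

End collisions.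

Local Open Scope classical_set_scope.
Local Open Scope ring_scope.

(** * From lattice correlations to the heat equation *)

Section heat_solution.
Variables (R : realType) (d : nat) (rho0 : 'rV[R]_d -> R) (rho : 'rV[R]_d -> R -> R).
Hypotheses (crho0 : continuous rho0) (prho0 : torus_periodic rho0).
Hypothesis hrho : heat_sol rho0 rho.
Implicit Types (x y : 'rV[R]_d) (t : R).

Lemma heat_bounded : exists2 K : R, 0 < K & forall x t, 0 <= t -> `|rho x t| <= K.
Proof.
have [K K0 HK] := periodic_bounded crho0 prho0; exists K => // x t t0.
(* The empty list of modes is the zero solution. *)
have := heat_dist hrho (heat_sol_trigsol [::]) (c := K) _ x t0.
rewrite {2}/trigsol big_nil subr0; apply => y.
by rewrite /trigsol big_nil subr0.
Qed.

Lemma heat_trig_approx (e : R) : 0 < e -> exists p : seq (mode R d),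
  (forall lam x, `|rho0 x - trigsol lam p x 0| <= e) /\
  forall x t, 0 <= t -> `|rho x t - trigsol (@damping R d) p x t| <= e.
Proof.
move=> e0; have [p Hp] := trig_dense crho0 prho0 e0; exists p; split => // x t t0.
exact: heat_dist hrho (heat_sol_trigsol p) (Hp _) x t t0.
Qed.

(** The radius serves all times down to zero: [rho] is within [e / 3] of a trigonometric flow whose
    Lipschitz constant does not depend on time. *)
Lemma heat_unif_continuous (e : R) : 0 < e -> exists2 r : R, 0 < r &
  forall x y t, 0 <= t -> `|x - y| <= r -> `|rho x t - rho y t| <= e.
Proof.
move=> e0; have e3 : 0 < e / 3 by rewrite divr_gt0.
have [p [_ Hp]] := heat_trig_approx e3.
have L0 : 0 < `|lipconst p| + 1 by rewrite ltr_wpDl.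
exists (e / 3 / (`|lipconst p| + 1)); first by rewrite divr_gt0.
move=> x y t t0 xy.
have h1 := Hp x t t0; have h2 := Hp y t t0.
have h3 : `|trigsol (@damping R d) p x t - trigsol (@damping R d) p y t| <= e / 3.
  apply: (le_trans (trigsol_lip _ _ _ (@damping_ge0 R d) t0)).
  apply: (@le_trans _ _ ((`|lipconst p| + 1) * (e / 3 / (`|lipconst p| + 1)))).
    apply: ler_pM => //; last by rewrite (le_trans (ler_norm _))// lerDl.
    apply: sumr_ge0 => m _; rewrite mulr_ge0// sumr_ge0// => i _.
    by rewrite !mulr_ge0// pi_ge0.
  by rewrite mulrC divfK ?lt0r_neq0.
move: h1 h2 h3; rewrite !ler_norml => /andP[? ?] /andP[? ?] /andP[? ?].
by apply/andP; split; lra.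
Qed.

End heat_solution.

Section local_equilibrium.
Variables (R : realType) (d : nat) (rho0 : 'rV[R]_d -> R) (rho : 'rV[R]_d -> R -> R).
Hypotheses (crho0 : continuous rho0) (prho0 : torus_periodic rho0).
Hypothesis hrho : heat_sol rho0 rho.

Lemma prodB_le (a b a' b' K q : R) : `|a| <= K -> `|b'| <= K -> `|a - a'| <= q -> `|b - b'| <= q ->
  `|a * b - a' * b'| <= 2 * K * q.
Proof.
move=> aK bK aq bq; have -> : a * b - a' * b' = a * (b - b') + (a - a') * b' by ring.
apply: (le_trans (ler_normD _ _)); rewrite !normrM.
have : `|a| * `|b - b'| <= K * q by rewrite ler_pM.
have : `|a - a'| * `|b'| <= q * K by rewrite ler_pM.
lra.
Qed.

(** The occupation scale: a site is occupied with probability about [massn * rho]. It may tend to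
    zero, so errors have to be stated relative to it. *)
Definition massn (n M : nat) : R := n%:R * eps R M ^+ d.

(** The comparison function is [massn] times a lattice trigonometric flow: an exact solution on the
    lattice, close to [rho], with the uniform Lipschitz bound that the barrier estimate requires. *)
Lemma local_equilibrium (T eta : R) : 0 <= T -> 0 < eta -> exists2 r : R, 0 < r &
  forall (n M : nat) (dO : measure_display) (Omega : measurableType dO)
    (P : probability Omega R) (X : R -> Omega -> state d M),
  is_markov (@exclusion_jumps R d M) P X (init_law rho0 n) ->
  eps R M < r ->
  (forall (x : site d M) t, 0 <= t <= T ->
     `|dens n rho0 x t - massn n M * rho (pos R x) t| <= massn n M * eta) /\
  (forall (x y : site d M) t, x != y -> 0 <= t <= T ->
     massn n M ^+ 2 * (rho (pos R x) t * rho (pos R y) t - eta) <= pcorr n rho0 x y t).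
Proof.
move=> T0 eta0; have [K K0 rhoK] := heat_bounded crho0 prho0 hrho.
(* The pair bound collects errors [4 * (K + 4) * q] from time zero, [4 * (K + 2) * q] from replacing
   the lattice flow by [rho], and [q] from the barrier; the density bound costs [4 * q]. *)
pose C : R := 8 * K + 32.
have C0 : 0 < C by rewrite /C; lra.
pose q := Num.min 1 (eta / C).
have q0 : 0 < q by rewrite lt_min ltr01 divr_gt0.
have q1 : q <= 1 by rewrite ge_min lexx.
have qC : q * C <= eta by rewrite -ler_pdivlMr// ge_min lexx orbT.
have [p [Hp0 Hp]] := heat_trig_approx crho0 prho0 hrho q0.
have [r1 r10 H1] := periodic_unif_continuous crho0 prho0 q0.
have [r2 r20 H2] := trigsol_cvg p T0 q0.
pose L := lipconst p.
(* The barrier error is at most [massn^2 * eps * Q], which is why [eps] is kept below [q / Q]. *)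
pose Q := L ^+ 2 / 2 * (d%:R + 2 * (d%:R * pi ^+ 2) * T) + 1.
have Q0 : 0 < Q.
  apply: ltr_wpDl => //; apply: mulr_ge0; first by apply: divr_ge0 => //; exact: sqr_ge0.
  by apply: addr_ge0 => //; do 3 apply: mulr_ge0 => //; exact: sqr_ge0.
have r4 : 0 < Num.min (Num.min r1 r2) (Num.min (1/4) (q / Q)).
  have qQ : 0 < q / Q by exact: divr_gt0 q0 Q0.
  have q4 : 0 < 1 / 4 :> R by lra.
  by rewrite !lt_min r10 r20 q4 qQ.
exists (Num.min (Num.min r1 r2) (Num.min (1/4) (q / Q))) => //.
move=> n M dO Omega P X XP; rewrite !lt_min => /and3P[/andP[er1 er2] e4 eQ].
have e0 := eps_gt0 R M; set e := eps R M in er1 er2 e4 eQ e0.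
have M2 : (2 <= M)%N.
  rewrite leqNgt; apply/negP; rewrite ltnS => M1.
  have : M.+1%:R <= 2 :> R by rewrite ler_nat.
  by have := epsM R M; rewrite -/e; nra.
set nu := massn n M; have nu0 : 0 <= nu by rewrite mulr_ge0// exprn_ge0// ltW.
pose tr (x : site d M) (t : R) : R := trigsol (ldamping R M) p (pos R x) t.
pose v (x : site d M) (t : R) : R := nu * tr x t.
have hv : lheat v by exact: lheat_trigsol.
have tr_rho x t : 0 <= t <= T -> `|tr x t - rho (pos R x) t| <= 2 * q.
  move=> tT; have /andP[t0 _] := tT.
  have := H2 M er2 (pos R x) t tT; have := Hp (pos R x) t t0.
  by rewrite !ler_norml -/(tr x t); lra.
have tr_le x t : 0 <= t <= T -> `|tr x t| <= K + 2.
  move=> tT; have /andP[t0 _] := tT.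
  have := tr_rho x t tT; have := rhoK (pos R x) t t0.
  by rewrite !ler_norml; lra.
have rho00 x : rho x 0 = rho0 x by case: hrho.
have init_v x : `|init_param rho0 n x - v x 0| <= nu * (2 * q).
  have := @init_param_approx R d M rho0 n x q crho0; rewrite -/e -/(massn n M) -/nu.
  have hz z : `|z - pos R x| <= e -> `|rho0 z - rho0 (pos R x)| <= q.
    by move=> zx; apply/ltW/H1; exact: le_lt_trans zx er1.
  move=> /(_ hz) h.
  have : `|nu * rho0 (pos R x) - v x 0| <= nu * q.
    by rewrite /v -mulrBr normrM ger0_norm// ler_wpM2l// /tr Hp0.
  by move: h; rewrite !ler_norml; lra.
have dv x t : 0 <= t -> `|dens n rho0 x t - v x t| <= nu * (2 * q).
  move=> t0; apply: (lheat_dist (@lheat_dens _ _ _ n rho0 M2) hv) => // y.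
  by rewrite /dens corr0 big_set1.
split.
  move=> x t tT; have /andP[t0 _] := tT.
  have h1 := dv x t t0.
  have h2 : `|v x t - nu * rho (pos R x) t| <= nu * (2 * q).
    by rewrite /v -mulrBr normrM ger0_norm// ler_wpM2l// tr_rho.
  have h3 : nu * (4 * q) <= nu * eta.
    rewrite ler_wpM2l//; have := mulr_ge0 (ltW q0) (ltW K0); move: qC; rewrite /C; lra.
  by move: h1 h2; rewrite !ler_norml; lra.
move=> x y t xy tT; have /andP[t0 tT'] := tT.
have L0 : 0 <= L.
  apply: sumr_ge0 => m _; rewrite mulr_ge0// sumr_ge0// => i _.
  by rewrite !mulr_ge0// pi_ge0.
have vadj a b s : 0 <= s -> adj a b -> e ^- 2 * (v a s - v b s) ^+ 2 <= (nu * L) ^+ 2.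
  move=> s0 /adjP[l [c ->]].
  have : `|tr a s - tr (nbr a l c) s| <= L * e.
    rewrite /tr (@periodic_nbr _ _ _ (fun z => trigsol (ldamping R M) p z s)); last first.
      by move=> z i; apply: eq_bigr => m _; rewrite cosmode_periodic.
    apply: (le_trans (trigsol_lip _ _ _ (@ldamping_ge0 R d M) s0)).
    rewrite -/L ler_wpM2l// opprD addrA subrr add0r normrN normrZ norm_unitv mulr1.
    by rewrite normrM /sgnb; case: c; rewrite ?normrN normr1 mul1r ger0_norm// ltW.
  move=> h; have hv2 : `|v a s - v (nbr a l c) s| <= e * (nu * L).
    rewrite /v -mulrBr normrM (ger0_norm nu0) mulrCA ler_wpM2l//.
    by rewrite mulrC.
  rewrite ler_pdivrMl ?exprn_gt0// -exprMn -(real_normK (num_real (_ - _))).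
  rewrite lerXn2r// nnegrE; apply: mulr_ge0; [exact: ltW|exact: mulr_ge0].
have vc a b : a != b -> v a 0 * v b 0 - nu ^+ 2 * (2 * (K + 4) * (2 * q)) <=
    init_param rho0 n a * init_param rho0 n b.
  move=> _; have h0 : 0 <= (0 : R) <= T by rewrite lexx.
  have va : `|v a 0| <= nu * (K + 4).
    by rewrite /v normrM ger0_norm// ler_wpM2l//; have := tr_le a 0 h0; lra.
  have ib : `|init_param rho0 n b| <= nu * (K + 4).
    have := init_v b; have : `|v b 0| <= nu * (K + 2).
      by rewrite /v normrM ger0_norm// ler_wpM2l// tr_le.
    have : nu * (2 * q) <= nu * 2 by rewrite ler_wpM2l//; lra.
    by rewrite !ler_norml; lra.
  have ha : `|v a 0 - init_param rho0 n a| <= nu * (2 * q) by rewrite distrC.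
  have hb : `|v b 0 - init_param rho0 n b| <= nu * (2 * q) by rewrite distrC.
  have := prodB_le va ib ha hb; rewrite ler_norml => /andP[_].
  by rewrite (_ : 2 * (nu * (K + 4)) * (nu * (2 * q)) = nu ^+ 2 * (2 * (K + 4) * (2 * q))); [lra|ring].
have := @pcorr_ge R d M n rho0 M2 v ((nu * L) ^+ 2) (nu ^+ 2 * (2 * (K + 4) * (2 * q)))
  (ltW e4) hv (sqr_ge0 _) vadj vc x y t xy t0.
apply: le_trans.
have hQ : (nu * L) ^+ 2 / 2 * (e * d%:R + 2 * (d%:R * pi ^+ 2) * e * t) <= nu ^+ 2 * q.
  have -> : (nu * L) ^+ 2 / 2 * (e * d%:R + 2 * (d%:R * pi ^+ 2) * e * t) =
    nu ^+ 2 * (e * (L ^+ 2 / 2 * (d%:R + 2 * (d%:R * pi ^+ 2) * t))) by field.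
  rewrite ler_wpM2l ?sqr_ge0//; apply: (@le_trans _ _ (e * Q)).
    rewrite ler_pM2l// /Q ler_wpDr// ler_wpM2l ?divr_ge0 ?sqr_ge0// lerD2l.
    by apply: ler_wpM2l => //; do 2 apply: mulr_ge0 => //; exact: sqr_ge0.
  by rewrite -ler_pdivlMr// ltW.
have hvv : nu ^+ 2 * (rho (pos R x) t * rho (pos R y) t) - nu ^+ 2 * (2 * (K + 2) * (2 * q)) <= v x t * v y t.
  have -> : v x t * v y t = nu ^+ 2 * (tr x t * tr y t) by rewrite /v; ring.
  rewrite -mulrBr ler_wpM2l ?sqr_ge0//.
  have rK : `|rho (pos R y) t| <= K + 2 by have := rhoK (pos R y) t t0; lra.
  by have := prodB_le (tr_le x t tT) rK (tr_rho x t tT) (tr_rho y t tT); rewrite ler_norml; lra.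
have hC : nu ^+ 2 * (q * C) <= nu ^+ 2 * eta by rewrite ler_wpM2l ?sqr_ge0.
rewrite mulrBr; rewrite /C in hC.
have Nq : 0 <= nu ^+ 2 * q by rewrite mulr_ge0 ?sqr_ge0// ltW.
move: hQ hvv hC Nq; move: (_ / 2 * _) (v x t * v y t) (rho _ _ * rho _ _) => A V W; lra.
Qed.

End local_equilibrium.

(** * Time integral of the squared density *)

Section squared_density_integral.
Variables (R : realType) (d : nat) (rho0 : 'rV[R]_d -> R) (rho : 'rV[R]_d -> R -> R).
Hypotheses (crho0 : continuous rho0) (prho0 : torus_periodic rho0).
Hypothesis hrho : heat_sol rho0 rho.
Variable K : R.
Hypothesis rhoK : forall x t, 0 <= t -> `|rho x t| <= K.
Implicit Types (x y : 'rV[R]_d) (s t : R).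
Local Notation mu := (@lebesgue_measure R).

Definition Rint x t : R := \int[mu]_(s in `[0, t]) (rho x s ^+ 2).

(** Reflection in time gives a function continuous on the whole line, as the integral lemmas demand,
    while [rho] is continuous only for nonnegative times. *)
Let sq x s := rho x `|s| ^+ 2.

Let sq_continuous x : continuous (sq x).
Proof.
have [_ [_ [crho _]]] := hrho; move/subspace_continuousP in crho.
pose g (s : R) : 'rV[R]_d * R := (x, `|s|).
have cg : continuous g.
  move=> s; apply: (@cvg_pair _ _ _ (nbhs s) (nbhs x) (nbhs `|s|) _ _ _ (fun=> x) Num.norm); [exact: cvg_cst|exact: norm_continuous].
have cr : continuous (fun s => rho x `|s|).
  move=> s; have gA : [set p : 'rV[R]_d * R | 0 <= p.2] (g s) by exact: normr_ge0.
  apply: (@cvg_comp _ _ _ g (fun p => rho p.1 p.2) _ _ _ _ (crho _ gA)).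
  move=> W HW; have FF : Filter (nbhs s) by exact: nbhs_filter.
  by apply: (@filterS _ (nbhs s) _ _ _ _ (cg s _ HW)) => s' /=; apply; exact: normr_ge0.
have -> : sq x = (fun s => rho x `|s| * rho x `|s|).
  by apply/funext => s; rewrite /sq expr2.
by move=> s; apply: cvgM; exact: cr.
Qed.

Let RintE x t : Rint x t = \int[mu]_(s in `[0, t]) sq x s.
Proof.
by apply: eq_Rintegral => s; rewrite inE/= in_itv/= => /andP[s0 _]; rewrite /sq ger0_norm.
Qed.

Let K_ge0 : 0 <= K. Proof. exact: le_trans (rhoK 0 (lexx 0)). Qed.

Let sq_le x s : 0 <= sq x s <= K ^+ 2.
Proof.
rewrite sqr_ge0 /= /sq -(real_normK (num_real _)) lerXn2r ?nnegrE//.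
exact: rhoK.
Qed.

Lemma Rint0 x : Rint x 0 = 0.
Proof. by rewrite /Rint set_itv1 Rintegral_set1. Qed.

Lemma is_derive_Rint x t : 0 < t -> is_derive t 1 (Rint x) (rho x t ^+ 2).
Proof.
move=> t0; have t1 : t < t + 1 by rewrite ltrDl.
have [] := continuous_FTC1_closed t1 (integrable_continuous 0 (t + 1) (@sq_continuous x)) t0
  (@sq_continuous x t).
have -> : (fun u => (\int[mu]_(s in [set` `[0, u]]) sq x s)%R) = Rint x.
  by apply/funext => u; rewrite RintE.
move=> D E; apply: DeriveDef => //.
by rewrite -derive1E E /sq ger0_norm// ltW.
Qed.

Lemma Rint_incr x s t : 0 <= s <= t -> 0 <= Rint x t - Rint x s <= K ^+ 2 * (t - s).
Proof.
move=> /andP[s0 st]; rewrite !RintE (@int_split _ 0 t s) ?s0// addrAC subrr add0r.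
rewrite Rintegral_ge0 => [|u _]; last by case/andP: (sq_le x u).
rewrite -int_cst//; apply: int_le => //; first exact: cst_continuous.
by move=> u _; case/andP: (sq_le x u).
Qed.

Lemma Rint_ge0 x t : 0 <= t -> 0 <= Rint x t.
Proof. by move=> t0; have := @Rint_incr x 0 t; rewrite lexx t0 Rint0 subr0 => /(_ isT)/andP[]. Qed.

Lemma Rint_le x t : 0 <= t -> Rint x t <= K ^+ 2 * t.
Proof. by move=> t0; have := @Rint_incr x 0 t; rewrite lexx t0 Rint0 !subr0 => /(_ isT)/andP[]. Qed.

Lemma Rint_within_continuous x T : {within `[0, T], continuous (Rint x)}.
Proof.
apply/subspace_continuousP => t; rewrite /= in_itv/= => /andP[t0 tT].
apply/cvgrPdist_le => e e0.
have K1 : 0 < K ^+ 2 + 1 by rewrite ltr_wpDl ?sqr_ge0.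
rewrite near_withinE; near=> u => /=; rewrite in_itv/= => /andP[u0 _].
apply: (@le_trans _ _ ((K ^+ 2 + 1) * `|t - u|)).
  have [tu|/ltW ut] := leP t u.
    have := @Rint_incr x t u; rewrite t0 tu => /(_ isT)/andP[h1 h2].
    rewrite distrC ger0_norm// distrC ger0_norm ?subr_ge0//.
    by apply: (le_trans h2); rewrite ler_wpM2r ?subr_ge0// lerDl.
  have := @Rint_incr x u t; rewrite u0 ut => /(_ isT)/andP[h1 h2].
  rewrite ger0_norm// ger0_norm ?subr_ge0//.
  by apply: (le_trans h2); rewrite ler_wpM2r ?subr_ge0// lerDl.
rewrite -ler_pdivlMl//; near: u.
by apply: cvgr_dist_le; [exact: cvg_id|rewrite mulr_gt0// invr_gt0].
Unshelve. all: by end_near. Qed.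

Lemma Rint_modulus x y t (q : R) : 0 <= t ->
  (forall s, 0 <= s -> `|rho x s - rho y s| <= q) ->
  `|Rint x t - Rint y t| <= 2 * K * q * t.
Proof.
move=> t0 xy; rewrite !RintE -[X in _ * X](subr0 t).
apply: int_dist => // s _; rewrite /sq.
have h := xy `|s| (normr_ge0 s).
have -> : forall a b : R, a ^+ 2 - b ^+ 2 = a * a - b * b by move=> a b; ring.
by apply: prodB_le => //; exact: rhoK.
Qed.

Lemma Rint_continuous t : 0 <= t -> continuous (Rint^~ t).
Proof.
move=> t0 x; have FF : Filter (nbhs x) by exact: nbhs_filter.
apply/cvgrPdist_le => e e0.
have Q0 : 0 < 2 * K * t + 1 by rewrite ltr_wpDl// !mulr_ge0.
have [r r0 Hr] := heat_unif_continuous crho0 prho0 hrho (divr_gt0 e0 Q0).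
near=> y.
apply: (le_trans (Rint_modulus t0 (q := e / (2 * K * t + 1)) _)).
  move=> s s0; apply: Hr => //; near: y.
rewrite mulrAC mulrA ler_pdivrMr// mulrC ler_pM2l// lerDl//.
Unshelve. all: by end_near. Qed.

End squared_density_integral.

(** * Law of large numbers at a fixed time *)

Section intensity_variance.
Variables (R : realType) (d M n : nat) (rho0 : 'rV[R]_d -> R).
Variables (dO : measure_display) (Omega : measurableType dO).
Variables (P : probability Omega R) (X : R -> Omega -> state d M).
Hypothesis XP : is_markov (@exclusion_jumps R d M) P X (init_law rho0 n).
Hypothesis M2 : (2 <= M)%N.
Hypothesis n0 : (0 < n)%N.
Local Notation e := (eps R M).
Local Notation Ex := (@Ex R d M n rho0).
Local Notation nu := (@massn R d n M).
Local Notation sc1 := (sc1 R d M n).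
Variables (Phi : dbond d M -> R) (c : R).
Hypotheses (Phi_ge0 : forall i, 0 <= Phi i) (Phi_le : forall i, Phi i <= c).
Hypothesis c0 : 0 <= c.
Variables (rr : site d M -> R) (t K q : R).
Hypotheses (t0 : 0 <= t) (K0 : 0 <= K) (q0 : 0 <= q).
Hypothesis rrK : forall x, `|rr x| <= K.
Hypothesis densK : forall x : site d M, dens n rho0 x t <= nu * (K + 1).
Hypothesis bdens_le : forall i : dbond d M, bdens n rho0 i t <= nu ^+ 2 * (rr (tail i) ^+ 2 + q).
Hypothesis pcorr_le : forall i : dbond d M, nu ^+ 2 * (rr (tail i) ^+ 2 - q) <= pcorr n rho0 (tail i) (head i) t.

(** A Riemann sum for the pairing of the test function with [rho^2], when [rr] holds the values of
    [rho]. It is the target of the drift, since [sc1 * massn^2 = eps^d]. *)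
Definition mean_int : R := e ^+ d * \sum_i Phi i * rr (tail i) ^+ 2.

Let D : R := (2 * d)%:R.
Let s : R := D * c * q.

Let ed0 : 0 < e ^+ d. Proof. by rewrite exprn_gt0// eps_gt0. Qed.

Lemma sc1_massn : sc1 * nu ^+ 2 = e ^+ d.
Proof.
rewrite /sc1 /massn; have : n%:R != 0 :> R by rewrite pnatr_eq0 -lt0n.
have := lt0r_neq0 ed0; move: (e ^+ d) (n%:R) => E N E0 N0.
by field; rewrite E0 N0.
Qed.

Let sumPhi : e ^+ d * \sum_i Phi i <= D * c.
Proof.
rewrite /D -(card_dbond R d M) mulrC mulrAC; apply: ler_wpM2r; first exact: ltW.
by rewrite mulr_natl -sumr_const; apply: ler_sum => i _.
Qed.

Let shift (a : R) : sc1 * \sum_i Phi i * (nu ^+ 2 * (rr (tail i) ^+ 2 + a)) =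
   mean_int + a * (e ^+ d * \sum_i Phi i).
Proof.
have -> : \sum_i Phi i * (nu ^+ 2 * (rr (tail i) ^+ 2 + a)) =
    nu ^+ 2 * (\sum_i Phi i * rr (tail i) ^+ 2 + a * \sum_i Phi i).
  by rewrite [a * _]mulr_sumr -big_split/= mulr_sumr; apply: eq_bigr => i _; ring.
by rewrite mulrA sc1_massn /mean_int; ring.
Qed.

Lemma mean_int_ge0 : 0 <= mean_int.
Proof. by apply: mulr_ge0; [exact: ltW|apply: sumr_ge0 => i _; rewrite mulr_ge0 ?sqr_ge0]. Qed.

Lemma mean_int_le : mean_int <= D * c * K ^+ 2.
Proof.
apply: (@le_trans _ _ (e ^+ d * (\sum_i Phi i) * K ^+ 2)).
  rewrite -mulrA ler_pM2l// mulr_suml; apply: ler_sum => i _.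
  rewrite ler_wpM2l// -(real_normK (num_real (rr _))) lerXn2r ?nnegrE//.
by rewrite ler_wpM2r ?sqr_ge0.
Qed.

Lemma Ex_cint_ub : Ex t (cint n Phi) <= mean_int + s.
Proof.
apply: (le_trans (Ex_cint_le XP M2 Phi_ge0 t0)).
apply: (@le_trans _ _ (sc1 * \sum_i Phi i * (nu ^+ 2 * (rr (tail i) ^+ 2 + q)))).
  by rewrite ler_wpM2l ?sc1_ge0//; apply: ler_sum => i _; rewrite ler_wpM2l.
by rewrite shift lerD2l /s mulrC ler_wpM2r.
Qed.

Lemma Ex_cint_lb : mean_int - s <= Ex t (cint n Phi).
Proof.
rewrite Ex_cintE.
apply: (@le_trans _ _ (sc1 * \sum_i Phi i * (nu ^+ 2 * (rr (tail i) ^+ 2 - q)))).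
  by rewrite shift lerD2l mulNr lerN2 /s mulrC ler_wpM2r.
by rewrite ler_wpM2l ?sc1_ge0//; apply: ler_sum => i _; rewrite ler_wpM2l.
Qed.

(** With [m] for [mean_int], the product part of the second moment is at most [(m + s)^2] and the
    mean at least [m - s], so [(m + s)^2 - 2 m (m - s) + m^2 = 4 m s + s^2]. The last summand comes
    from bonds that share a site. *)
Lemma cint_variance : Ex t (fun st => (cint n Phi st - mean_int) ^+ 2) <=
  4 * mean_int * s + s ^+ 2 + sc1 * (c ^+ 2 * (K + 1) ^+ 2 * (8 * d)%:R * D).
Proof.
rewrite Ex_cint2E.
have bU (i : dbond d M) : bdens n rho0 i t <= (nu * (K + 1)) ^+ 2.
  by rewrite expr2; apply: ler_pM; rewrite ?(dens_ge0 XP _ t0) ?densK.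
have h1 := Ex_cint2_le XP M2 Phi_ge0 Phi_le t0 bU.
have h2 := Ex_cint_lb.
have h3 : sc1 * \sum_i Phi i * bdens n rho0 i t <= mean_int + s.
  apply: (@le_trans _ _ (sc1 * \sum_i Phi i * (nu ^+ 2 * (rr (tail i) ^+ 2 + q)))).
    by rewrite ler_wpM2l ?sc1_ge0//; apply: ler_sum => i _; rewrite ler_wpM2l.
  by rewrite shift lerD2l /s mulrC ler_wpM2r.
have h30 : 0 <= sc1 * \sum_i Phi i * bdens n rho0 i t.
  rewrite mulr_ge0 ?sc1_ge0// sumr_ge0// => i _.
  by rewrite mulr_ge0// (bdens_ge0 XP _ t0).
have h4 : sc1 ^+ 2 * (c ^+ 2 * (nu * (K + 1)) ^+ 2 * (8 * d)%:R * #|{: dbond d M}|%:R) =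
   sc1 * (c ^+ 2 * (K + 1) ^+ 2 * (8 * d)%:R * D).
  by rewrite /D -(card_dbond R d M) -[in RHS]sc1_massn; ring.
have m0 := mean_int_ge0.
have s0 : 0 <= s by rewrite !mulr_ge0.
have h5 : (sc1 * \sum_i Phi i * bdens n rho0 i t) ^+ 2 <= (mean_int + s) ^+ 2.
  by rewrite lerXn2r ?nnegrE// addr_ge0.
have h6 : mean_int * (mean_int - s) <= mean_int * Ex t (cint n Phi) by rewrite ler_wpM2l.
by rewrite h4 in h1; nra.
Qed.

End intensity_variance.

Section law_of_large_numbers.
Variables (R : realType) (d : nat) (rho0 : 'rV[R]_d -> R) (rho : 'rV[R]_d -> R -> R).
Hypotheses (crho0 : continuous rho0) (prho0 : torus_periodic rho0).
Hypothesis hrho : heat_sol rho0 rho.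
Variable phi : testfn R d.
Hypotheses (cphi : forall l b, continuous (phi l b))
  (pphi : forall l b, torus_periodic (phi l b)).

Definition bond_weight M (i : dbond d M) : R :=
  phi i.1.2 i.2 (pos R (tail i) + ((if i.2 then 1 else -1) * eps R M / 2) *: unitv R i.1.2).

Lemma collision_numberE M n (Xw : R -> state d M) t :
  collision_number n Xw t phi = coll n (@bond_weight M) (Xw t).
Proof.
rewrite /collision_number /coll; congr (_ * _).
rewrite pair_bigA /= pair_bigA /=; apply: eq_bigr => -[[x l] b] _ /=.
by rewrite /bond_weight.
Qed.

Lemma test_bounded : exists2 c : R, 0 < c & forall l b x, `|phi l b x| <= c.
Proof.
have H (q : 'I_d * bool) : exists c : R, 0 < c /\ forall x, `|phi q.1 q.2 x| <= c.
  by have [c c0 Hc] := periodic_bounded (@cphi q.1 q.2) (@pphi q.1 q.2); exists c.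
have [c Hc] := choice H.
have c0 q : 0 <= c q by have [/ltW] := Hc q.
exists (1 + \sum_q c q); first by rewrite ltr_wpDr// sumr_ge0.
move=> l b x; apply: (le_trans ((Hc (l, b)).2 x)).
by rewrite (bigD1 (l, b))//= ler_wpDl// lerDl sumr_ge0.
Qed.

Lemma test_unif_continuous (q : R) : 0 < q -> exists2 r : R, 0 < r &
  forall l b z z', `|z - z'| <= r -> `|phi l b z - phi l b z'| <= q.
Proof.
move=> q0.
have H (i : 'I_d * bool) : exists2 r : R, 0 < r & forall h, 0 < h < r ->
   forall z z', `|z - z'| <= h -> `|phi i.1 i.2 z - phi i.1 i.2 z'| <= q.
  have [r r0 Hr] := periodic_unif_continuous (@cphi i.1 i.2) (@pphi i.1 i.2) q0.
  by exists r => // h /andP[_ hr] z z' zz'; apply/ltW/Hr; exact: le_lt_trans zz' hr.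
have [r r0 Hr] := common_radius (index_enum ('I_d * bool)%type) H.
exists (r / 2); first by rewrite divr_gt0.
move=> l b z z'; apply: (Hr (l, b)); first exact: mem_index_enum.
by apply/andP; split; lra.
Qed.

Section riemann_limit.
Variables (K c T : R).
Hypothesis rhoK : forall x t, 0 <= t -> `|rho x t| <= K.
Hypothesis phic : forall l b x, `|phi l b x| <= c.
Hypotheses (K0 : 0 <= K) (c0 : 0 <= c) (T0 : 0 <= T).

(** The deterministic path fed to Gronwall: its derivative is exactly [mean_int]. It differs from
    the limit by a Riemann sum and by half a bond in the argument of the test function. *)
Definition lattice_limit M t : R :=
  eps R M ^+ d * \sum_(i : dbond d M) bond_weight i * Rint rho (pos R (tail i)) t.

Lemma phiRint_continuous l b t : 0 <= t -> continuous (fun x => phi l b x * Rint rho x t).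
Proof.
move=> t0 x; have FF : Filter (nbhs x) by exact: nbhs_filter.
apply: (@cvgM R _ (nbhs x) FF (phi l b) (fun x => Rint rho x t)); first exact: (cphi (x := x)).
exact: (Rint_continuous crho0 prho0 hrho rhoK t0 (x := x)).
Qed.

Lemma lattice_limit_cvg (g : R) : 0 < g -> exists2 r : R, 0 < r &
  forall M, eps R M < r -> forall t, 0 <= t <= T ->
  `|lattice_limit M t - collision_limit rho t phi| <= g.
Proof.
move=> g0.
(* For each of the [2 * d] components, the half-bond shift costs [q * K^2 * T] and the Riemann sum
   costs [d] times the modulus [G] of the integrand. *)
pose B := (2 * d)%:R * ((d.+1)%:R * (K ^+ 2 * T) + d%:R * (c * (2 * K * T))) + 1.
have B0 : 0 < B.
  rewrite /B ltr_wpDl// mulr_ge0// addr_ge0// !mulr_ge0// ?sqr_ge0//.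
have q0 : 0 < g / B by rewrite divr_gt0.
set q := g / B in q0.
have [r1 r10 H1] := test_unif_continuous q0.
have [r2 r20 H2] := heat_unif_continuous crho0 prho0 hrho q0.
exists (Num.min r1 r2); first by rewrite lt_min r10.
move=> M; rewrite lt_min => /andP[er1 er2] t /andP[t0 tT].
have e0 := eps_gt0 R M; set e := eps R M in e0 er1 er2.
have RK x : `|Rint rho x t| <= K ^+ 2 * T.
  rewrite ger0_norm ?(Rint_ge0 hrho rhoK)//.
  by apply: (le_trans (Rint_le hrho rhoK x t0)); rewrite ler_wpM2l ?sqr_ge0.
have Rmod z z' : `|z - z'| <= e -> `|Rint rho z t - Rint rho z' t| <= 2 * K * T * q.
  move=> zz'; apply: (le_trans (Rint_modulus hrho rhoK t0 (q := q) _)).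
    by move=> s s0; apply: H2 => //; exact: le_trans zz' (ltW er2).
  by rewrite mulrAC ler_wpM2r ?(ltW q0)// ler_wpM2l ?mulr_ge0.
pose G := K ^+ 2 * T * q + c * (2 * K * T * q).
have gmod l b z z' : `|z - z'| <= e ->
    `|phi l b z * Rint rho z t - phi l b z' * Rint rho z' t| <= G.
  move=> zz'.
  have -> : phi l b z * Rint rho z t - phi l b z' * Rint rho z' t =
    Rint rho z t * (phi l b z - phi l b z') + phi l b z' * (Rint rho z t - Rint rho z' t) by ring.
  apply: (le_trans (ler_normD _ _)); rewrite !normrM /G lerD// ler_pM//.
    by apply: H1; exact: le_trans zz' (ltW er1).
  exact: Rmod.
have per l b : `|e ^+ d * \sum_(x : site d M) bond_weight (x, l, b) * Rint rho (pos R x) t -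
    torint (fun x => phi l b x * Rint rho x t)| <= q * (K ^+ 2 * T) + G * d%:R.
  have h1 := torint_riemann (phiRint_continuous (l := l) (b := b) t0) (@gmod l b).
  rewrite -(subrKA (e ^+ d * \sum_(a : site d M) phi l b (pos R a) * Rint rho (pos R a) t)).
  apply: (le_trans (ler_normD _ _)); rewrite lerD//; last by rewrite distrC.
  rewrite -mulrBr -sumrB normrM (ger0_norm (exprn_ge0 _ (ltW e0))).
  apply: (@le_trans _ _ (e ^+ d * \sum_(x : site d M) (q * (K ^+ 2 * T)))); last first.
    by rewrite sumr_const -(mulr_natl (q * _)) mulrA (mulrC (e ^+ d)) card_site mul1r.
  rewrite ler_wpM2l ?(exprn_ge0 _ (ltW e0))//; apply: (le_trans (ler_norm_sum _ _ _)).
  apply: ler_sum => x _; rewrite -mulrBl normrM ler_pM//.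
  apply: H1; rewrite /tail /= addrAC subrr add0r normrZ norm_unitv mulr1.
  have sgn (b' : bool) : `|(if b' then 1 else -1) * e / 2| = e / 2.
    by case: b'; rewrite ?mul1r ?mulN1r ?mulNr ?normrN ger0_norm//; lra.
  by rewrite sgn; lra.
have E : lattice_limit M t = \sum_(l < d) \sum_(b : bool)
    (e ^+ d * \sum_(x : site d M) bond_weight (x, l, b) * Rint rho (pos R x) t).
  rewrite /lattice_limit -/e.
  under [in RHS]eq_bigr do rewrite -mulr_sumr.
  rewrite -mulr_sumr; congr (_ * _).
  rewrite -(pair_bigA _ (fun u (b : bool) => bond_weight (u, b) * Rint rho (pos R (tail (u, b))) t))/=.
  rewrite -(pair_bigA _ (fun x (l : 'I_d) => \sum_(b : bool) bond_weight (x, l, b) *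
     Rint rho (pos R (tail (x, l, b))) t))/=.
  by rewrite exchange_big/=; apply: eq_bigr => l _; rewrite exchange_big.
rewrite E /collision_limit -sumrB.
apply: (le_trans (ler_norm_sum _ _ _)).
apply: (@le_trans _ _ (\sum_(l < d) \sum_(b : bool) (q * (K ^+ 2 * T) + G * d%:R))).
  apply: ler_sum => l _; rewrite -sumrB; apply: (le_trans (ler_norm_sum _ _ _)).
  by apply: ler_sum => b _; exact: per.
rewrite pair_bigA/= sumr_const card_prod card_ord card_bool mulnC -(mulr_natl (_ + _)).
apply: (@le_trans _ _ (q * B)); last by rewrite /q divfK ?lt0r_neq0.
rewrite (_ : _ * _ = q * B - q); first by rewrite lerBlDr lerDl ltW.
by rewrite /B /G -[d.+1%:R]natr1; ring.
Qed.

End riemann_limit.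

End law_of_large_numbers.

(** [r] is fixed before the process and bounds two small parameters: [eps] governs the Riemann sums
    and the local equilibrium, [(eps^d * n^2)^-1] the size of the jumps and the bonds sharing a
    site. *)
Lemma collision_lln (R : realType) (d : nat) (rho0 : 'rV[R]_d -> R)
    (rho : 'rV[R]_d -> R -> R) (phi : testfn R d) (T delta beta : R) :
  continuous rho0 -> torus_periodic rho0 -> heat_sol rho0 rho ->
  (forall l b, continuous (phi l b)) -> (forall l b, torus_periodic (phi l b)) ->
  (forall l b x, 0 <= phi l b x) -> 0 <= T -> 0 < delta -> 0 < beta ->
  exists2 r : R, 0 < r &
  forall (n M : nat) (dO : measure_display) (Omega : measurableType dO)
    (P : probability Omega R) (X : R -> Omega -> state d M),
  is_markov (@exclusion_jumps R d M) P X (init_law rho0 n) ->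
  (0 < n)%N -> eps R M < r -> (eps R M ^+ d * n%:R ^+ 2)^-1 < r ->
  forall t, 0 <= t <= T ->
  (P [set w | (delta < `|collision_number n (fun t => X t w) t phi -
                         collision_limit rho t phi|)%R] <= beta%:E)%E.
Proof.
move=> crho0 prho0 hrho cphi pphi phi_ge0 T0 delta0 beta0.
have [K Kp rhoK] := heat_bounded crho0 prho0 hrho; have K0 := ltW Kp.
have [c cp phic] := test_bounded cphi pphi; have c0 := ltW cp.
have [r1 r10 H1] := lattice_limit_cvg crho0 prho0 hrho cphi pphi rhoK phic K0 c0 T0 (divr_gt0 delta0 (ltr0n _ 2)).
pose D : R := (2 * d)%:R; have D0 : 0 <= D by rewrite ler0n.
(* Gronwall's factor times Chebyshev's inequality at [delta / 2]. Below, [A1] and [B2] collect the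
   parts of [B1 * V] controlled by [s0] and by [sc1]; each part is kept below [beta / 2]. *)
pose B1 := expR T * 4 / delta ^+ 2.
have B10 : 0 < B1 by rewrite divr_gt0 ?exprn_gt0// mulr_gt0 ?expR_gt0.
pose A1 := B1 * (4 * (D * c * K ^+ 2) + 1) + 1.
have DcK0 : 0 <= D * c * K ^+ 2 by rewrite mulr_ge0 ?sqr_ge0// mulr_ge0.
have A10 : 0 < A1 by rewrite ltr_wpDl// mulr_ge0 ?(ltW B10)//; lra.
pose s0 := Num.min 1 (beta / 2 / A1).
have s00 : 0 < s0 by rewrite lt_min ltr01/= !divr_gt0.
pose q := s0 / (D * c + 1).
have Dc0 : 0 < D * c + 1 by rewrite ltr_wpDl// mulr_ge0.
have q0 : 0 < q by rewrite divr_gt0.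
(* Replacing densities by [nu * rho] costs [2 * (K + 1) * eta], and moving [rho] from the head of a
   bond to its tail costs [K * eta]. *)
pose eta := Num.min 1 (q / (3 * K + 3)).
have K3 : 0 < 3 * K + 3 by lra.
have eta0 : 0 < eta by rewrite lt_min ltr01 divr_gt0.
have eta1 : eta <= 1 by rewrite ge_min lexx.
have etaq : eta * (3 * K + 3) <= q by rewrite -ler_pdivlMr// ge_min lexx orbT.
have [r2 r20 H2] := local_equilibrium crho0 prho0 hrho T0 eta0.
have [r3 r30 H3] := heat_unif_continuous crho0 prho0 hrho eta0.
pose B2 := B1 * (c ^+ 2 * (K + 1) ^+ 2 * (8 * d)%:R * D + c * D * (D * c * K ^+ 2 + 1)) + 1.
have B20 : 0 < B2.
  rewrite ltr_wpDl// mulr_ge0 ?(ltW B10)//; apply: addr_ge0.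
    by do 3 apply: mulr_ge0 => //; exact: sqr_ge0.
  by apply: mulr_ge0; [exact: mulr_ge0|lra].
have r40 : 0 < beta / 2 / B2 by rewrite !divr_gt0.
exists (Num.min (Num.min r1 r2) (Num.min r3 (Num.min (1/4) (beta / 2 / B2)))).
  by rewrite !lt_min r10 r20 r30 r40 /= andbT; lra.
move=> n M dO Omega P X XP n0.
rewrite !lt_min => /and4P[/andP[er1 er2] er3 e4 _] /and4P[_ _ _ scr] t tT.
have /andP[t0 tT'] := tT.
have e0 := eps_gt0 R M; set e := eps R M in e0 er1 er2 er3 e4 scr.
have M2 : (2 <= M)%N.
  rewrite leqNgt; apply/negP; rewrite ltnS => M1.
  have : M.+1%:R <= 2 :> R by rewrite ler_nat.
  by have := epsM R M; rewrite -/e; clear -e0 e4; nra.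
have [Hd Hp] := H2 n M dO Omega P X XP er2.
set nu := massn R d n M in Hd Hp.
have nu0 : 0 <= nu by rewrite mulr_ge0// exprn_ge0// ltW.
pose Phi := @bond_weight R d phi M.
have Phi0 (i : dbond d M) : 0 <= Phi i by exact: phi_ge0.
have Phic (i : dbond d M) : Phi i <= c by exact: le_trans (ler_norm _) (phic _ _ _).
pose rr u (x : site d M) := rho (pos R x) u.
pose y u := mean_int Phi (rr u).
pose a u := lattice_limit rho phi M u.
have rhoper u : torus_periodic (fun x => rho x u) by case: hrho => [_ [pr _]] x i; exact: pr.
have rnbr u (i : dbond d M) : 0 <= u -> `|rr u (tail i) - rr u (head i)| <= eta.
  move=> u0; rewrite /rr /head (periodic_nbr _ _ _ (rhoper u)); apply: H3 => //.
  rewrite opprD addrA subrr add0r normrN normrZ norm_unitv mulr1 normrM.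
  have -> : `|sgnb R i.2| = 1 by rewrite /sgnb; case: i.2; rewrite ?normrN normr1.
  by rewrite mul1r gtr0_norm// ltW.
have densK u (x : site d M) : 0 <= u <= T -> `|dens n rho0 x u| <= nu * (K + 1).
  move=> uT; have /andP[u0 _] := uT.
  have : `|nu * rho (pos R x) u| <= nu * K by rewrite normrM ger0_norm// ler_wpM2l// rhoK.
  have : nu * eta <= nu * 1 by rewrite ler_wpM2l.
  by have := Hd x u uT; rewrite !ler_norml; clear; lra.
have rsq u (i : dbond d M) : 0 <= u -> `|rr u (tail i) ^+ 2 - rr u (tail i) * rr u (head i)| <= K * eta.
  move=> u0; rewrite expr2 -mulrBr normrM ler_pM// ?rnbr//; exact: rhoK.
have bd u (i : dbond d M) : 0 <= u <= T -> bdens n rho0 i u <= nu ^+ 2 * (rr u (tail i) ^+ 2 + q).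
  move=> uT; have /andP[u0 _] := uT.
  have rK : `|nu * rr u (head i)| <= nu * (K + 1).
    by rewrite normrM ger0_norm// ler_wpM2l//; have := rhoK (pos R (head i)) u u0; rewrite /rr; clear; lra.
  have := prodB_le (densK u (tail i) uT) rK (Hd (tail i) u uT) (Hd (head i) u uT).
  have -> : 2 * (nu * (K + 1)) * (nu * eta) = nu ^+ 2 * (2 * (K + 1) * eta) by ring.
  have -> : nu * rho (pos R (tail i)) u * (nu * rr u (head i)) =
     nu ^+ 2 * (rr u (tail i) * rr u (head i)) by rewrite /rr; ring.
  rewrite -/(bdens n rho0 i u) ler_norml => /andP[_].
  have : nu ^+ 2 * (rr u (tail i) * rr u (head i) + 2 * (K + 1) * eta) <=
     nu ^+ 2 * (rr u (tail i) ^+ 2 + q).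
    rewrite ler_wpM2l ?sqr_ge0//; have := rsq u i u0; rewrite ler_norml => /andP[].
    have := etaq; have := ltW eta0; move: (rr u _ ^+ 2) (rr u _ * rr u _) => Z W; clear; lra.
  by rewrite mulrDr; clear; lra.
have pc u (i : dbond d M) : 0 <= u <= T ->
    nu ^+ 2 * (rr u (tail i) ^+ 2 - q) <= pcorr n rho0 (tail i) (head i) u.
  move=> uT; have /andP[u0 _] := uT.
  apply: le_trans (Hp (tail i) (head i) u (tail_neq_head M2 i) uT).
  rewrite ler_wpM2l ?sqr_ge0//; have := rsq u i u0; rewrite ler_norml => /andP[].
  rewrite -/(rr u (tail i)) -/(rr u (head i)).
  have := etaq; have := ltW eta0; have := mulr_ge0 K0 (ltW eta0).
  move: (rr u _ ^+ 2) (rr u _ * rr u _) => Z W; clear; lra.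
have rK u (x : site d M) : 0 <= u -> `|rr u x| <= K by move=> u0; exact: rhoK.
pose s1 := sc1 R d M n.
have sc10 : 0 <= s1 by exact: sc1_ge0.
pose ss := D * c * q.
have ss0 : 0 <= ss by rewrite mulr_ge0 ?(ltW q0)// mulr_ge0.
have ss1 : ss <= s0.
  by rewrite /ss /q mulrA ler_pdivrMr// mulrC ler_wpM2l ?(ltW s00)// lerDl.
pose V := 4 * (D * c * K ^+ 2) * ss + ss ^+ 2 + s1 * (c ^+ 2 * (K + 1) ^+ 2 * (8 * d)%:R * D)
  + s1 * (c * D) * (D * c * K ^+ 2 + 1).
have s01 : s0 <= 1 by rewrite ge_min lexx.
have HV u : 0 <= u <= T -> Ex n rho0 u (fun st => (cint n Phi st - y u) ^+ 2) +
    qrate d M n c * Ex n rho0 u (cint n Phi) <= V.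
  move=> uT; have /andP[u0 _] := uT.
  have dK (x : site d M) : dens n rho0 x u <= nu * (K + 1) by exact: le_trans (ler_norm _) (densK u x uT).
  have h1 := cint_variance XP M2 n0 Phi0 Phic c0 u0 (ltW q0) (fun x => dK x)
    (fun i => bd u i uT) (fun i => pc u i uT).
  have h2 := Ex_cint_ub XP M2 n0 Phi0 Phic u0 (ltW q0) (fun i => bd u i uT).
  have h3 := @mean_int_le R d M Phi c Phi0 Phic (rr u) K K0 (fun x => rK u x u0).
  have h4 : qrate d M n c <= s1 * (c * D).
    rewrite /qrate ler_wpM2r ?mulr_ge0// /sc /s1 /sc1 -[leRHS]mul1r ler_wpM2r ?sc1_ge0//.
    by rewrite expr_le1 ?(ltW e0)//; apply: ltW; apply: lt_trans e4 _; clear; lra.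
  have h5 : qrate d M n c * Ex n rho0 u (cint n Phi) <= s1 * (c * D) * (D * c * K ^+ 2 + 1).
    apply: ler_pM => //; first by rewrite mulr_ge0 ?sc_ge0// mulr_ge0.
      apply: (Ex_ge0 XP) => // [|st]; first exact: dominated_cint.
      rewrite mulr_ge0 ?sc1_ge0// sumr_ge0// => i _.
      by rewrite mulr_ge0 ?occ_ge0.
    apply: (le_trans h2); rewrite lerD//; exact: le_trans ss1 s01.
  have h6 : 4 * mean_int Phi (rr u) * ss <= 4 * (D * c * K ^+ 2) * ss.
    by rewrite ler_wpM2r// ler_wpM2l.
  by rewrite /V /y; move: h1; rewrite -/D -/ss -/s1; move: h5 h6; clear; lra.
have ca : {within `[0, T], continuous a}.
  rewrite /a /lattice_limit => u; apply: cvgMl_tmp.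
  apply: (cvg_big add_continuous) => i _; apply: cvgMl_tmp.
  exact: (Rint_within_continuous hrho rhoK).
have a0 : a 0 = 0.
  by rewrite /a /lattice_limit big1 ?mulr0// => i _; rewrite Rint0 mulr0.
have Da u : 0 < u < T -> is_derive u 1 a (y u).
  move=> /andP[u0 _].
  have DS : is_derive u 1 (fun u => \sum_(i : dbond d M) Phi i * Rint rho (pos R (tail i)) u)
     (\sum_(i : dbond d M) Phi i * rr u (tail i) ^+ 2).
    apply: is_derive_bigsum => i.
    exact: (@is_deriveZ _ _ _ _ (Phi i) u 1 _ (is_derive_Rint hrho (pos R (tail i)) u0)).
  exact: (@is_deriveZ _ _ _ _ (eps R M ^+ d) u 1 _ DS).
have dC (a1 : R) : dominated (@njumps d M) (fun st => (coll n Phi st - a1) ^+ 2).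
  rewrite (_ : (fun st => _) = (fun st => (1 * coll n Phi st + - a1) * (1 * coll n Phi st + - a1))).
    by apply: dominatedM; apply: dominatedD; [exact: dominated_coll|exact: dominated_cst|
      exact: dominated_coll|exact: dominated_cst].
  by apply/funext => st; rewrite mul1r expr2.
have fl := fluct_gronwall XP M2 Phi0 Phic ca a0 Da HV tT.
have flT : fluct n rho0 Phi (a t) t <= expR T * V.
  apply: (le_trans fl).
  have V0 : 0 <= V.
    rewrite /V; apply: addr_ge0; first apply: addr_ge0; first apply: addr_ge0.
    - by rewrite mulr_ge0// mulr_ge0.
    - exact: sqr_ge0.
    - apply: mulr_ge0 => //; do 2 apply: mulr_ge0 => //.
      by rewrite mulr_ge0 ?sqr_ge0.
    - by apply: mulr_ge0; [rewrite mulr_ge0// mulr_ge0|clear -DcK0; lra].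
  have : expR t * V <= expR T * V by rewrite ler_wpM2r// ler_expR.
  by clear -V0; lra.
have dC' : dominated (@njumps d M) (fun st => (2 / delta) ^+ 2 * (coll n Phi st - a t) ^+ 2).
  rewrite (_ : (fun st => _) = (fun st => (2 / delta) ^+ 2 * (coll n Phi st - a t) ^+ 2 + 0)).
    by apply: dominatedD; [exact: (dC (a t))|exact: dominated_cst].
  by apply/funext => st; rewrite addr0.
have e2 : 0 < 2 / delta by rewrite divr_gt0.
(* Chebyshev at [delta / 2]; the other half of [delta] covers the distance between [a t] and the
   limit. *)
apply: (@le_trans _ _ (Ex n rho0 t (fun st => (2 / delta) ^+ 2 * (coll n Phi st - a t) ^+ 2))%:E).
  rewrite (_ : [set w | _] = [set w |
     [set st | delta < `|coll n Phi st - collision_limit rho t phi|] (X t w)]); last first.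
    by apply/seteqP; split => w /=; rewrite collision_numberE.
  apply: (prob_le_Ex XP t0 dC') => [st|st /= st_far]; first by rewrite mulr_ge0 ?sqr_ge0.
  rewrite -exprMn -real_normK ?num_real// exprn_ege1// normrM gtr0_norm//.
  rewrite -ler_pdivrMl// mulr1 invf_div.
  have := H1 M er1 t tT; rewrite -/(a t) distrC => h1.
  have := ler_distD (a t) (coll n Phi st) (collision_limit rho t phi).
  by rewrite (distrC (a t)); clear -h1 st_far; lra.
rewrite lee_fin ExZ; last exact: (dC (a t)).
rewrite -/(fluct n rho0 Phi (a t) t).
apply: (@le_trans _ _ (B1 * V)).
  apply: (le_trans (ler_wpM2l (sqr_ge0 _) flT)).
  rewrite le_eqVlt; apply/orP; left; apply/eqP; rewrite /B1; field.
  by rewrite lt0r_neq0.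
have s0A : s0 * A1 <= beta / 2 by rewrite -ler_pdivlMr// ge_min lexx orbT.
have scB : s1 * B2 <= beta / 2 by rewrite -ler_pdivlMr//; exact: ltW.
have ss2 : ss ^+ 2 <= ss by rewrite expr2 ler_piMl//; exact: le_trans ss1 s01.
have g1 : B1 * (4 * (D * c * K ^+ 2) * ss + ss ^+ 2) <= ss * (B1 * (4 * (D * c * K ^+ 2) + 1)).
  rewrite [leRHS]mulrCA ler_wpM2l ?(ltW B10)//; clear -ss2; lra.
have g2 : ss * (B1 * (4 * (D * c * K ^+ 2) + 1)) <= s0 * (B1 * (4 * (D * c * K ^+ 2) + 1)).
  by rewrite ler_wpM2r// mulr_ge0 ?(ltW B10)//; clear -DcK0; lra.
have g3 : B1 * V = B1 * (4 * (D * c * K ^+ 2) * ss + ss ^+ 2) + (s1 * B2 - s1).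
  by rewrite /V /B2; ring.
have g4 : s0 * (B1 * (4 * (D * c * K ^+ 2) + 1)) = s0 * A1 - s0 by rewrite /A1; ring.
by rewrite g3; move: g1 g2; rewrite g4; clear -s0A scB sc10 s00; lra.
Qed.

(** * Positive functionals and the limit path *)

Section positive_functionals.
Variables (R : realType) (d : nat).
Implicit Types (phi psi : testfn R d) (xi : testfn R d -> R).

(** Continuity in place of smoothness: the collision number and its limit are positive functionals,
    hence of order zero, and sup-norm estimates control them. *)
Definition periodic_test phi :=
  (forall l b, continuous (phi l b)) /\ (forall l b, torus_periodic (phi l b)).

Definition cst_test (c : R) : testfn R d := fun _ _ _ => c.

Definition lin_test (a : R) phi psi : testfn R d := fun l b x => a * phi l b x + psi l b x.

(** Such a functional is bounded in the sup norm by its value at the constant 1. This gives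
    membership in the dual and reduces approximation of test functions to control of the total
    mass. *)
Definition positive_linear xi :=
  (forall a phi psi, periodic_test phi -> periodic_test psi ->
     xi (lin_test a phi psi) = a * xi phi + xi psi) /\
  (forall phi psi, periodic_test phi -> periodic_test psi ->
     (forall l b x, phi l b x <= psi l b x) -> xi phi <= xi psi).

Lemma periodic_cst_test (c : R) : periodic_test (cst_test c).
Proof. by split=> [l b|l b x i //]; exact: cst_continuous. Qed.

Lemma periodic_lin_test a phi psi : periodic_test phi -> periodic_test psi ->
  periodic_test (lin_test a phi psi).
Proof.
move=> [cphi pphi] [cpsi ppsi]; split=> l b x; last by move=> i; rewrite /lin_test pphi ppsi.
have FF : Filter (nbhs x) by exact: nbhs_filter.
by apply: (@cvgD _ _ _ _ FF); [apply: cvgMl_tmp; exact: cphi|exact: cpsi].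
Qed.

Lemma periodic_is_test phi : is_test phi -> periodic_test phi.
Proof.
move=> H; split=> l b; last by have [] := H l b.
by have [_ /(_ [::])[]] := H l b.
Qed.

Lemma positive_linear_cst xi c : positive_linear xi -> xi (cst_test c) = c * xi (cst_test 1).
Proof.
move=> [lin _].
have z : xi (cst_test 0) = 0.
  have := lin (-1) (cst_test 0) (cst_test 0) (periodic_cst_test 0) (periodic_cst_test 0).
  rewrite (_ : lin_test _ _ _ = cst_test 0) ?mulN1r ?addNr//.
  by apply/funext => l; apply/funext => b; apply/funext => x; rewrite /lin_test mulr0 addr0.
rewrite (_ : cst_test c = lin_test c (cst_test 1) (cst_test 0)).
  by rewrite lin ?z ?addr0//; exact: periodic_cst_test.
by apply/funext => l; apply/funext => b; apply/funext => x; rewrite /lin_test mulr1 addr0.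
Qed.

Lemma positive_linear_dist xi phi psi c : positive_linear xi ->
  periodic_test phi -> periodic_test psi -> (forall l b x, `|phi l b x - psi l b x| <= c) ->
  `|xi phi - xi psi| <= c * xi (cst_test 1).
Proof.
move=> pl pphi ppsi H; have [lin mon] := pl.
have one phi1 psi1 : periodic_test phi1 -> periodic_test psi1 ->
    (forall l b x, phi1 l b x - psi1 l b x <= c) -> xi phi1 - xi psi1 <= c * xi (cst_test 1).
  move=> p1 p2 le12; rewrite lerBlDr -lin//; last exact: periodic_cst_test.
  apply: mon => //; first by apply: periodic_lin_test => //; exact: periodic_cst_test.
  by move=> l b x; rewrite /lin_test mulr1 -lerBlDr.
rewrite ler_norml lerNl opprB !one// => l b x.
  exact: le_trans (ler_norm _) (H l b x).
by apply: le_trans (H l b x); rewrite distrC ler_norm.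
Qed.

Lemma positive_linear_norm xi phi c : positive_linear xi ->
  periodic_test phi -> (forall l b x, `|phi l b x| <= c) -> `|xi phi| <= c * xi (cst_test 1).
Proof.
move=> pl pphi H; have h := positive_linear_cst 0 pl; rewrite mul0r in h.
rewrite -[xi phi]subr0 -[X in _ - X]h; apply: positive_linear_dist => //.
  exact: periodic_cst_test.
by move=> l b x; rewrite /cst_test subr0.
Qed.

Lemma positive_linear1_ge0 xi : positive_linear xi -> 0 <= xi (cst_test 1).
Proof.
move=> pl; have h := positive_linear_cst 0 pl; rewrite mul0r in h; rewrite -[leLHS]h.
by apply: pl.2 => [||l b x]; [exact: periodic_cst_test|exact: periodic_cst_test|exact: ler01].
Qed.

Lemma positive_linear_in_dual xi : positive_linear xi -> in_dual xi.
Proof.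
move=> pl; split.
  by move=> a phi psi tphi tpsi; apply: pl.1; exact: periodic_is_test.
exists 1%N, (fun=> [::]), (xi (cst_test 1)) => phi tphi.
have pphi := periodic_is_test tphi.
rewrite big_ord1 mulrC; apply: positive_linear_norm => // l b x.
have [c _ phic] := test_bounded pphi.1 pphi.2.
apply: (@ub_le_sup R); last by exists l, b, x.
by exists c => _ [l' [b' [x' ->]]]; exact: phic.
Qed.

Lemma positive_linear_collision_number M n (Xw : R -> state d M) t :
  positive_linear (collision_number n Xw t).
Proof.
split=> [a phi psi _ _|phi psi _ _ le12]; rewrite /collision_number.
  rewrite [a * _]mulrCA -mulrDr; congr (_ * _).
  rewrite mulr_sumr -big_split; apply: eq_bigr => x _ /=.
  rewrite mulr_sumr -big_split; apply: eq_bigr => l _ /=.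
  rewrite mulr_sumr -big_split; apply: eq_bigr => b _ /=.
  by rewrite /lin_test mulrDr mulrCA.
have e0 := ltW (eps_gt0 R M).
rewrite ler_wpM2l ?divr_ge0 ?mulr_ge0 ?exprn_ge0//.
do 3 (apply: ler_sum => ? _).
by rewrite ler_wpM2l.
Qed.

End positive_functionals.

Section limit_path.
Variables (R : realType) (d : nat) (rho0 : 'rV[R]_d -> R) (rho : 'rV[R]_d -> R -> R).
Hypotheses (crho0 : continuous rho0) (prho0 : torus_periodic rho0).
Hypothesis hrho : heat_sol rho0 rho.
Variable K : R.
Hypothesis rhoK : forall x t, 0 <= t -> `|rho x t| <= K.
Implicit Types (phi psi : testfn R d) (s t : R).

Let cR phi l b t : periodic_test phi -> 0 <= t -> continuous (fun x => phi l b x * Rint rho x t).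
Proof. by move=> [cphi _] t0; exact: (phiRint_continuous crho0 prho0 hrho cphi rhoK). Qed.

Lemma positive_linear_collision_limit t : 0 <= t -> positive_linear (collision_limit rho t).
Proof.
move=> t0; split=> [a phi psi pphi ppsi|phi psi pphi ppsi le12]; rewrite /collision_limit.
  rewrite mulr_sumr -big_split; apply: eq_bigr => l _ /=.
  rewrite mulr_sumr -big_split; apply: eq_bigr => b _ /=.
  rewrite -torint_lin; [|exact: cR|exact: cR].
  by congr torint; apply/funext => x; rewrite /lin_test mulrDl mulrA.
apply: ler_sum => l _; apply: ler_sum => b _; apply: torint_le; [exact: cR|exact: cR|].
by move=> x; rewrite ler_wpM2r// (Rint_ge0 hrho rhoK).
Qed.

Lemma collision_limitB phi s t : periodic_test phi -> 0 <= s -> 0 <= t ->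
  collision_limit rho t phi - collision_limit rho s phi =
  \sum_(l < d) \sum_(b : bool) torint (fun x => phi l b x * (Rint rho x t - Rint rho x s)).
Proof.
move=> pphi s0 t0; rewrite /collision_limit -sumrB; apply: eq_bigr => l _.
rewrite -sumrB; apply: eq_bigr => b _; rewrite -torintB; [|exact: cR|exact: cR].
by congr torint; apply/funext => x; rewrite mulrBr.
Qed.

Let cRB phi l b s t : periodic_test phi -> 0 <= s -> 0 <= t ->
  continuous (fun x => phi l b x * (Rint rho x t - Rint rho x s)).
Proof.
move=> pphi s0 t0.
have -> : (fun x => phi l b x * (Rint rho x t - Rint rho x s)) =
  (fun x => phi l b x * Rint rho x t - phi l b x * Rint rho x s).
  by apply/funext => x; rewrite mulrBr.
move=> x; have FF : Filter (nbhs x) by exact: nbhs_filter.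
by apply: (@cvgB _ _ _ _ FF); exact: cR.
Qed.

Lemma collision_limit_lip phi c s t : periodic_test phi -> (forall l b x, `|phi l b x| <= c) ->
  0 <= s <= t ->
  `|collision_limit rho t phi - collision_limit rho s phi| <= (2 * d)%:R * (c * (K ^+ 2 * (t - s))).
Proof.
move=> pphi phic st; have /andP[s0 st'] := st; have t0 := le_trans s0 st'.
rewrite collision_limitB//; apply: (le_trans (ler_norm_sum _ _ _)).
apply: (@le_trans _ _ (\sum_(l < d) \sum_(b : bool) c * (K ^+ 2 * (t - s)))).
  apply: ler_sum => l _; apply: (le_trans (ler_norm_sum _ _ _)); apply: ler_sum => b _.
  apply: torint_norm_le; first exact: cRB.
  move=> x; rewrite normrM ler_pM//.
  have /andP[h0 h1] := Rint_incr hrho rhoK x st.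
  by rewrite ger0_norm.
by rewrite pair_bigA/= sumr_const card_prod card_ord card_bool mulnC -(mulr_natl (c * _)).
Qed.

Lemma collision_limit_mono phi s t : periodic_test phi -> (forall l b x, 0 <= phi l b x) ->
  0 <= s <= t -> collision_limit rho s phi <= collision_limit rho t phi.
Proof.
move=> pphi phi0 st; have /andP[s0 st'] := st; have t0 := le_trans s0 st'.
rewrite -subr_ge0 collision_limitB//; apply: sumr_ge0 => l _; apply: sumr_ge0 => b _.
rewrite -(@torint_cst R d 0); apply: torint_le; [exact: cst_continuous|exact: cRB|].
move=> x; rewrite mulr_ge0//.
by have /andP[] := Rint_incr hrho rhoK x st.
Qed.

Lemma in_D_collision_limit T : in_D T (collision_limit rho).
Proof.
have main t B e : 0 <= t -> bounded_set B -> 0 < e -> exists delta, 0 < delta /\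
    forall u, `|t - u| < delta -> 0 <= u -> forall phi, B phi ->
    `|collision_limit rho u phi - collision_limit rho t phi| <= e.
  move=> t0 [Btest /(_ [::])[c Hc]] e0.
  pose A := (2 * d)%:R * (`|c| * K ^+ 2) + 1.
  have A0 : 0 < A by rewrite ltr_wpDl//; apply: mulr_ge0 => //; apply: mulr_ge0 => //; exact: sqr_ge0.
  exists (e / A); split; first by rewrite divr_gt0.
  move=> u ut u0 phi Bphi.
  have phic l b x : `|phi l b x| <= `|c| by apply: le_trans (Hc phi Bphi l b x) (ler_norm _).
  have pphi := periodic_is_test (Btest phi Bphi).
  suff h : `|collision_limit rho u phi - collision_limit rho t phi| <=
      (2 * d)%:R * (`|c| * (K ^+ 2 * `|t - u|)).
    apply: (le_trans h); apply: (@le_trans _ _ (A * `|t - u|)).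
      by rewrite /A mulrDl mul1r !mulrA lerDl.
    by rewrite mulrC -ler_pdivlMr// ltW.
  have [tu|/ltW tu] := leP t u.
    by rewrite (distrC t) (ger0_norm (_ : 0 <= u - t)) ?subr_ge0//; apply: collision_limit_lip; rewrite ?t0.
  by rewrite (ger0_norm (_ : 0 <= t - u)) ?subr_ge0// distrC; apply: collision_limit_lip; rewrite ?u0.
split; last split.
- by move=> t /andP[t0 _]; apply: positive_linear_in_dual; exact: positive_linear_collision_limit.
- move=> t /andP[t0 tT] B hB e e0; have [r [r0 Hr]] := main t B e t0 hB e0.
  exists r; split=> // u /andP[tu ut] uT phi Bphi; apply: Hr => //; last exact: le_trans tu.
  by rewrite distrC ger0_norm ?subr_ge0// ltrBlDl.
- move=> t /andP[/ltW t0 tT]; exists (collision_limit rho t); split.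
    by apply: positive_linear_in_dual; exact: positive_linear_collision_limit.
  move=> B hB e e0; have [r [r0 Hr]] := main t B e t0 hB e0.
  exists r; split=> // u /andP[tu ut] u0 phi Bphi; apply: Hr => //.
  by rewrite ger0_norm ?subr_ge0 1?ltW//; lra.
Qed.

End limit_path.

Lemma in_D_collision_number (R : realType) (d M n : nat) (T : R) (Xw : R -> state d M) :
  (forall t, 0 <= t -> exists delta, 0 < delta /\
      forall u, t <= u -> u < t + delta -> Xw u = Xw t) ->
  (forall t, 0 < t -> exists delta s, 0 < delta /\
      forall u, t - delta < u -> u < t -> Xw u = s) ->
  in_D T (collision_number n Xw).
Proof.
move=> rc ll; split; last split.
- by move=> t _; apply: positive_linear_in_dual; exact: positive_linear_collision_number.
- move=> t /andP[t0 _] B _ e e0; have [r [r0 Hr]] := rc t t0.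
  exists r; split=> // u /andP[tu ut] _ phi _.
  by rewrite /collision_number Hr// subrr normr0 ltW.
- move=> t /andP[t0 _]; have [r [s [r0 Hr]]] := ll t t0.
  exists (collision_number n (fun=> s) 0); split.
    by apply: positive_linear_in_dual; exact: positive_linear_collision_number.
  move=> B _ e e0; exists r; split=> // u /andP[tu ut] _ phi _.
  by rewrite /collision_number (Hr u tu ut) subrr normr0 ltW.
Qed.

(** * Finite nets for bounded sets of test functions *)

Section net.
Variables (R : realType) (d : nat).

(** Coordinates are changed one at a time, so the mean value theorem is used along axes only; each
    of the [d] steps costs at most [L * |x - y|]. *)
Lemma partial_derivatives_lip (f : 'rV[R]_d -> R) (L : R) :
  (forall i x, derivable f x (unitv R i)) ->
  (forall i x, `|derive f x (unitv R i)| <= L) ->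
  forall x y, `|f x - f y| <= L * d%:R * `|x - y|.
Proof.
move=> df fL.
have seg i x (a b : R) : a <= b ->
    `|f (x + b *: unitv R i) - f (x + a *: unitv R i)| <= L * (b - a).
  move=> ab.
  have D (h : R) : is_derive h 1 (fun h : R => f (x + h *: unitv R i)) (derive f (x + h *: unitv R i) (unitv R i)).
    exact: is_derive_line.
  have [|c _ ->] := MVT_segment ab (fun h _ => D h).
    apply: derivable_within_continuous => h _.
    by have := D h => ?; exact: ex_derive.
  by rewrite normrM (ger0_norm (_ : 0 <= b - a)) ?subr_ge0// ler_wpM2r ?subr_ge0.
have step i x (h : R) : `|f (x + h *: unitv R i) - f x| <= L * `|h|.
  have [h0|/ltW h0] := leP 0 h.
    by have := seg i x 0 h h0; rewrite scale0r addr0 subr0 (ger0_norm h0).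
  by have := seg i x h 0 h0; rewrite scale0r addr0 sub0r distrC (ler0_norm h0).
have L0 (i : 'I_d) : 0 <= L by exact: le_trans (normr_ge0 _) (fL i 0).
move=> x y.
have -> : f x = f (y + \sum_i (x 0 i - y 0 i) *: unitv R i).
  congr f; rewrite -row_unitv; apply/rowP => i; rewrite !mxE; ring.
have chain (r : seq 'I_d) : `|f (y + \sum_(i <- r) (x 0 i - y 0 i) *: unitv R i) - f y| <=
    \sum_(i <- r) L * `|x - y|.
  elim: r => [|i r IH]; first by rewrite !big_nil addr0 subrr normr0.
  rewrite !big_cons; set S := \sum_(j <- r) (x 0 j - y 0 j) *: unitv R j.
  have -> : y + ((x 0 i - y 0 i) *: unitv R i + S) = y + S + (x 0 i - y 0 i) *: unitv R i.
    by rewrite addrCA addrC.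
  rewrite -(subrKA (f (y + S))).
  apply: (le_trans (ler_normD _ _)); apply: lerD => //.
  apply: (le_trans (step _ _ _)); rewrite ler_wpM2l ?(L0 i)//.
  by have := norm_coord (x - y) i; rewrite !mxE.
apply: (le_trans (chain _)).
by rewrite sumr_const card_ord -(mulr_natr (L * _)) mulrAC.
Qed.

Lemma lattice_net M (y : 'rV[R]_d) : (forall i, 0 <= y 0 i < 1) ->
  exists a : site d M, `|y - pos R a| <= eps R M.
Proof.
move=> y01; have e0 := eps_gt0 R M; have eM := epsM R M.
have N0 : 0 < M.+1%:R :> R by [].
pose k i := Num.truncn (y 0 i * M.+1%:R).
have yN0 i : 0 <= y 0 i * M.+1%:R by rewrite mulr_ge0//; case/andP: (y01 i).
have kM i : (k i < M.+1)%N.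
  by rewrite truncn_lt_nat// gtr_pMl//; case/andP: (y01 i).
exists [ffun i => inord (k i)]; apply: norm_rV_le => [|i]; first exact: ltW.
rewrite !mxE ffunE inordK//.
have /andP[k1 k2] := truncn_itv (yN0 i).
have -> : y 0 i = y 0 i * M.+1%:R * eps R M by rewrite -mulrA eM mulr1.
rewrite -mulrBl normrM (ger0_norm (ltW e0)) ler_piMl ?(ltW e0)//.
move: k2; rewrite -(natr1 (Num.truncn _)) -/(k i) => k2; rewrite -/(k i) in k1.
by rewrite ger0_norm ?subr_ge0//; lra.
Qed.

(** An explicit Arzela-Ascoli argument: bounded first derivatives give a common Lipschitz constant,
    and values at the points of a fine grid are rounded to multiples of [e / 3]. Two functions with
    the same table differ by at most [e / 3] on the grid, and passing to arbitrary points costs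
    [e / 3] for each function. *)
Lemma bounded_set_net (B : set (testfn R d)) (e : R) : bounded_set B -> 0 < e ->
  exists (I : finType) (ps : I -> testfn R d), (forall i, periodic_test (ps i)) /\
  forall phi, B phi -> exists i, forall l b x, `|phi l b x - ps i l b x| <= e.
Proof.
move=> [Btest Bder] e0.
have [c0 Hc0] := Bder [::]; pose c := `|c0|.
have Hc phi : B phi -> forall l b x, `|phi l b x| <= c.
  by move=> Bphi l b x; exact: le_trans (Hc0 phi Bphi l b x) (ler_norm _).
have [L0 HL] := choice (fun i : 'I_d => Bder [:: i]).
pose L := \sum_i `|L0 i|.
have L_ge0 : 0 <= L by apply: sumr_ge0.
have Blip phi : B phi -> forall l b x y, `|phi l b x - phi l b y| <= L * d%:R * `|x - y|.
  move=> Bphi l b; apply: partial_derivatives_lip => i x.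
    by have [_ sm] := Btest phi Bphi l b; have [_] := sm [::]; exact.
  apply: (le_trans (HL i phi Bphi l b x)); apply: (le_trans (ler_norm _)).
  by rewrite /L (bigD1 i)//= lerDl sumr_ge0.
pose e' := e / 3; have e'0 : 0 < e' by rewrite divr_gt0.
pose M := Num.truncn (L * d%:R / e').
have Me : L * d%:R * eps R M <= e'.
  have := truncnS_gt (L * d%:R / e'); rewrite -/M ltr_pdivrMr// => /ltW.
  have em := epsM R M; have := eps_gt0 R M; move: (L * d%:R) => LL ee h.
  have := ler_wpM2r (ltW ee) h; rewrite mulrAC em mul1r; exact.
pose k := Num.truncn (2 * c / e').
pose q phi (u : 'I_d * bool * site d M) := Num.truncn ((phi u.1.1 u.1.2 (pos R u.2) + c) / e').
pose Q phi : {ffun 'I_d * bool * site d M -> 'I_k.+1} := [ffun u => inord (q phi u)].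
have qk phi u : B phi -> (q phi u < k.+1)%N.
  move=> Bphi; rewrite ltnS truncn_le_nat; apply: le_lt_trans (truncnS_gt _).
  rewrite ler_pM2r ?invr_gt0//; have := Hc phi Bphi u.1.1 u.1.2 (pos R u.2).
  by rewrite ler_norml; lra.
exists {ffun 'I_d * bool * site d M -> 'I_k.+1}.
(* A table that occurs in [B] is represented by a member of [B], so that the Lipschitz bound holds
   for it as well; any other table gets the zero function as a dummy. *)
have H (i : {ffun 'I_d * bool * site d M -> 'I_k.+1}) : exists psi : testfn R d,
    periodic_test psi /\ ((exists2 phi, B phi & Q phi = i) -> B psi /\ Q psi = i).
  have [[phi Bphi Qphi]|no] := pselect (exists2 phi, B phi & Q phi = i).
    by exists phi; split=> //; exact: periodic_is_test (Btest phi Bphi).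
  by exists (cst_test 0); split=> [|//]; exact: periodic_cst_test.
have [ps Hps] := choice H.
exists ps; split=> [i|phi Bphi]; first by have [] := Hps i.
exists (Q phi) => l b x.
have [_ /(_ (ex_intro2 _ _ phi Bphi erefl))[Bpsi QE]] := Hps (Q phi).
set psi := ps (Q phi) in Bpsi QE *.
have near (a : site d M) : `|phi l b (pos R a) - psi l b (pos R a)| <= e'.
  have := congr1 (fun f : {ffun _ -> _} => nat_of_ord (f (l, b, a))) QE.
  rewrite !ffunE !inordK ?qk// => qE.
  have nn f : B f -> 0 <= (f l b (pos R a) + c) / e'.
    move=> Bf; rewrite divr_ge0 ?(ltW e'0)//; have := Hc f Bf l b (pos R a).
    by rewrite ler_norml; lra.
  have /andP[] := truncn_itv (nn phi Bphi); have /andP[] := truncn_itv (nn psi Bpsi).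
  move: qE; rewrite /q /= => ->; rewrite -natr1.
  move: (Num.truncn _)%:R => m; rewrite ltr_pdivrMr// ler_pdivlMr// => h1 h2.
  rewrite ltr_pdivrMr// ler_pdivlMr// => h3 h4.
  by rewrite ler_norml; move: h1 h2 h3 h4; rewrite mulrDl mul1r; lra.
have [z [y [y01 xE]]] := torus_repr x.
have pe f : B f -> f l b x = f l b y.
  by move=> Bf; rewrite xE periodic_shift//; have [] := Btest f Bf l b.
rewrite (pe _ Bphi) (pe _ Bpsi).
have [a ya] := lattice_net M y01.
have lp f : B f -> `|f l b y - f l b (pos R a)| <= e'.
  move=> Bf; apply: (le_trans (Blip f Bf l b y (pos R a))).
  by apply: le_trans Me; rewrite ler_wpM2l// mulr_ge0.
have := near a; have := lp _ Bphi; have := lp _ Bpsi; rewrite /e' !ler_norml; lra.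
Qed.

End net.

Lemma dist_between (R : realType) (a a1 a2 c c1 c2 q : R) : a1 <= a <= a2 ->
  `|a1 - c1| <= q -> `|a2 - c2| <= q -> `|c - c1| <= q -> `|c2 - c| <= q -> `|a - c| <= q + q.
Proof. by rewrite !ler_norml; lra. Qed.

(** * Uniformity in time and over bounded sets *)

Section uniform_law_of_large_numbers.
Variables (R : realType) (d : nat) (rho0 : 'rV[R]_d -> R) (rho : 'rV[R]_d -> R -> R).
Hypotheses (crho0 : continuous rho0) (prho0 : torus_periodic rho0).
Hypothesis hrho : heat_sol rho0 rho.
Variable T : R.
Hypothesis T_gt0 : 0 < T.
Implicit Types (phi psi : testfn R d) (B : set (testfn R d)).

(** Failures form an uncountable union over times and test functions; they are covered by one
    measurable [G] that depends on neither. *)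
Definition uniform_lln B := forall delta beta : R, 0 < delta -> 0 < beta ->
  exists2 r : R, 0 < r &
  forall (n M : nat) (dO : measure_display) (Omega : measurableType dO)
    (P : probability Omega R) (X : R -> Omega -> state d M),
  is_markov (@exclusion_jumps R d M) P X (init_law rho0 n) ->
  (0 < n)%N -> eps R M < r -> (eps R M ^+ d * n%:R ^+ 2)^-1 < r ->
  exists G : set Omega, [/\ measurable G, (P G <= beta%:E)%E &
  forall w, ~ G w -> forall t, 0 <= t <= T -> forall phi, B phi ->
    `|collision_number n (fun t => X t w) t phi - collision_limit rho t phi| <= delta].

Definition le_collisions M (s s' : state d M) := forall q, (st_C s q <= st_C s' q)%N.

Lemma le_collisions_jump M (s : state d M) j s' : j \in exclusion_jumps R s ->
  le_collisions j.2 s' -> le_collisions s s'.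
Proof.
rewrite mem_cat => /orP[] /mapP[p _ ->] //= H q; apply: leq_trans (H q).
by rewrite /st_C /= ffunE leq_addr.
Qed.

Lemma collision_number_mono M n (Xw : R -> state d M) phi s t :
  (forall l b x, 0 <= phi l b x) -> le_collisions (Xw s) (Xw t) ->
  collision_number n Xw s phi <= collision_number n Xw t phi.
Proof.
move=> phi0 st; have e0 := ltW (eps_gt0 R M).
rewrite /collision_number ler_wpM2l ?divr_ge0 ?mulr_ge0 ?exprn_ge0//.
do 3 (apply: ler_sum => ? _).
by rewrite ler_wpM2r// ler_nat.
Qed.

Lemma time_grid (m : nat) (t : R) : (0 < m)%N -> 0 <= t <= T ->
  exists j k : 'I_m.+1, [/\ j%:R * (T / m%:R) <= t, t <= k%:R * (T / m%:R),
    t - j%:R * (T / m%:R) <= T / m%:R & k%:R * (T / m%:R) - t <= T / m%:R].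
Proof.
move=> m0 /andP[t0 tT]; have mR : 0 < m%:R :> R by rewrite ltr0n.
have h0 : 0 < T / m%:R by rewrite divr_gt0.
set h := T / m%:R in h0 *; have mh : m%:R * h = T by rewrite mulrC divfK// lt0r_neq0.
have th0 : 0 <= t / h by rewrite divr_ge0// ltW.
have /andP[j1 j2] := truncn_itv th0; set j := Num.truncn (t / h) in j1 j2.
have jm : (j <= m)%N.
  by rewrite -(ler_nat R) (le_trans j1)// ler_pdivrMr// mh.
rewrite ler_pdivlMr// in j1; rewrite ltr_pdivrMr// -(natr1 j) mulrDl mul1r in j2.
have jlt : (j < m.+1)%N by [].
have [jm'|jm'] := ltnP j m.
  have klt : (j.+1 < m.+1)%N by [].
  exists (Ordinal jlt), (Ordinal klt); rewrite /= -(natr1 j) mulrDl mul1r.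
  by split => //; lra.
(* Here [t = T], and the last grid point is its own neighbour on both sides. *)
exists (Ordinal jlt), (Ordinal jlt) => /=.
have jE : j = m by apply/eqP; rewrite eqn_leq jm jm'.
by rewrite jE mh in j1 j2 *; split => //; lra.
Qed.

(** Between grid times the monotone number is squeezed by its values at the two neighbours, and the
    mesh is such that the limit moves by at most [delta / 2] over one cell. [G] consists of the null
    set of non-monotone paths and [m + 1] events of probability at most [beta / m.+1]. *)
Lemma uniform_lln_ge0 phi : periodic_test phi -> (forall l b x, 0 <= phi l b x) ->
  uniform_lln [set phi].
Proof.
move=> pphi phi0 delta beta delta0 beta0.
have [K Kp rhoK] := heat_bounded crho0 prho0 hrho; have K0 := ltW Kp.
have [c cp phic] := test_bounded pphi.1 pphi.2; have c0 := ltW cp.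
pose A := (2 * d)%:R * (c * K ^+ 2).
have A0 : 0 <= A by apply: mulr_ge0 => //; apply: mulr_ge0 => //; exact: sqr_ge0.
have d20 : 0 < delta / 2 by rewrite divr_gt0.
pose m := (Num.truncn (A * T / (delta / 2))).+1.
have mR : 0 < m%:R :> R by rewrite ltr0n.
have Am : A * (T / m%:R) <= delta / 2.
  have := truncnS_gt (A * T / (delta / 2)); rewrite -/m ltr_pdivrMr// => /ltW.
  by rewrite mulrA ler_pdivrMr// (mulrC (delta / 2)).
have b0 : 0 < beta / m.+1%:R by rewrite divr_gt0.
have [r r0 Hr] := collision_lln crho0 prho0 hrho pphi.1 pphi.2 phi0 (ltW T_gt0) d20 b0.
exists r => // n M dO Omega P X XP n0 er nr.
have [N [mN PN HN]] := negligible_paths_nle XP (fun s q => leqnn _)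
  (@le_collisions_jump M).
pose tj (j : nat) := j%:R * (T / m%:R).
have tj0 j : (j < m.+1)%N -> 0 <= tj j <= T.
  move=> jm; rewrite /tj mulr_ge0 ?divr_ge0 ?(ltW T_gt0)//= mulrA ler_pdivrMr// mulrC ler_wpM2l ?(ltW T_gt0)//.
  by rewrite ler_nat -ltnS.
pose E j := [set w | delta / 2 < `|collision_number n (fun t => X t w) (tj j) phi -
                         collision_limit rho (tj j) phi|].
have mE j : (j < m.+1)%N -> measurable (E j).
  move=> /tj0/andP[t0 _].
  exact: (measurable_state XP t0 [set s | delta / 2 < `|collision_number n (fun=> s) (tj j) phi -
                         collision_limit rho (tj j) phi|]).
exists (N `|` \big[setU/set0]_(j < m.+1) E j); split.
- by apply: measurableU => //; apply: bigsetU_measurable => j _; exact: mE.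
- apply: (le_trans (measureU2 _ mN _)); first by apply: bigsetU_measurable => j _; exact: mE.
  rewrite [X in (X + _)%E]PN add0e; apply: (le_trans (Boole_inequality _ mE)).
  apply: (@le_trans _ _ (\sum_(j < m.+1) (beta / m.+1%:R)%:E)%E).
    by apply: lee_sum => j _; apply: Hr => //; exact: tj0.
  by rewrite sumEFin sumr_const card_ord -(mulr_natr (_ / _)) divfK// pnatr_eq0.
move=> w Gw t tT _ ->.
have mon s u : 0 <= s -> s <= u -> collision_number n (fun t => X t w) s phi <=
    collision_number n (fun t => X t w) u phi.
  move=> s0 su; apply: collision_number_mono => //.
  apply: contrapT => H; apply: Gw; left; apply: HN => /= Hall; exact/H/Hall.
have near (j : 'I_m.+1) : `|collision_number n (fun t => X t w) (tj j) phi -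
                         collision_limit rho (tj j) phi| <= delta / 2.
  rewrite leNgt; apply/negP => H; apply: Gw; right.
  by rewrite (bigD1 j)//=; left.
have [j [k [jt tk tj1 tk1]]] := @time_grid m t (ltn0Sn _) tT.
have /andP[t0 tT'] := tT.
have lip s u : 0 <= s <= u -> u - s <= T / m%:R ->
    `|collision_limit rho u phi - collision_limit rho s phi| <= delta / 2.
  move=> su us; apply: (le_trans (collision_limit_lip crho0 prho0 hrho rhoK pphi phic su)).
  by apply: le_trans Am; rewrite /A -!mulrA !ler_wpM2l ?sqr_ge0.
have /andP[tj00 _] := tj0 j (ltn_ord j).
have h1 := lip (tj j) t _ tj1; rewrite tj00 jt in h1; have {}h1 := h1 isT.
have h2 := lip t (tj k) _ tk1; rewrite t0 tk in h2; have {}h2 := h2 isT.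
have h3 := mon _ _ tj00 jt; have h4 := mon _ _ t0 tk.
rewrite [delta]splitr; apply: dist_between (near j) (near k) h1 h2.
by rewrite h3 h4.
Qed.

Lemma uniform_llnU B B' : uniform_lln B -> uniform_lln B' -> uniform_lln (B `|` B').
Proof.
move=> H H' delta beta delta0 beta0; have b0 : 0 < beta / 2 by rewrite divr_gt0.
have [r r0 Hr] := H delta _ delta0 b0; have [r' r'0 Hr'] := H' delta _ delta0 b0.
exists (Num.min r r'); first by rewrite lt_min r0.
move=> n M dO Omega P X XP n0; rewrite !lt_min => /andP[er er'] /andP[nr nr'].
have [G [mG PG HG]] := Hr n M dO Omega P X XP n0 er nr.
have [G' [mG' PG' HG']] := Hr' n M dO Omega P X XP n0 er' nr'.
exists (G `|` G'); split; first exact: measurableU.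
  apply: (le_trans (measureU2 _ mG mG')); rewrite [beta]splitr EFinD.
  exact: leeD.
by move=> w /not_orP[nG nG'] t tT phi [Bphi|Bphi]; [exact: HG|exact: HG'].
Qed.

(** Adding its bound [c] makes [phi] nonnegative; the constant function is nonnegative as well, and
    [c] times its error is subtracted again, whence [delta / (1 + c)]. *)
Lemma uniform_lln_periodic phi : periodic_test phi -> uniform_lln [set phi].
Proof.
move=> pphi delta beta delta0 beta0.
have [c cp phic] := test_bounded pphi.1 pphi.2; have c0 := ltW cp.
have pc := @periodic_cst_test R d.
have H := @uniform_lln_ge0 (lin_test 1 (cst_test c) phi) (periodic_lin_test 1 (pc c) pphi) _.
have H1 := @uniform_lln_ge0 (cst_test 1) (pc 1) (fun _ _ _ => ler01).
have d0 : 0 < delta / (1 + c) by rewrite divr_gt0// addr_gt0.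
have [|r r0 Hr] := uniform_llnU (H _) H1 d0 beta0.
  by move=> l b x; have := phic l b x; rewrite /lin_test /cst_test ler_norml mul1r; lra.
exists r => // n M dO Omega P X XP n0 er nr.
have [G [mG PG HG]] := Hr n M dO Omega P X XP n0 er nr.
exists G; split=> // w /HG{}HG t tT _ ->; have /andP[t0 _] := tT.
have [K _ rhoK] := heat_bounded crho0 prho0 hrho.
have plA := positive_linear_collision_number n (fun t => X t w) t.
have plc := positive_linear_collision_limit crho0 prho0 hrho rhoK t0.
have := HG t tT _ (or_introl erefl); have := HG t tT _ (or_intror erefl).
rewrite plA.1// plc.1// !mul1r (positive_linear_cst c plA) (positive_linear_cst c plc).
set A := collision_number _ _ _; set C := collision_limit _ _; set q := delta / _ => h1 h2.
have -> : delta = q * (1 + c) by rewrite divfK// lt0r_neq0// addr_gt0.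
have -> : A phi - C phi = (c * A (cst_test 1) + A phi - (c * C (cst_test 1) + C phi)) -
  c * (A (cst_test 1) - C (cst_test 1)) by ring.
apply: (le_trans (ler_normB _ _)); rewrite [q * _]mulrDr mulr1 lerD// normrM ger0_norm// mulrC.
exact: ler_wpM2r.
Qed.

Lemma uniform_lln_fin (I : finType) (ps : I -> testfn R d) :
  (forall i, periodic_test (ps i)) -> uniform_lln (range ps).
Proof.
move=> pps.
suff H (s : seq I) : uniform_lln [set ps i | i in [set` s]].
  move=> delta beta delta0 beta0; have [r r0 Hr] := H (index_enum I) delta beta delta0 beta0.
  exists r => // n M dO Omega P X XP n0 er nr.
  have [G [mG PG HG]] := Hr n M dO Omega P X XP n0 er nr.
  exists G; split=> // w /HG{}HG t tT _ [i _ <-]; apply: HG => //.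
  by exists i => //=; exact: mem_index_enum.
elim: s => [|i s IH].
  move=> delta beta delta0 beta0; exists 1 => // n M dO Omega P X XP n0 er nr.
  by exists set0; split=> //; [rewrite measure0 lee_fin ltW|move=> w _ t tT psi [j]].
move=> delta beta delta0 beta0.
have [r r0 Hr] := uniform_llnU (uniform_lln_periodic (pps i)) IH delta0 beta0.
exists r => // n M dO Omega P X XP n0 er nr.
have [G [mG PG HG]] := Hr n M dO Omega P X XP n0 er nr.
exists G; split=> // w /HG{}HG t tT _ [j /= + <-]; rewrite inE => /orP[/eqP ->|js].
  by apply: HG => //; left.
by apply: HG => //; right; exists j.
Qed.

(** Replacing [phi] by a net function costs the mesh times the total mass, and the random mass is
    controlled by including the constant 1 among the test functions. *)
Lemma uniform_lln_bounded B : bounded_set B -> uniform_lln B.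
Proof.
move=> bB delta beta delta0 beta0.
have [K _ rhoK] := heat_bounded crho0 prho0 hrho.
have pc := @periodic_cst_test R d.
have plc t : 0 <= t -> positive_linear (collision_limit rho t).
  by move=> t0; exact: (positive_linear_collision_limit crho0 prho0 hrho rhoK t0).
pose C1 := collision_limit rho T (cst_test 1).
have C10 : 0 <= C1 by apply: positive_linear1_ge0; exact: plc (ltW T_gt0).
(* Outside [G] the random mass is at most [C1 + 1], because its error is at most 1, and the limit
   mass is at most [C1]. *)
have e0 : 0 < delta / 2 / (2 * C1 + 1) by rewrite !divr_gt0//; lra.
set e := delta / 2 / (2 * C1 + 1) in e0.
have [I [ps [pps Bps]]] := bounded_set_net bB e0.
have d0 : 0 < Num.min 1 (delta / 2) by rewrite lt_min ltr01 divr_gt0.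
have [r r0 Hr] := uniform_llnU (uniform_lln_fin pps) (uniform_lln_periodic (pc 1)) d0 beta0.
exists r => // n M dO Omega P X XP n0 er nr.
have [G [mG PG HG]] := Hr n M dO Omega P X XP n0 er nr.
exists G; split=> // w /HG{}HG t tT phi Bphi; have /andP[t0 tT'] := tT.
have plA := positive_linear_collision_number n (fun t => X t w) t.
have [i Hi] := Bps phi Bphi.
have pphi := periodic_is_test (bB.1 phi Bphi).
have h1 := HG t tT (ps i) (or_introl (ex_intro2 _ _ i Logic.I erefl)).
have h2 := HG t tT _ (or_intror erefl).
have h3 := positive_linear_dist plA pphi (pps i) Hi.
have h4 := positive_linear_dist (plc t t0) pphi (pps i) Hi.
have h5 : collision_limit rho t (cst_test 1) <= C1.
  by apply: (collision_limit_mono crho0 prho0 hrho rhoK) => //; rewrite t0.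
have A1 := positive_linear1_ge0 plA.
set A := collision_number _ _ _ in h1 h2 h3 A1 *; set C := collision_limit _ _ in h1 h2 h3 h4 h5 *.
rewrite !le_min in h1 h2; case/andP: h1 => _ h1; case/andP: h2 => h2 _.
have h6 : e * A (cst_test 1) + e * C (cst_test 1) <= delta / 2.
  have -> : delta / 2 = e * (2 * C1 + 1) by rewrite divfK// lt0r_neq0//; lra.
  by rewrite -mulrDr ler_wpM2l ?(ltW e0)//; move: h2; rewrite ler_norml; lra.
by move: h1 h3 h4 h6; rewrite !ler_norml; lra.
Qed.

End uniform_law_of_large_numbers.

(** * Sampled paths as time changes of the original path *)

Section discretisation.
Variables (R : realType) (S : Type) (x : R -> S) (T : R).
Hypothesis T_gt0 : 0 < T.
Hypothesis x_right : forall t, 0 <= t -> exists delta, 0 < delta /\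
  forall u, t <= u -> u < t + delta -> x u = x t.
Hypothesis x_left : forall t, 0 < t -> exists delta s, 0 < delta /\
  forall u, t - delta < u -> u < t -> x u = s.

Let h (m : nat) : R := T / m.+1%:R.

Let h_gt0 m : 0 < h m. Proof. by rewrite divr_gt0. Qed.

Let hm m : m.+1%:R * h m = T. Proof. by rewrite mulrC divfK// pnatr_eq0. Qed.

Lemma grid_above m t : 0 <= t -> exists k : nat, t <= k%:R * h m < t + h m.
Proof.
move=> t0; have /andP[c1 c2] := ceil_itv (t / h m).
have th : 0 <= t / h m by rewrite divr_ge0// ltW.
have : 0 <= Num.ceil (t / h m) by rewrite -(ler_int R) (le_trans th).
case: (Num.ceil _) c1 c2 => // k c1 c2 _; exists k.
rewrite ler_pdivrMr// in c2; rewrite c2 /=.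
by move: c1; rewrite intrB ltr_pdivlMr// mulrBl mul1r ltrBlDr.
Qed.

Lemma truncn_above m (k : nat) v : k%:R * h m <= v -> (k <= Num.truncn (v / h m))%N.
Proof.
move=> kv; have v0 : 0 <= v by apply: le_trans kv; rewrite mulr_ge0// ltW.
by rewrite truncn_ge_nat ?divr_ge0// ?ler_pdivlMr// ltW.
Qed.

Lemma truncn_below m (k : nat) v : 0 <= v -> v < k%:R * h m -> (Num.truncn (v / h m) < k)%N.
Proof.
by move=> v0 vk; rewrite truncn_lt_nat ?divr_ge0// ?ltr_pdivrMr// ltW.
Qed.

(* The time change is built on [0, t] for increasing t: where the path is constant it is
   affine between the grid points following the two ends. *)
Definition matched (t : R) := forall th : R, 0 < th < 1 -> \forall m \near \oo,
  exists (tau : R -> R) (k : nat), [/\ tau 0 = 0, tau t = k%:R * h m, t <= k%:R * h m < t + h m,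
    forall s u, 0 <= s -> s <= u -> u <= t ->
      (1 - th) * (u - s) <= tau u - tau s <= (1 + th) * (u - s) &
    forall s, 0 <= s < t -> x ((Num.truncn (tau s / h m))%:R * h m) = x s].

Lemma matched0 : matched 0.
Proof.
move=> th th01; near=> m; exists id, 0%N.
rewrite mul0r add0r lexx h_gt0; split => // [s u s0 su u0|s /andP[s0]].
  have -> : u = s by lra.
  by rewrite subrr !mulr0 lexx.
by rewrite ltNge s0.
Unshelve. all: by end_near. Qed.

(** Both ends are moved up to grid points by less than [h m <= th * (b - a)], so the affine piece
    has slope within [th] of 1. Its values from [k * h m] up to but excluding [k' * h m] are sampled
    at grid points in [[a, b)], where the path is constant. *)
Lemma matched_extend a b : 0 <= a < b -> (forall u, a <= u < b -> x u = x a) ->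
  matched a -> matched b.
Proof.
move=> /andP[a0 ab] xab ma th th01; have /andP[th0 th1] := th01.
have b0 : 0 <= b by apply: le_trans a0 (ltW ab).
have hsmall : \forall m \near \oo, h m <= th * (b - a).
  have tb : 0 < th * (b - a) by rewrite mulr_gt0// subr_gt0.
  exists (Num.truncn (T / (th * (b - a)))) => // m /= mM.
  rewrite /h ler_pdivrMr//; have := truncnS_gt (T / (th * (b - a))).
  rewrite ltr_pdivrMr// mulrC => /ltW /le_trans; apply.
  by rewrite ler_wpM2l ?(ltW tb)// ler_nat.
have := ma th th01; apply: filterS2 hsmall => m hth [tau [k [tau0 tauk /andP[ak ka] slope match_]]].
have [k' /andP[bk kb]] := grid_above m b0.
pose sl := (k'%:R * h m - k%:R * h m) / (b - a).
have ba : 0 < b - a by rewrite subr_gt0.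
have sl1 : 1 - th <= sl by rewrite ler_pdivlMr//; nra.
have sl2 : sl <= 1 + th by rewrite ler_pdivrMr//; nra.
have slE : sl * (b - a) = k'%:R * h m - k%:R * h m by rewrite divfK// lt0r_neq0.
pose tau' s := if s <= a then tau s else k%:R * h m + sl * (s - a).
exists tau', k'; rewrite /tau' a0 bk kb leNgt ab /=; split => //.
- by rewrite slE; ring.
- have tail s u : a <= s -> s <= u -> (1 - th) * (u - s) <= sl * (u - s) <= (1 + th) * (u - s).
    by move=> as_ su; rewrite !ler_wpM2r ?subr_ge0.
  move=> s u s0 su ub; case: (leP u a) => [ua|au].
    by rewrite (le_trans su ua); exact: slope.
  case: (leP s a) => [sa|as_].
    have /andP[g1 g2] := slope s a s0 sa (lexx _); have /andP[g3 g4] := tail a u (lexx _) (ltW au).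
    by rewrite tauk in g1 g2; move: g1 g2 g3 g4; rewrite !mulrBr; lra.
  have -> : k%:R * h m + sl * (u - a) - (k%:R * h m + sl * (s - a)) = sl * (u - s) by ring.
  exact: tail (ltW as_) su.
- move=> s /andP[s0 sb]; case: (ltgtP s a) => [sa|as_|sa].
  + by rewrite match_// s0.
  + set v := k%:R * h m + sl * (s - a).
    have sl0 : 0 < sl by apply: lt_le_trans sl1; rewrite subr_gt0.
    have kv : k%:R * h m <= v by rewrite lerDl mulr_ge0 ?(ltW sl0)// subr_ge0 ltW.
    have vk : v < k'%:R * h m.
      have : sl * (s - a) < sl * (b - a) by rewrite ltr_pM2l// ltrD2r.
      by rewrite slE /v; lra.
    have v0 : 0 <= v by apply: le_trans kv; rewrite mulr_ge0// ltW.
    rewrite (xab s) ?(ltW as_)//; apply: xab.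
    have := truncn_above kv; have := truncn_below v0 vk.
    set q := Num.truncn _ => qk kq; apply/andP; split.
      by apply: (le_trans ak); rewrite ler_wpM2r ?(ltW (h_gt0 m))// ler_nat.
    have : q.+1%:R * h m <= k'%:R * h m by rewrite ler_wpM2r ?(ltW (h_gt0 m))// ler_nat.
    by rewrite -natr1 mulrDl mul1r; lra.
  + rewrite sa tauk mulfK ?lt0r_neq0// natrK; apply: xab; rewrite ak /=.
    by have := hth; nra.
Qed.

(** Continuous induction on the supremum of the matched times: the left limit makes the path
    constant just before the supremum, so it is matched; right-continuity extends beyond it unless
    it equals [T]. *)
Lemma matchedT : matched T.
Proof.
pose A := [set t | 0 <= t <= T /\ matched t].
have A0 : A 0 by split; [rewrite lexx ltW|exact: matched0].
have ubA : ubound A T by move=> t [/andP[]].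
have supA : has_sup A by split; [exists 0|exists T].
pose b := sup A.
have b0 : 0 <= b by apply: ub_le_sup => //; exists T.
have bT : b <= T by apply: ge_sup => //; exists 0.
have mb : matched b.
  have [b0'|b0'] := ltrP 0 b; last first.
    have -> : b = 0 by apply/eqP; rewrite eq_le b0 b0'.
    exact: matched0.
  have [r [s [r0 Hr]]] := x_left b0'.
  have [t [/andP[t0 tT] mt] tb] := sup_adherent r0 supA; rewrite -/b in tb.
  have tb' : t <= b by apply: ub_le_sup; [exists T|split; rewrite ?t0].
  have [tb''|tb''] := ltrP t b; last by have -> : b = t by apply/eqP; rewrite eq_le tb' tb''.
  apply: (@matched_extend t) => //; first by rewrite t0.
  move=> u /andP[tu ub]; have tbu u' : t <= u' -> u' < b -> x u' = s.
    by move=> tu' ub'; apply: Hr => //; lra.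
  by rewrite !tbu.
have [bT'|bT'] := ltrP b T; last by have <- : b = T by apply/eqP; rewrite eq_le bT bT'.
have [r [r0 Hr]] := x_right b0.
pose c := Num.min T (b + r / 2).
have bc : b < c by rewrite lt_min bT' ltrDl divr_gt0.
have mc : matched c.
  apply: (@matched_extend b) => //; first by rewrite b0.
  move=> u /andP[bu uc]; apply: Hr => //.
  by move: uc; rewrite lt_min => /andP[_]; lra.
have : c <= b.
  apply: ub_le_sup; first by exists T.
  by split => //; rewrite ge_min lexx /= (le_trans b0 (ltW bc)).
by rewrite leNgt bc.
Qed.

(** The cap at [m.+1] freezes the path at its value in [T], so that [m + 2] sampled states determine
    it. *)
Definition grid_path (m : nat) (t : R) : S := x ((minn (Num.truncn (t / h m)) m.+1)%:R * h m).

Lemma grid_path_timechange (th : R) : 0 < th < 1 -> \forall m \near \oo,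
  exists tau, [/\ timechange T tau,
    forall s u, 0 <= s -> s <= u -> u <= T ->
      (1 - th) * (u - s) <= tau u - tau s <= (1 + th) * (u - s) &
    forall s, 0 <= s <= T -> grid_path m (tau s) = x s].
Proof.
move=> th01; have /andP[th0 th1] := th01.
have := matchedT th01; apply: filterS => m [tau [k [tau0 tauT /andP[Tk kT] slope match_]]].
(* [T] is itself a grid point, hence the first one at or after [T]; the time change therefore ends
   exactly at [T]. *)
have kE : k = m.+1.
  have h0 := h_gt0 m.
  have k1 : (k < m.+2)%N.
    by rewrite -(ltr_nat R) -(ltr_pM2r h0) -(natr1 m.+1) mulrDl mul1r hm.
  have k2 : (m.+1 <= k)%N by rewrite -(ler_nat R) -(ler_pM2r h0) hm.
  by apply/eqP; rewrite eqn_leq -ltnS k1.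
rewrite kE hm in tauT.
have incr s t : 0 <= s -> s < t -> t <= T -> tau s < tau t.
  move=> s0 st tT; have /andP[g _] := slope s t s0 (ltW st) tT.
  have : 0 < (1 - th) * (t - s) by rewrite mulr_gt0 ?subr_gt0.
  by rewrite -subr_gt0; lra.
exists tau; split => //.
- split => //; split => //; split => //.
  apply/subspace_continuousP => t; rewrite /= in_itv/= => /andP[t0 tT].
  apply/cvgrPdist_le => e e0; rewrite near_withinE; near=> u => /=.
  rewrite in_itv/= => /andP[u0 uT].
  have tu : `|t - u| < e / 2.
    by near: u; exists (e / 2) => /=; [exact: divr_gt0|].
  apply: (@le_trans _ _ (2 * `|t - u|)); last by lra.
  have [tu'|/ltW tu'] := leP t u.
    have /andP[g1 g2] := slope t u t0 tu' uT.
    have g3 : 0 <= (1 - th) * (u - t) by rewrite mulr_ge0 ?subr_ge0// ltW.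
    rewrite distrC (distrC t) (ger0_norm (le_trans g3 g1)) ger0_norm ?subr_ge0//.
    by move: g2 g3; rewrite !mulrDl; lra.
  have /andP[g1 g2] := slope u t u0 tu' tT.
  have g3 : 0 <= (1 - th) * (t - u) by rewrite mulr_ge0 ?subr_ge0// ltW.
  rewrite (ger0_norm (le_trans g3 g1)) ger0_norm ?subr_ge0//.
  by move: g2 g3; rewrite !mulrDl; lra.
- move=> s /andP[s0 sT].
  have [sT'|sT'] := ltrP s T; last first.
    have -> : s = T by apply/eqP; rewrite eq_le sT sT'.
    rewrite /grid_path tauT -{1}(hm m) mulfK ?lt0r_neq0// natrK minnn.
    by rewrite hm.
  rewrite /grid_path (minn_idPl _) ?match_ ?s0//.
  have ts0 : 0 <= tau s.
    have /andP[g _] := slope 0 s (lexx _) s0 sT; rewrite tau0 !subr0 in g.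
    by apply: le_trans g; rewrite mulr_ge0// subr_ge0 ltW.
  by apply: ltnW; apply: truncn_below => //; rewrite hm -tauT; exact: incr.
Unshelve. all: by end_near. Qed.

Lemma grid_path_right m t : 0 <= t -> exists delta, 0 < delta /\
  forall u, t <= u -> u < t + delta -> grid_path m u = grid_path m t.
Proof.
move=> t0; have h0 := h_gt0 m.
have th : 0 <= t / h m by rewrite divr_ge0// ltW.
have /andP[k1 k2] := truncn_itv th; set k := Num.truncn _ in k1 k2.
rewrite ltr_pdivrMr// in k2; rewrite ler_pdivlMr// in k1.
exists (k.+1%:R * h m - t); split; first by rewrite subr_gt0.
move=> u tu ut; rewrite /grid_path -/k (_ : Num.truncn (u / h m) = k)//.
apply: truncn_def; rewrite ler_pdivlMr// ltr_pdivrMr//.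
by apply/andP; split; lra.
Qed.

Lemma grid_path_left m t : 0 < t -> exists delta s, 0 < delta /\
  forall u, t - delta < u -> u < t -> grid_path m u = s.
Proof.
move=> t0; have h0 := h_gt0 m.
have [[|k] /andP[tk kt]] := grid_above m (ltW t0); first by rewrite mul0r leNgt t0 in tk.
rewrite -(natr1 k) mulrDl mul1r in tk kt.
exists (t - k%:R * h m), (x ((minn k m.+1)%:R * h m)); split; first by lra.
move=> u tu ut; rewrite /grid_path (_ : Num.truncn (u / h m) = k)//.
apply: truncn_def; rewrite ler_pdivlMr// ltr_pdivrMr// -natr1 mulrDl mul1r.
by apply/andP; split; lra.
Qed.

End discretisation.

(** * Skorohod pseudometrics and measurability *)

Section skorohod.
Variables (R : realType) (d : nat).
Implicit Types (T : R) (B : set (testfn R d)) (xi : R -> testfn R d -> R).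

Lemma dB_le T B xi1 xi2 tau (a b : R) : timechange T tau ->
  (forall t, 0 <= t <= T -> forall phi, B phi -> `|xi1 t phi - xi2 (tau t) phi| <= a) ->
  (forall s t, 0 <= s <= T -> 0 <= t <= T -> s != t -> `|ln ((tau t - tau s) / (t - s))| <= b) ->
  (dB T B xi1 xi2 <= (a + b)%:E)%E.
Proof.
move=> tc Ha Hb; apply: le_trans (_ : (_ + _ <= _)%E).
  by apply: ereal_inf_lbound; exists tau; split; [exact: tc|reflexivity].
rewrite EFinD; apply: leeD; apply: ge_ereal_sup.
  by move=> _ [t [phi [tT [Bphi ->]]]]; rewrite lee_fin Ha.
by move=> _ [s [t [sT [tT [st ->]]]]]; rewrite lee_fin Hb.
Qed.

Lemma ln_slope_le (th q : R) : 0 < th <= 2^-1 -> 1 - th <= q <= 1 + th -> `|ln q| <= 2 * th.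
Proof.
move=> /andP[th0 th1] /andP[q1 q2].
have q0 : 0 < q by lra.
rewrite ler_norml; apply/andP; split; last first.
  have -> : q = 1 + (q - 1) by ring.
  by apply: (le_trans (@le_ln1Dx R (q - 1) _)); lra.
rewrite lerNl -lnV ?posrE//.
have -> : q^-1 = 1 + (q^-1 - 1) by ring.
have qV : q * q^-1 = 1 by rewrite mulfV// lt0r_neq0.
have qV0 : 0 < q^-1 by rewrite invr_gt0.
apply: (le_trans (@le_ln1Dx R (q^-1 - 1) _)); first by lra.
rewrite lerBlDr -(ler_pM2l q0) qV.
have : (1 - th) * (2 * th + 1) <= q * (2 * th + 1) by rewrite ler_wpM2r//; lra.
apply: le_trans; nra.
Qed.

Lemma dB_id_le T B xi1 xi2 (a : R) :
  (forall t, 0 <= t <= T -> forall phi, B phi -> `|xi1 t phi - xi2 t phi| <= a) ->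
  (dB T B xi1 xi2 <= a%:E)%E.
Proof.
move=> H; rewrite -[a]addr0; apply: (@dB_le _ _ _ _ id) => //.
  by split=> //; split=> //; split=> //; apply: continuous_subspaceT => t; exact: cvg_id.
by move=> s t _ _ st; rewrite divff ?ln1 ?normr0// subr_eq0 eq_sym.
Qed.

End skorohod.

Section measurability.
Variables (R : realType) (d M n : nat) (T : R).
Hypothesis T_gt0 : 0 < T.
Variable F : (R -> testfn R d -> R) -> R.
Hypothesis cF : SM_continuous T F.

(** The sampled path agrees with the path after a time change, so the sup part of the distance is
    zero and only the logarithm of the slopes remains, at most [2 * th], for every [B] at once. *)
Lemma grid_path_cvg (x : R -> state d M) :
  (forall t, 0 <= t -> exists delta, 0 < delta /\
      forall u, t <= u -> u < t + delta -> x u = x t) ->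
  (forall t, 0 < t -> exists delta s, 0 < delta /\
      forall u, t - delta < u -> u < t -> x u = s) ->
  F (collision_number n (grid_path x T m)) @[m --> \oo] --> F (collision_number n x).
Proof.
move=> xr xl; apply/cvgrPdist_lt => e e0.
have [k [Bs [delta [delta0 [_ Hd]]]]] := cF (in_D_collision_number n T xr xl) e0.
(* [ln_slope_le] needs slopes within 1/2 of 1, and [2 * th] has to stay below [delta]. *)
pose th := Num.min 2^-1 (delta / 4).
have th0 : 0 < th by rewrite lt_min invr_gt0 ltr0n divr_gt0.
have th1 : th <= 2^-1 by rewrite ge_min lexx.
have th2 : th <= delta / 4 by rewrite ge_min lexx orbT.
have th01 : 0 < th < 1 by rewrite th0 /=; lra.
have := grid_path_timechange T_gt0 xr xl th01; apply: filterS => m [tau [tc slope same]].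
apply: Hd => [|j jk].
  by apply: in_D_collision_number => t; [exact: grid_path_right|exact: grid_path_left].
apply: (@le_lt_trans _ _ (0 + 2 * th)%:E); last by rewrite lte_fin; lra.
apply: (dB_le tc) => [t tT phi _|s t sT tT st].
  by rewrite /collision_number same// subrr normr0.
wlog lt_st : s t sT tT st / s < t => [W|].
  have [ts|ts|ts] := ltgtP s t; first exact: W.
    rewrite -[_ / _]divrNN !opprB; apply: W => //; by rewrite eq_sym.
  by rewrite ts eqxx in st.
have ts0 : 0 < t - s by rewrite subr_gt0.
apply: ln_slope_le; first by rewrite th0.
case/andP: sT => s0 _; case/andP: tT => _ tT.
by rewrite ler_pdivlMr// ler_pdivrMr//; exact: slope (ltW lt_st) tT.
Qed.

(** Evaluated on a sampled path, [F] factors through finitely many states of a countable type, where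
    every set has a measurable preimage; a pointwise limit of such functions is measurable. *)
Lemma measurable_path_functional (dO : measure_display) (Omega : measurableType dO)
    (X : R -> Omega -> state d M) :
  (forall t s, 0 <= t -> measurable [set w | X t w = s]) ->
  (forall w t, 0 <= t -> exists delta, 0 < delta /\
      forall u, t <= u -> u < t + delta -> X u w = X t w) ->
  (forall w t, 0 < t -> exists delta s, 0 < delta /\
      forall u, t - delta < u -> u < t -> X u w = s) ->
  measurable_fun setT (fun w => F (collision_number n (fun t => X t w))).
Proof.
move=> mX Xr Xl.
apply: (@measurable_fun_cvg _ _ _ _
  (fun m w => F (collision_number n (grid_path (fun t => X t w) T m)))); last first.
  by move=> w _; exact: (grid_path_cvg (Xr w) (Xl w)).
move=> m.
pose Y w : {ffun 'I_m.+2 -> state d M} := [ffun j : 'I_m.+2 => X (j%:R * (T / m.+1%:R)) w].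
pose g (v : {ffun 'I_m.+2 -> state d M}) :=
  F (collision_number n (fun t => v (inord (minn (Num.truncn (t / (T / m.+1%:R))) m.+1)))).
have -> : (fun w => F (collision_number n (grid_path (fun t => X t w) T m))) = g \o Y.
  apply/funext => w; rewrite /g /=; congr (F (collision_number n _)); apply/funext => t.
  by rewrite ffunE inordK// ltnS geq_minr.
move=> _ U mU; rewrite setTI.
have mY v : measurable [set w | Y w = v].
  have -> : [set w | Y w = v] =
      \bigcap_(j in [set: 'I_m.+2]) [set w | X (j%:R * (T / m.+1%:R)) w = v j].
    apply/seteqP; split=> [w /= <- j _|w H]; first by rewrite /Y ffunE.
    by apply/ffunP => j; rewrite ffunE; exact: H.
  apply: fin_bigcap_measurable; first exact: finite_finset.
  by move=> j _; apply: mX; rewrite mulr_ge0// divr_ge0// ltW.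
exact: (measurable_countable mY (fun v => U (g v))).
Qed.

End measurability.

(** * Convergence of expectations *)

Lemma expectation_near (R : realType) (dO : measure_display) (Omega : measurableType dO)
    (P : probability Omega R) (f : Omega -> R) (c e C beta : R) (G : set Omega) :
  measurable_fun setT f -> (forall w, `|f w| <= C) -> `|c| <= C ->
  measurable G -> (P G <= beta%:E)%E -> 0 <= e -> (forall w, ~ G w -> `|f w - c| <= e) ->
  (\int[P]_w (f w)%:E \is a fin_num)%E /\
  `|\int[P]_w f w - c| <= e + 2 * C * beta.
Proof.
move=> mf fC cC mG PG e0 near.
have C0 : 0 <= C by apply: le_trans cC.
have PT : (P setT < +oo)%E by rewrite probability_setT ltry.
have bdd (g : Omega -> R) (K : R) : measurable_fun setT g -> (forall w, `|g w| <= K) ->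
    P.-integrable setT (EFin \o g).
  move=> mg gK; apply: measurable_bounded_integrable => //.
  exists K; split; first exact: num_real.
  by move=> K' KK' w _; apply: le_trans (gK w) (ltW KK').
have intf := bdd f C mf fC.
split; first exact: integrable_fin_num.
have intc : P.-integrable setT (EFin \o cst c) by apply: (bdd _ `|c|).
have Ec : \int[P]_w c = c by rewrite Rintegral_cst// [X in fine X]probability_setT mulr1.
rewrite -[X in _ - X]Ec -RintegralB//.
have mB : measurable_fun setT (fun w => f w - c) by exact: measurable_funB.
have intB : P.-integrable setT (EFin \o (fun w => f w - c)).
  by apply: (bdd _ (C + C)) => // w; apply: (le_trans (ler_normB _ _)); exact: lerD.
apply: (le_trans (le_normr_Rintegral _ intB)) => //.
have int1 : P.-integrable setT (EFin \o (\1_G : Omega -> R)).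
  by apply: (bdd _ 1) => [|w]; [exact: measurable_indic|rewrite indicE; case: (_ \in _); rewrite ?normr1 ?normr0].
have intr : P.-integrable setT (EFin \o (fun w => 2 * C * \1_G w)).
  apply: (bdd _ (2 * C)) => [|w]; first by apply: measurable_funM => //; exact: measurable_indic.
  by rewrite indicE; case: (_ \in _); rewrite ?mulr1 ?mulr0 ?normr0 ?ger0_norm//; lra.
have inte : P.-integrable setT (EFin \o cst e) by apply: (bdd _ `|e|).
(* The error is at most [e] off [G] and, both terms being bounded by [C], at most [2 * C] on [G]. *)
apply: (@le_trans _ _ (\int[P]_w (e + 2 * C * \1_G w))).
  apply: le_Rintegral => //.
  - apply: (bdd _ (C + C)) => [|w].
      exact: measurableT_comp mB.
    by rewrite normr_id; apply: (le_trans (ler_normB _ _)); exact: lerD.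
  - apply: (bdd _ (e + 2 * C)) => [|w].
      by apply: measurable_funD => //; apply: measurable_funM => //; exact: measurable_indic.
    by rewrite indicE; case: (_ \in _); rewrite ?mulr1 ?mulr0 ger0_norm//; lra.
  - move=> w _; rewrite indicE; have [wG|wG] := pselect (G w).
      rewrite mem_set// mulr1; apply: (le_trans (ler_normB _ _)).
      by have := fC w; lra.
    by rewrite memNset// mulr0 addr0; exact: near.
rewrite RintegralD// RintegralZl// Rintegral_cst// [X in fine X]probability_setT mulr1 lerD2l.
rewrite ler_wpM2l ?mulr_ge0// /Rintegral integral_indic// setIT -lee_fin fineK//.
exact: fin_num_measure.
Qed.

(** A neighbourhood in the path topology involves finitely many pseudometrics; a finite union of
    bounded sets is bounded, so one exceptional set serves them all. *)
Lemma uniform_lln_finite (R : realType) (d : nat) (rho0 : 'rV[R]_d -> R)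
    (rho : 'rV[R]_d -> R -> R) (T : R) (k : nat) (Bs : nat -> set (testfn R d)) :
  continuous rho0 -> torus_periodic rho0 -> heat_sol rho0 rho -> 0 < T ->
  (forall j, (j < k)%N -> bounded_set (Bs j)) ->
  uniform_lln rho0 rho T (\bigcup_(j in [set j | (j < k)%N]) Bs j).
Proof.
move=> crho0 prho0 hrho T0 bB; apply: uniform_lln_bounded => //; split.
  by move=> phi [j /= jk]; exact: (bB j jk).1.
move=> s; have H (j : 'I_k) := (bB j (ltn_ord j)).2 s.
have [c Hc] := choice H.
exists (\sum_j `|c j|) => phi [j /= jk Bphi] l b x.
apply: (le_trans (Hc (Ordinal jk) phi Bphi l b x)); apply: (le_trans (ler_norm _)).
by rewrite (bigD1 (Ordinal jk))//= lerDl sumr_ge0.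
Qed.

Theorem theorem6p3 (R : realType) (d : nat) (T : R)
  (rho0 : 'rV[R]_d -> R) (rho : 'rV[R]_d -> R -> R)
  (M : nat -> nat) (kappa : R)
  (dO : nat -> measure_display) (Omega : forall n : nat, measurableType (dO n))
  (P : forall n : nat, probability (Omega n) R)
  (X : forall n : nat, R -> Omega n -> state d (M n)) :
  (0 < d)%N -> 0 < T ->
  continuous rho0 -> torus_periodic rho0 -> (forall x, 0 <= rho0 x) ->
  (exists x, rho0 x != 0) ->
  heat_sol rho0 rho ->
  (* eps_n = 1/(M n + 1) -> 0 *)
  (fun n => eps R (M n)) @ \oo --> 0 ->
  (* eps^(d/2) n -> oo *)
  (fun n => Num.sqrt (eps R (M n) ^+ d) * n%:R) @ \oo --> +oo ->
  (* eps^d n -> kappa in [0, 1/||rho0||_L1) *)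
  (fun n => eps R (M n) ^+ d * n%:R) @ \oo --> kappa ->
  0 <= kappa -> kappa < (torint (fun x => `|rho0 x|))^-1 ->
  (forall n (x : site d (M n)), init_param rho0 n x <= 1) ->
  (forall n, is_markov (@exclusion_jumps R d (M n)) (P n) (X n)
                       (init_law rho0 n)) ->
  forall F : (R -> testfn R d -> R) -> R,
    SM_bounded T F -> SM_continuous T F ->
    (forall n, measurable_fun setT
                 (fun w => F (collision_number n (fun t => X n t w)))) /\
    (fun n => (\int[P n]_w (F (collision_number n (fun t => X n t w)))%:E)%E)
      @ \oo --> (F (collision_limit rho))%:E.
Proof.
move=> _ T0 crho0 prho0 _ _ hrho eps0 scale _ _ _ _ XP F [C0 FC0] cF.
have inD n w : in_D T (collision_number n (fun t => X n t w)).
  by have [_ [Xr [Xl _]]] := XP n; exact: in_D_collision_number (Xr w) (Xl w).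
have mF n : measurable_fun setT (fun w => F (collision_number n (fun t => X n t w))).
  have [mX [Xr [Xl _]]] := XP n; exact: (measurable_path_functional n T0 cF mX Xr Xl).
split=> //.
have [K _ rhoK] := heat_bounded crho0 prho0 hrho.
have inDc : in_D T (collision_limit rho) := in_D_collision_limit crho0 prho0 hrho rhoK T.
pose C := `|C0| + 1.
have Cp : 0 < C by rewrite ltr_wpDl.
have FC xi : in_D T xi -> `|F xi| <= C.
  by move=> /FC0/le_trans; apply; apply: (le_trans (ler_norm _)); rewrite lerDl.
have main e : 0 < e -> \forall n \near \oo,
    (\int[P n]_w (F (collision_number n (fun t => X n t w)))%:E \is a fin_num)%E /\
    `|\int[P n]_w (F (collision_number n (fun t => X n t w))) - F (collision_limit rho)| <= e.
  move=> e0; have e20 : 0 < e / 2 by rewrite divr_gt0.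
  have [k [Bs [delta [delta0 [bB Hd]]]]] := cF _ inDc _ e20.
  (* The exceptional set is charged [2 * C] times its probability, here at most [e / 2]. *)
  have b0 : 0 < e / 2 / (2 * C) by rewrite !divr_gt0// mulr_gt0.
  have [r r0 Hr] := uniform_lln_finite crho0 prho0 hrho T0 bB (divr_gt0 delta0 (ltr0n _ 2)) b0.
  (* A number above 1 and [r^-1] has its square above [r^-1]; its positivity also forces [n > 0]. *)
  pose A := Num.max 1 r^-1.
  have A1 : 1 <= A by rewrite le_max lexx.
  have Ar : r^-1 <= A by rewrite le_max lexx orbT.
  have near1 : \forall n \near \oo, A < Num.sqrt (eps R (M n) ^+ d) * n%:R.
    by have /cvgryPgt/(_ A) := scale.
  have near2 : \forall n \near \oo, eps R (M n) < r.
    have /cvgrPdist_lt/(_ _ r0) := eps0; apply: filterS => n; rewrite sub0r normrN.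
    exact: le_lt_trans (ler_norm _).
  apply: filterS2 near1 near2 => n big small.
  have ed0 : 0 < eps R (M n) ^+ d by rewrite exprn_gt0// eps_gt0.
  have n0 : (0 < n)%N.
    rewrite lt0n; apply/eqP => nE; move: big; rewrite nE mulr0; lra.
  have sc : (eps R (M n) ^+ d * n%:R ^+ 2)^-1 < r.
    have -> : eps R (M n) ^+ d * n%:R ^+ 2 = (Num.sqrt (eps R (M n) ^+ d) * n%:R) ^+ 2.
      by rewrite exprMn sqr_sqrtr// ltW.
    move: big; set z := _ * _ => big.
    have z2 : r^-1 < z ^+ 2.
      apply: (le_lt_trans Ar); apply: (lt_le_trans big).
      by rewrite expr2 ler_peMl//; lra.
    by rewrite -[ltRHS]invrK ltf_pV2 ?posrE ?exprn_gt0 ?invr_gt0//; lra.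
  have [G [mG PG HG]] := Hr n (M n) (dO n) (Omega n) (P n) (X n) (XP n) n0 small sc.
  have near w : ~ G w -> `|F (collision_number n (fun t => X n t w)) - F (collision_limit rho)| <= e / 2.
    move=> Gw; rewrite distrC; apply/ltW/Hd => // j jk.
    apply: (@le_lt_trans _ _ (delta / 2)%:E); last by rewrite lte_fin; lra.
    apply: dB_id_le => t tT phi Bphi; rewrite distrC; apply: HG => //.
    by exists j.
  have [fin dist] := expectation_near (mF n) (fun w => FC _ (inD n w)) (FC _ inDc) mG PG (ltW e20) near.
  split=> //; apply: (le_trans dist).
  by rewrite (mulrC (2 * C)) divfK ?lt0r_neq0 ?mulr_gt0//; lra.
(* Convergence in the extended reals splits into eventual finiteness, which [main] records, and
   convergence of the real values. *)
apply/fine_cvgP; split; first by apply: filterS (main 1 ltr01) => n [].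
apply/cvgrPdist_le => e e0; apply: filterS (main e e0) => n [_].
by rewrite distrC.
Qed.
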